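(* The algorithm Approx2 (defined in the context) runs in $O(|V|^8)$ time on an input graph $G=(V,E)$ and is a $2$-approximation algorithm for the Max-$4$ path cover problem: for every input graph and every execution, the returned collection consists of vertex-disjoint paths of order at least $4$ and covers at least $\mathrm{OPT}/2$ vertices, where $\mathrm{OPT}$ is the maximum number of vertices coverable by vertex-disjoint paths of order at least $4$. Moreover, $\frac{16}{9}$ is a lower bound on its performance ratio: there is an input graph and an execution of Approx2 whose output covers exactly $\frac{9}{16}\mathrm{OPT}$ vertices.
   Context: All graphs are simple and undirected; $G=(V,E)$ is the input graph, $n=|V|$. The order of a path is its number of vertices; an $\ell$-path is a path of order $\ell$. The Max-$4$ path cover problem asks, given $G$, for a collection of vertex-disjoint paths in $G$, each of order at least $4$, covering the maximum number of vertices. Vertex naming on a path: for a path $P$ of order $\ell\ge 4$, pick one endpoint; $u_j$ is the vertex at distance $j$ from it ($0\le j\le\lceil\ell/2\rceil-1$), $v_j$ the vertex at distance $j$ from the other endpoint ($0\le j\le\lfloor\ell/2\rfloor-1$); either endpoint may serve as $u_0$. For a collection $\mathcal{P}$ of vertex-disjoint paths, $V(\mathcal{P})$ is the union of their vertex sets, $R=V\setminus V(\mathcal{P})$. For $v\in V(\mathcal{P})$, an extension $e(v)$ is a path in $G[R]$ with an endpoint adjacent to $v$ in $G$ (the empty path of order 0 is allowed); $n(e(v))$ is its order. Operations (with $k=4$): (Add) If $G[V\setminus V(\mathcal{P})]$ contains a $4$-path, add it. (Rep) If for some $P\in\mathcal{P}$, index $t$ and extension $e(u_t)$ with $n(e(u_t))\ge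 t+1$, replace the prefix $u_0$-$\cdots$-$u_{t-1}$ by $e(u_t)$; symmetrically for $v_t$. (DoubleRep) For $P\in\mathcal{P}$: (i) indices $j\ge t+1$ and vertex-disjoint extensions $e(u_t),e(u_j)$ with $n(e(u_t))\ge 4-(t+1)$, $n(e(u_j))\ge 4-(n(P)-j)$: replace $P$ by $u_0$-$\cdots$-$u_t$-$e(u_t)$ and $e(u_j)$-$u_j$-$\cdots$-$v_0$; or (ii) indices $t,j$ and vertex-disjoint $e(u_t),e(v_j)$ with $n(e(u_t))\ge 4-(t+1)$, $n(e(v_j))\ge 4-(j+1)$: replace $P$ by $u_0$-$\cdots$-$u_t$-$e(u_t)$ and $e(v_j)$-$v_j$-$\cdots$-$v_0$. (Re-cover) For two paths $P,P'\in\mathcal{P}$ both of order at least $5$ such that $V(P)\cup V(P')$ is exactly covered by a set of vertex-disjoint paths of $G$ each of order at least $4$, at least one of order exactly $4$: replace $P,P'$ by these paths. (Look-ahead) For $P\in\mathcal{P}$ with an index $t\in\{2,3\}$ and an extension $e(u_t)$ with $n(e(u_t))=t$: (i) if replacing $P$ by the path $e(u_t)$-$u_t$-$\cdots$-$v_1$-$v_0$ (or, when $u_t$ is the center vertex of $P$, i.e. $n(P)\in\{5,7\}$, alternatively by $u_0$-$\cdots$-$u_t$-$e(u_t)$) makes a Rep operation applicable, perform this replacement and then that Rep; (ii) if $n(P)=6$, $t=2$, and one of $v_0,v_2$ is adjacent to a vertex $w$ that lies on $e(u_2)$, or on $u_0$-$u_1$, or on another path of $\mathcal{P}$ at distance at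 most $1$ from one of its ends, replace $P$ by $u_0$-$u_1$-$u_2$-$e(u_2)$ and then use $v_0$-$v_1$-$v_2$ as an extension at $w$ to perform a Rep. The same applies symmetrically with the roles of the $u$'s and $v$'s exchanged. Algorithm Approx2: start with $\mathcal{P}=\emptyset$; repeatedly check, in the order Add, Rep, DoubleRep, Re-cover, Look-ahead, whether an operation is applicable and if so apply it, breaking any path of order $8$ or more into two paths one of which is a $4$-path so that all paths have order between $4$ and $7$; when none is applicable, return $\mathcal{P}$. *)

(* Defs.v *)
From mathcomp Require Import all_boot.

Set Implicit Arguments.
Unset Strict Implicit.
Unset Printing Implicit Defensive.

Record sgraph (T : finType) := SGraph {
  adj :> rel T;
  adj_sym : symmetric adj;
  adj_irr : irreflexive adj }.

(* A path is the sequence of its vertices, its order is [size], and it is the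
   same path as its reversal.  A collection of paths is a sequence of such
   sequences; it stands for a set, so the relations below look at it only up to
   [perm_eq] and up to the orientation of its members (see [takes]). *)
Definition coll (T : Type) := seq (seq T).

Section Approx2.
Variables (T : finType) (G : sgraph T).
Implicit Types (P Q N : coll T) (p q e pre suf : seq T) (x w : T).

Definition gpath p := uniq p && sorted G p.

Definition feasible P :=
  uniq (flatten P) && all (fun p => gpath p && (4 <= size p)) P.

Definition covered P : {set T} := [set x in flatten P].

Definition is_opt (m : nat) :=
  (exists2 Q, feasible Q & #|covered Q| = m) /\
  (forall Q, feasible Q -> #|covered Q| <= m).

(* [p] is a member of [P] read from one of its two ends, and [Q] consists of
   the other members.  If [p] is read from its end u_0 then u_t is the vertex
   at position t, for t < uphalf (size p) = ceil (size p / 2); reading the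
   path from the other end exchanges the roles of the u's and the v's. *)
Definition takes P p Q := perm_eq P (p :: Q) \/ perm_eq P (rev p :: Q).

(* [e] lists an extension e(x) starting with its vertex adjacent to [x]; it may
   be empty. *)
Definition extension P x e :=
  [&& path G x e, uniq e & all (fun y => y \notin flatten P) e].

Definition add P P' :=
  exists p, [/\ size p = 4, gpath p, all (fun y => y \notin flatten P) p
              & P' = p :: P].

(* Rep at the vertex x = u_t with the extension e; here t = size pre. *)
Definition rep_at P x e P' :=
  exists pre suf Q,
    [/\ takes P (pre ++ x :: suf) Q,
        size pre < uphalf (size (pre ++ x :: suf)),
        extension P x e,
        (size pre).+1 <= size e
      & P' = (rev e ++ x :: suf) :: Q].

Definition rep P P' := exists x e, rep_at P x e P'.

(* x = u_t and y are two vertices of the path, y farther from u_0 than x.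
   Either y = u_j (case (i)), or y = v_j (case (ii)).  Both cases ask
   that the extension of y have order at least 4 minus the number
   (size suf).+1 of vertices from y to v_0, this number being
   n(P) - j in case (i) and j + 1 in case (ii). *)
Definition double_rep P P' :=
  exists pre x mid y suf Q e f,
    let p := pre ++ x :: mid ++ y :: suf in
    [/\ takes P p Q, size pre < uphalf (size p),
        [/\ extension P x e, extension P y f & uniq (e ++ f)],
        4 - (size pre).+1 <= size e /\ 4 - (size suf).+1 <= size f
      & P' = (pre ++ x :: e) :: (rev f ++ y :: suf) :: Q].

Definition recover P P' :=
  exists p q Q N,
    [/\ perm_eq P (p :: q :: Q), 5 <= size p /\ 5 <= size q,
        feasible N /\ perm_eq (flatten N) (p ++ q),
        has (fun r => size r == 4) N
      & P' = N ++ Q].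

Definition near_end w q := (w \in take 2 q) || (w \in take 2 (rev q)).

(* The path pre ++ x :: suf is u_0 ... u_t ... v_1 v_0 with x = u_t. *)
Definition look_ahead_i Q pre x suf e P' :=
  exists p1,
    (p1 = rev e ++ x :: suf \/ size pre = size suf /\ p1 = pre ++ x :: e) /\
    rep (p1 :: Q) P'.

(* Here pre = u_0 u_1, x = u_2 and suf = v_2 v_1 v_0; the extension f at w
   is suf, starting at v_2, or its reversal, starting at v_0. *)
Definition look_ahead_ii Q pre x suf e P' :=
  [/\ size pre = 2, size suf = 3
    & exists w f,
        [/\ f = suf \/ f = rev suf,
            [|| w \in e, w \in pre | has (near_end w) Q]
          & rep_at ((pre ++ x :: e) :: Q) w f P']].

Definition look_ahead P P' :=
  exists pre x suf Q e,
    let p := pre ++ x :: suf in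
    [/\ takes P p Q, size pre < uphalf (size p) /\ size pre \in [:: 2; 3],
        extension P x e, size e = size pre
      & look_ahead_i Q pre x suf e P' \/ look_ahead_ii Q pre x suf e P'].

(* Breaking is repeated until every path has order at most 7.  As [takes]
   reads the path from either end, the 4-path is cut off at any end. *)
Inductive broken : coll T -> coll T -> Prop :=
| Broken_done P P' :
    all (fun p => size p <= 7) P -> perm_eq P P' -> broken P P'
| Broken_split P p Q P' :
    takes P p Q -> 8 <= size p ->
    broken (take 4 p :: drop 4 p :: Q) P' -> broken P P'.

Definition operation (i : nat) : coll T -> coll T -> Prop :=
  nth (fun _ _ => False) [:: add; rep; double_rep; recover; look_ahead] i.

Definition applicable (i : nat) P := exists P', operation i P P'.

Definition step P P' :=
  exists i P1, [/\ forall j, j < i -> ~ applicable j P,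
                   operation i P P1 & broken P1 P'].

Definition terminal P := forall i, ~ applicable i P.

Fixpoint steps P (s : seq (coll T)) : Prop :=
  if s is P' :: s' then step P P' /\ steps P' s' else True.

(* An execution, complete or not, goes through the empty collection and then
   through the members of [s]. *)
Definition execution (s : seq (coll T)) := steps [::] s.

Definition output (s : seq (coll T)) : coll T := last [::] s.

Definition complete_execution (s : seq (coll T)) :=
  execution s /\ terminal (output s).

End Approx2.

(* Machine model for running times: a random access machine, programmed in a
   structured language, whose memory consists of arrays of natural numbers
   (as many as the program text mentions) filled with 0 at the start, with
   constant-time access to the adjacency matrix of the input graph on the
   vertices 0, ..., n-1.  Every expression node and every executed
   instruction costs one unit.  The only arithmetic is successor, truncated
   subtraction and equality test, so that the numbers stored during t units of
   time are O(n + t) and fit in machine words; unit costs hide no work. *)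
Inductive expr :=
| Cst of nat
| NVert
| Read of nat & expr
| Succ of expr
| Sub of expr & expr
| Eq of expr & expr
| Edge of expr & expr.

Inductive cmd :=
| Skip
| Write of nat & expr & expr
| Print of expr
| Seq of cmd & cmd
| If of expr & cmd & cmd
| While of expr & cmd.

Definition memory := nat -> nat -> nat.

Definition mem0 : memory := fun _ _ => 0.

Definition update (m : memory) (a i v : nat) : memory :=
  fun b j => if (b == a) && (j == i) then v else m b j.

Section Machine.
Variables (n : nat) (G : sgraph 'I_n).

Definition edge_query (i j : nat) : nat :=
  [exists x : 'I_n, exists y : 'I_n, [&& x == i :> nat, y == j :> nat & G x y]].

Fixpoint eval (m : memory) (e : expr) : nat :=
  match e with
  | Cst k => k
  | NVert => n
  | Read a e1 => m a (eval m e1)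
  | Succ e1 => (eval m e1).+1
  | Sub e1 e2 => eval m e1 - eval m e2
  | Eq e1 e2 => eval m e1 == eval m e2
  | Edge e1 e2 => edge_query (eval m e1) (eval m e2)
  end.

Fixpoint ecost (e : expr) : nat :=
  match e with
  | Cst _ | NVert => 1
  | Read _ e1 | Succ e1 => (ecost e1).+1
  | Sub e1 e2 | Eq e1 e2 | Edge e1 e2 => (ecost e1 + ecost e2).+1
  end.

(* [exec c m m' out t]: started in memory m, the program c halts after t units
   of time in memory m', having printed out.  A guard holds when nonzero. *)
Inductive exec : cmd -> memory -> memory -> seq nat -> nat -> Prop :=
| Exec_skip m : exec Skip m m [::] 1
| Exec_write a e1 e2 m :
    exec (Write a e1 e2) m (update m a (eval m e1) (eval m e2))
      [::] (ecost e1 + ecost e2).+1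
| Exec_print e m : exec (Print e) m m [:: eval m e] (ecost e).+1
| Exec_seq c1 c2 m1 m2 m3 o1 o2 t1 t2 :
    exec c1 m1 m2 o1 t1 -> exec c2 m2 m3 o2 t2 ->
    exec (Seq c1 c2) m1 m3 (o1 ++ o2) (t1 + t2).+1
| Exec_if e c1 c2 m m' o t :
    exec (if eval m e != 0 then c1 else c2) m m' o t ->
    exec (If e c1 c2) m m' o (ecost e + t).+1
| Exec_while_end e c m :
    eval m e = 0 -> exec (While e c) m m [::] (ecost e).+1
| Exec_while_loop e c m1 m2 m3 o1 o2 t1 t2 :
    eval m1 e != 0 -> exec c m1 m2 o1 t1 -> exec (While e c) m2 m3 o2 t2 ->
    exec (While e c) m1 m3 (o1 ++ o2) (ecost e + t1 + t2).+1.

(* Each sequence is preceded by its length, so the encoding is injective. *)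
Definition encode_path (p : seq 'I_n) : seq nat :=
  size p :: [seq val x | x <- p].

Definition encode_coll (P : coll 'I_n) : seq nat :=
  size P :: flatten [seq encode_path p | p <- P].

Definition encode_execution (s : seq (coll 'I_n)) : seq nat :=
  flatten [seq encode_coll P | P <- [::] :: s].

End Machine.

(* Main.v *)
Require Import Defs.
From mathcomp Require Import all_boot.
From mathcomp Require Import zify.
From Stdlib Require Import Classical.

(** Running time.  Every operation increases the sum of twice the number of
    covered vertices and of the number of 4-paths, which is at most 3n, so that
    an execution has at most 3n steps.
    Once the earlier operations are inapplicable, an application of any
    operation is determined by at most 7 choices among at most n paths and
    vertices, and up to renaming there are finitely many shapes of such
    applications.  The program has one rule per shape and searches for an
    instance of each rule by at most 7 nested loops.

    Ratio.  Fix an optimal collection O.  A vertex at distance t from the nearer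
    end of its path starts no extension of order more than t, which bounds the
    maximal segments of uncovered vertices next to it on O.  Charge each segment
    to the covered vertices at its ends: evenly, except that the center of a
    path of order 7 takes the whole segment from any other vertex.  A path then
    is charged at most its order, unless the center of a path of order 5, 6 or 7
    has its largest possible charge and the second vertex from an end u_0 is
    charged one vertex.  In that case the inapplicability of Look-ahead and
    Re-cover forces u_0 to have a neighbor on O in the inner part of a path that
    can afford to pay half a vertex.

    Lower bound.  One path of order 5 and one of order 4 whose inner vertices
    are joined to 7 pairwise nonadjacent uncovered vertices. *)
Set Implicit Arguments.
Unset Strict Implicit.
Unset Printing Implicit Defensive.

(** * The potential of a collection *)

(** The ratio is computed in half vertices, so that all charges are integers. Most path orders have
    cases that use up the whole budget of a path, hence a separate analysis for each order. A bad
    end, the end [u_0] of the critical case, receives one unit, and this unit is just what an inner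
    vertex next to it on O pays, so these units cancel in the sum over all paths.

    For the running time, an explicit list of shapes would be long, and a direct count for
    Look-ahead gives more than 7 choices. The list is avoided by starting from all rules of bounded
    size and keeping, by excluded middle, those whose every match in every graph is an application
    of the operation. The result depends neither on the graph nor on its order, and only the
    existence of a program is claimed. The surplus choices are excluded by the inapplicability of
    Add, Rep and DoubleRep, which the prescribed order of the checks supplies. The number of steps
    contributes the eighth factor. *)

Ltac bool_lia :=
  repeat match goal with
  | |- context [nat_of_bool ?b] => move: (nat_of_bool b) => ?
  end; lia.

(* The instances of [size] at convertible but distinct carriers would be
   different atoms for [lia]. *)
Ltac size_lia :=
  repeat match goal with
  | H : is_true (leq _ _) |- _ => revert H
  | H : @eq _ ?a ?b |- _ => change (@eq nat a b) in H; revert H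
  end;
  repeat match goal with
  | |- context [@size ?A ?s] => move: (@size A s) => ?
  end; clear; lia.

Section Collections.
Variables (T : finType) (G : sgraph T).
Implicit Types (P Q N : coll T) (p q e pre suf : seq T) (x w : T).

Lemma adjC x y : G x y = G y x.
Proof. exact: adj_sym. Qed.

Lemma sorted_revG p : sorted G (rev p) = sorted G p.
Proof.
rewrite rev_sorted; case: p => //= x p.
by apply: eq_path => y z; rewrite adjC.
Qed.

Lemma sorted_around pre x suf :
  sorted G (pre ++ x :: suf) = path G x (rev pre) && path G x suf.
Proof.
case: pre => [|a pre] //=.
rewrite -cat_rcons cat_path last_rcons; congr (_ && _).
rewrite -(belast_rcons a pre x) -{2}(last_rcons a pre x) rev_path.
by apply: eq_path => y z; rewrite adjC.
Qed.

(** Simplicity of the single paths follows from [uniq (flatten P)], so that only one global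
    condition has to be preserved. *)
Definition long p := sorted G p && (4 <= size p).

Lemma feasibleE P : feasible G P = uniq (flatten P) && all long P.
Proof.
rewrite /feasible; case U: (uniq _) => //=; apply: eq_in_all => p Pp.
suff up: uniq p by rewrite /gpath up.
case/splitPr: Pp U => P1 P2.
by rewrite flatten_cat /= !cat_uniq => /and3P[_ _ /and3P[]].
Qed.

Lemma perm_feasible P P' : perm_eq P P' -> feasible G P = feasible G P'.
Proof.
by move=> PP'; rewrite !feasibleE (perm_all _ PP') (perm_uniq (perm_flatten PP')).
Qed.

Lemma feasible_rev p Q : feasible G (rev p :: Q) = feasible G (p :: Q).
Proof.
rewrite !feasibleE /= /long sorted_revG size_rev; congr (_ && _).
by apply: perm_uniq; rewrite perm_cat2r perm_rev.
Qed.

Definition num4 P := count (fun p => size p == 4) P.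

(* Re-cover keeps the covered vertices; any other operation covers more vertices
   and destroys at most one 4-path. *)
Definition potential P := 2 * size (flatten P) + num4 P.

Lemma perm_potential P P' : perm_eq P P' -> potential P = potential P'.
Proof.
move=> PP'; rewrite /potential (perm_size (perm_flatten PP')).
by congr (_ + _); apply/permP.
Qed.

Lemma takes_perm P p Q : takes P p Q -> perm_eq (flatten P) (p ++ flatten Q).
Proof.
by case=> /perm_flatten/perm_trans; apply; rewrite //= perm_cat2r perm_rev.
Qed.

Lemma takes_feasible P p Q : takes P p Q -> feasible G P = feasible G (p :: Q).
Proof. by case=> /perm_feasible->; rewrite ?feasible_rev. Qed.

Lemma takes_potential P p Q : takes P p Q -> potential P = potential (p :: Q).
Proof.
by case=> /perm_potential->; rewrite /potential /num4 /= ?size_cat ?size_rev.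
Qed.

Lemma takes_small P p Q : takes P p Q ->
  all (fun q => size q <= 7) P = all (fun q => size q <= 7) (p :: Q).
Proof. by case=> /perm_all->; rewrite /= ?size_rev. Qed.

Lemma takes_rev P p Q : takes P p Q -> takes P (rev p) Q.
Proof. by case=> H; [right; rewrite revK | left]. Qed.

Lemma extensionP P x e :
  extension G P x e ->
  [/\ path G x e, uniq e & {in e, forall y, y \notin flatten P}].
Proof. by case/and3P=> -> -> /allP. Qed.

(** Every replacement keeps a subsequence [B] of the old vertex list [W] and adds vertices outside
    [W]; this is the common disjointness argument. *)
Lemma uniq_fresh (W e B : seq T) :
  uniq W -> subseq B W -> uniq e -> {in e, forall y, y \notin W} ->
  uniq (e ++ B).
Proof.
move=> uW sBW ue De; rewrite cat_uniq ue (subseq_uniq sBW uW) andbT.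
by apply/hasPn=> z /(mem_subseq sBW) zW; apply/negP => /De; rewrite zW.
Qed.

Lemma rep_at_feasible P x e P' :
  rep_at G P x e P' -> feasible G P -> feasible G P'.
Proof.
case=> pre [suf [Q [tk _ /extensionP[pe ue De] le ->]]].
rewrite (takes_feasible tk) !feasibleE /= /long.
rewrite !sorted_around revK pe /= => /andP[U /andP[/andP[/andP[_ ->] s4] ->]].
rewrite andbT; apply/andP; split; last first.
  by move: s4; rewrite !size_cat /= size_rev; lia.
have {}De : {in rev e, forall y, y \notin (pre ++ x :: suf) ++ flatten Q}.
  by move=> y; rewrite mem_rev => /De; rewrite (perm_mem (takes_perm tk)).
rewrite -catA; apply: (uniq_fresh U) De; rewrite ?rev_uniq //.
by rewrite -catA; apply: suffix_subseq.
Qed.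

(** The estimate is quantitative because the Rep that ends a Look-ahead must make up for a previous
    loss. The term 1 stands for a 4-path that may disappear. *)
Lemma rep_at_potential P pre x suf e Q :
  takes P (pre ++ x :: suf) Q ->
  potential ((rev e ++ x :: suf) :: Q) + 2 * size pre + 1
    >= potential P + 2 * size e.
Proof.
move=> tk; rewrite (takes_potential tk) /potential /num4 /= !size_cat size_rev /=.
by case: (_ == 4); lia.
Qed.

Lemma rep_feasible P P' : rep G P P' -> feasible G P -> feasible G P'.
Proof. by case=> x [e /rep_at_feasible]. Qed.

Lemma rep_potential P P' : rep G P P' -> potential P < potential P'.
Proof.
case=> x [e [pre [suf [Q [tk _ _ le ->]]]]].
by have := rep_at_potential e tk; lia.
Qed.

Lemma add_feasible P P' : add G P P' -> feasible G P -> feasible G P'.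
Proof.
case=> p [p4 /andP[up sp] /allP Dp ->].
rewrite !feasibleE /= /long sp p4 /= cat_uniq up => /andP[-> ->].
by rewrite !andbT; apply/hasPn=> z zP; apply/negP=> /Dp; rewrite zP.
Qed.

Lemma add_potential P P' : add G P P' -> potential P < potential P'.
Proof. by case=> p [p4 _ _ ->]; rewrite /potential /num4 /= size_cat p4; lia. Qed.

Lemma double_rep_feasible P P' :
  double_rep G P P' -> feasible G P -> feasible G P'.
Proof.
case=> pre [x [mid [y [suf [Q [e [f [tk _]]]]]]]].
case=> /extensionP[pe _ De] /extensionP[pf _ Df] uef [le lf ->].
rewrite (takes_feasible tk) !feasibleE /= /long.
rewrite !sorted_around revK pe pf /= cat_path /=.
case/and3P=> U /andP[/and3P[-> _ /andP[_ ->]] _] ->.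
rewrite !andbT /=; apply/andP; split; last first.
  by rewrite !size_cat /= size_rev; lia.
have De' : {in e ++ f, forall z, z \notin (pre ++ x :: mid ++ y :: suf) ++ flatten Q}.
  by move=> z; rewrite mem_cat -(perm_mem (takes_perm tk)) => /orP[/De | /Df].
have uB : uniq ((e ++ f) ++ (pre ++ x :: y :: suf) ++ flatten Q).
  apply: (uniq_fresh U) De' => //; rewrite cat_subseq // cat_subseq //= eqxx.
  exact: suffix_subseq.
move: uB; congr (is_true _); apply: perm_uniq.
by apply/permP=> a; rewrite !(count_cat, =^~ cat_cons) /= ?count_cat /= !count_rev /=; lia.
Qed.

(** The two new paths have order at least 4 each, more than 7 vertices together: this is where the
    breaking of long paths enters. One more covered vertex outweighs the loss of one 4-path. *)
Lemma double_rep_potential P P' : all (fun q => size q <= 7) P ->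
  double_rep G P P' -> potential P < potential P'.
Proof.
move=> s7 [pre [x [mid [y [suf [Q [e [f [tk _ _ [le lf] ->]]]]]]]]].
move: s7; rewrite (takes_small tk) (takes_potential tk) /potential /num4 /=.
rewrite !(size_cat, size_rev) /= !(size_cat, size_rev) /= => /andP[s7 _].
by do 3!case: (_ == 4); lia.
Qed.

Lemma recover_feasible P P' : recover G P P' -> feasible G P -> feasible G P'.
Proof.
case=> p [q [Q [N [/perm_feasible-> _ [+ pN] _ ->]]]].
rewrite !feasibleE /= flatten_cat all_cat => /andP[uN ->] /and4P[U _ _ ->].
rewrite !andbT; move: U; rewrite catA; congr (is_true _); apply: perm_uniq.
by rewrite perm_cat2r perm_sym.
Qed.

Lemma recover_potential P P' : recover G P P' -> potential P < potential P'.
Proof.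
case=> p [q [Q [N [/perm_potential-> [lp lq] [_ pN] h4 ->]]]].
rewrite /potential /num4 /= flatten_cat count_cat !size_cat (perm_size pN) size_cat.
move: h4; rewrite has_count.
rewrite [size p == 4]gtn_eqF // [size q == 4]gtn_eqF //.
rewrite !add0n.
by move: (count _ N) (count _ Q) (size p) (size q) (size (flatten Q)) => *; lia.
Qed.

Lemma look_ahead_swap P pre x suf Q e :
  takes P (pre ++ x :: suf) Q -> extension G P x e -> size e = size pre ->
  feasible G P ->
  feasible G ((rev e ++ x :: suf) :: Q) /\
  potential ((rev e ++ x :: suf) :: Q) = potential P.
Proof.
move=> tk /extensionP[pe ue De] se; rewrite (takes_feasible tk) !feasibleE /= /long.
rewrite !sorted_around revK pe /= => /andP[U /andP[/andP[/andP[_ ->] s4] ->]].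
split; last first.
  by rewrite (takes_potential tk) /potential /num4 /= !size_cat size_rev se.
rewrite andbT; apply/andP; split; last by move: s4; rewrite !size_cat size_rev se.
have {}De : {in rev e, forall y, y \notin (pre ++ x :: suf) ++ flatten Q}.
  by move=> y; rewrite mem_rev => /De; rewrite (perm_mem (takes_perm tk)).
rewrite -catA; apply: (uniq_fresh U) De; rewrite ?rev_uniq //.
by rewrite -catA; apply: suffix_subseq.
Qed.

Lemma flatten_uniq_mem P p q w :
  uniq (flatten P) -> p \in P -> q \in P -> w \in p -> w \in q -> p = q.
Proof.
elim: P => //= r P IH; rewrite cat_uniq => /and3P[_ /hasPn D U].
have F s : s \in P -> w \in s -> w \in r = false.
  by move=> sP ws; apply/negbTE/D/flattenP; exists s.
rewrite !inE => /orP[/eqP-> | pP] /orP[/eqP-> | qP] // wp wq.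
- by rewrite (F _ qP wq) in wp.
- by rewrite (F _ pP wp) in wq.
exact: IH.
Qed.

Lemma takes_mem P p Q : takes P p Q -> p \in P \/ rev p \in P.
Proof. by case=> /perm_mem E; [left | right]; rewrite E inE eqxx. Qed.

Lemma takes_sub P p Q q : takes P p Q -> q \in Q -> q \in P.
Proof. by case=> /perm_mem-> qQ; rewrite inE qQ orbT. Qed.

Lemma near_end_rev w q : near_end w (rev q) = near_end w q.
Proof. by rewrite /near_end revK orbC. Qed.

Lemma near_endE w pre suf : uniq (pre ++ w :: suf) ->
  near_end w (pre ++ w :: suf) = (size pre <= 1) || (size suf <= 1).
Proof.
have H (A B : seq T) : uniq (A ++ w :: B) ->
    (w \in take 2 (A ++ w :: B)) = (size A <= 1).
  case: A => [|a [|b A]] /=; rewrite !inE ?eqxx ?orbT //.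
  rewrite take0 !mem_cat !inE orbF ![w == _]eq_sym.
  by case/and3P=> /norP[_ /norP[_ /norP[/negbTE-> _]]] /norP[_ /norP[/negbTE->]].
move=> U; rewrite /near_end H //; congr (_ || _).
rewrite rev_cat rev_cons cat_rcons H ?size_rev //.
by rewrite -cat_rcons -rev_cons -rev_cat rev_uniq.
Qed.

Lemma near_end_takes P pre suf Q w q :
  feasible G P -> takes P (pre ++ w :: suf) Q -> q \in P -> w \in q ->
  near_end w q = (size pre <= 1) || (size suf <= 1).
Proof.
rewrite feasibleE => /andP[U _] tk qP wq.
have wp : w \in pre ++ w :: suf by rewrite mem_cat inE eqxx orbT.
have up : uniq (pre ++ w :: suf).
  by move: U; rewrite (perm_uniq (takes_perm tk)) cat_uniq => /andP[].
rewrite -(near_endE up); case: (takes_mem tk) => pP.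
  by rewrite (flatten_uniq_mem U qP pP wq wp).
by rewrite (flatten_uniq_mem U qP pP wq) ?mem_rev ?near_end_rev.
Qed.

Lemma near_end_mem w q : near_end w q -> w \in q.
Proof. by case/orP=> /mem_take; rewrite ?mem_rev. Qed.

(* Only the positions 0 and 1 of a path are near its end as soon as the path
   has order at least 4 and is read from the end nearer to w. *)
Lemma near_end_rep w f P' P :
  feasible G P -> has (near_end w) P -> rep_at G P w f P' ->
  exists pre suf Q',
    [/\ takes P (pre ++ w :: suf) Q', size pre <= 1, extension G P w f,
        (size pre).+1 <= size f & P' = (rev f ++ w :: suf) :: Q'].
Proof.
move=> fP /hasP[q qP nq] [pre [suf [Q' [tk half ext le ->]]]].
exists pre, suf, Q'; split=> //.
have := near_end_takes fP tk qP (near_end_mem nq); rewrite nq.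
move: fP; rewrite (takes_feasible tk) feasibleE /= /long => /and3P[_ /andP[_ s4] _].
by move: half s4; rewrite size_cat /=; lia.
Qed.

(** A path of order 6 becomes one of order 5: one covered vertex is lost, which is worth 2. *)
Lemma look_ahead_ii_near P pre x suf Q e :
  takes P (pre ++ x :: suf) Q -> extension G P x e -> size e = size pre ->
  feasible G P -> size pre = 2 -> size suf = 3 ->
  feasible G ((pre ++ x :: e) :: Q) /\
  potential P = potential ((pre ++ x :: e) :: Q) + 2.
Proof.
move=> tk /extensionP[pe ue De] se; rewrite (takes_feasible tk) !feasibleE /= /long.
rewrite !sorted_around pe /= => /andP[U /andP[/andP[/andP[-> _] s4] ->]] p2 s3.
split; last first.
  by rewrite (takes_potential tk) /potential /num4 /= !size_cat /= se p2 s3; lia.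
rewrite andbT; apply/andP; split; last by rewrite !size_cat /= se p2.
have {}De : {in e, forall y, y \notin (pre ++ x :: suf) ++ flatten Q}.
  by move=> y /De; rewrite (perm_mem (takes_perm tk)).
have : uniq (e ++ (pre ++ [:: x]) ++ flatten Q).
  apply: (uniq_fresh U) De => //; rewrite cat_subseq // cat_subseq //=.
  by rewrite eqxx sub0seq.
congr (is_true _); apply: perm_uniq.
by apply/permP=> a; rewrite !count_cat /= ?count_cat /=; lia.
Qed.

Lemma look_ahead_ii_end (pre : seq T) x e Q w : size pre = 2 -> size e = 2 ->
  [|| w \in e, w \in pre | has (near_end w) Q] ->
  has (near_end w) ((pre ++ x :: e) :: Q).
Proof.
move=> p2 e2 /or3P[H|H|H] /=; last by rewrite H orbT.
  rewrite /near_end rev_cat rev_cons cat_rcons [take 2 (rev e ++ _)]take_size_cat ?size_rev //.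
  by rewrite mem_rev H orbT.
by rewrite /near_end take_size_cat // H.
Qed.

Lemma perm_cons_swap (S : eqType) (a b : S) s : perm_eq (a :: b :: s) (b :: a :: s).
Proof. exact: (permEl (perm_catCA [:: a] [:: b] s)). Qed.

Lemma perm_cons2 (S : eqType) (a b : S) s t : perm_eq (a :: s) (b :: t) ->
  a = b /\ perm_eq s t \/ exists2 r, perm_eq s (b :: r) & perm_eq t (a :: r).
Proof.
move=> E; have : b \in a :: s by rewrite (perm_mem E) inE eqxx.
rewrite inE eq_sym; case: eqP => [ab _ | _ /= bs].
  by left; split=> //; rewrite -ab perm_cons in E.
right; exists (rem b s); first exact: perm_to_rem.
rewrite -(perm_cons b) perm_sym; apply: perm_trans E.
rewrite -[_ :: _ :: _]/([:: b; a] ++ rem b s) perm_sym.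
apply: (@perm_trans _ (a :: b :: rem b s)); first by rewrite perm_cons perm_to_rem.
exact: perm_cons_swap.
Qed.

Lemma takes_cons p Q q Q' : takes (p :: Q) q Q' ->
  (p = q \/ p = rev q) /\ perm_eq Q Q' \/
  exists2 Q0, takes Q q Q0 & perm_eq Q' (p :: Q0).
Proof.
case=> /perm_cons2[[pq QQ'] | [r Qr Q'r]].
- by left; split; [left|].
- by right; exists r; [left|].
- by left; split; [right|].
by right; exists r; [right|].
Qed.

(* Replacing P at its center by the other half is the first kind of
   replacement for the reversal of P. *)
Lemma rep_rev p Q P' : rep G (p :: Q) P' -> exists P'', rep G (rev p :: Q) P''.
Proof.
case=> x [e [pre [suf [Q' [tk half /and3P[pe ue De] le _]]]]].
have {}De : all (fun y => y \notin flatten (rev p :: Q)) e.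
  apply: etrans De; apply: eq_all => y.
  by rewrite /= !mem_cat mem_rev.
have [Q'' tk'] : exists Q'', takes (rev p :: Q) (pre ++ x :: suf) Q''.
  case: (takes_cons tk) => [[pq QQ'] | [Q0 tQ _]].
    by exists Q; case: pq => ->; [right | left; rewrite revK].
  exists (rev p :: Q0); case: tQ => E; [left | right].
    apply: (@perm_trans _ (rev p :: (pre ++ x :: suf) :: Q0)); first by rewrite perm_cons.
    exact: perm_cons_swap.
  apply: (@perm_trans _ (rev p :: rev (pre ++ x :: suf) :: Q0)); first by rewrite perm_cons.
  exact: perm_cons_swap.
exists ((rev e ++ x :: suf) :: Q''), x, e, pre, suf, Q''; split=> //.
by rewrite /extension pe ue.
Qed.

Lemma look_ahead_case P P' : look_ahead G P P' ->
  exists pre x suf Q e,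
  [/\ takes P (pre ++ x :: suf) Q,
      size pre < uphalf (size (pre ++ x :: suf)) /\ size pre \in [:: 2; 3],
      extension G P x e, size e = size pre
   & (exists P'', rep G ((rev e ++ x :: suf) :: Q) P'') \/
     look_ahead_ii G Q pre x suf e P'].
Proof.
case=> pre [x [suf [Q [e [tk [half t23] ext se [[p1 [p1E R]] | L]]]]]]; last first.
  by exists pre, x, suf, Q, e; split=> //; right.
case: p1E => [? | [ss p1E]]; first subst p1.
  by exists pre, x, suf, Q, e; split=> //; left; exists P'.
have E : rev (pre ++ x :: suf) = rev suf ++ x :: rev pre.
  by rewrite rev_cat rev_cons cat_rcons.
exists (rev suf), x, (rev pre), Q, e; split.
- by rewrite -E; apply: takes_rev.
- by move: half t23; rewrite !size_cat /= !size_rev ss.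
- by [].
- by rewrite size_rev -ss.
left; have [P'' R'] := rep_rev R; exists P''; move: R'.
by rewrite p1E rev_cat rev_cons cat_rcons.
Qed.

Lemma look_ahead_feasible P P' :
  look_ahead G P P' -> feasible G P -> feasible G P'.
Proof.
case=> pre [x [suf [Q [e [tk _ ext se [[p1 [p1E R]] | L]]]]]] fP.
  apply: rep_feasible R _; case: p1E => [->|[ss ->]].
    by case: (look_ahead_swap tk ext se fP).
  rewrite -feasible_rev rev_cat rev_cons cat_rcons.
  have tk' : takes P (rev suf ++ x :: rev pre) Q.
    by have := takes_rev tk; rewrite rev_cat rev_cons cat_rcons.
  by case: (look_ahead_swap tk' ext _ fP) => //; rewrite size_rev -ss.
case: L => p2 s3 [w [f [_ _ R]]]; apply: rep_at_feasible R _.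
by case: (look_ahead_ii_near tk ext se fP p2 s3).
Qed.

Lemma look_ahead_potential P P' :
  feasible G P -> look_ahead G P P' -> potential P < potential P'.
Proof.
move=> fP [pre [x [suf [Q [e [tk _ ext se [[p1 [p1E R]] | L]]]]]]].
  have <- : potential (p1 :: Q) = potential P; last exact: rep_potential R.
  case: p1E => [->|[ss ->]]; first by case: (look_ahead_swap tk ext se fP).
  have tk' : takes P (rev suf ++ x :: rev pre) Q.
    by have := takes_rev tk; rewrite rev_cat rev_cons cat_rcons.
  case: (look_ahead_swap tk' ext _ fP) => [|_ <-]; first by rewrite size_rev -ss.
  by rewrite /potential /num4 /= !size_cat /= !size_rev !addnS [size e + _]addnC.
case: L => p2 s3 [w [f [fE wH R]]]; move: R.
have [fP1 ->] := look_ahead_ii_near tk ext se fP p2 s3.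
have e2 : size e = 2 by rewrite se.
have f3 : size f = 3 by case: fE => ->; rewrite ?size_rev.
case/(near_end_rep fP1 (look_ahead_ii_end x p2 e2 wH)) => pre' [suf' [Q' [tk' p1 _ _ ->]]].
(* An extension of order 3 replaces at most one vertex: the gain of at least 6 - 2 - 1 = 3 exceeds
   the loss of 2. *)
by have := rep_at_potential f tk'; rewrite f3; lia.
Qed.

(** * Progress and length of executions *)

Definition admissible P := feasible G P && all (fun p => size p <= 7) P.

Lemma operation_feasible i P P' :
  operation G i P P' -> feasible G P -> feasible G P'.
Proof.
case: i => [|[|[|[|[|i]]]]] /=.
- exact: add_feasible.
- exact: rep_feasible.
- exact: double_rep_feasible.
- exact: recover_feasible.
- exact: look_ahead_feasible.
by rewrite /operation /= nth_nil.
Qed.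

Lemma operation_potential i P P' :
  operation G i P P' -> admissible P -> potential P < potential P'.
Proof.
move=> + /andP[fP sP]; case: i => [|[|[|[|[|i]]]]] /=.
- exact: add_potential.
- exact: rep_potential.
- exact: double_rep_potential.
- exact: recover_potential.
- exact: look_ahead_potential.
by rewrite /operation /= nth_nil.
Qed.

(** Cutting leaves the covered vertices alone, and the path that disappears has order at least 8, so
    the number of 4-paths does not drop. *)
Lemma broken_admissible P P' : broken P P' -> feasible G P ->
  admissible P' /\ potential P <= potential P'.
Proof.
elim=> {P P'} [P P' s7 PP'|P p Q P' tk s8 _ IH] fP.
  rewrite /admissible -(perm_feasible PP') fP -(perm_all _ PP') s7.
  by rewrite (perm_potential PP').
rewrite (takes_feasible tk) in fP; rewrite (takes_potential tk).
have fP1 : feasible G (take 4 p :: drop 4 p :: Q).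
  move: fP; rewrite !feasibleE /= catA cat_take_drop => /and3P[-> /andP[sp s4] ->].
  rewrite -[p in sorted _ p](cat_take_drop 4) in sp.
  by rewrite /long (cat_sorted2 sp).1 (cat_sorted2 sp).2 size_take size_drop; move: s8; case: ifP; lia.
have [-> /(leq_trans _) ->//] := IH fP1.
rewrite /potential /num4 /= catA cat_take_drop; lia.
Qed.

Lemma step_admissible P P' : step G P P' -> admissible P -> admissible P' /\ potential P < potential P'.
Proof.
case=> i [P1 [_ op br]] iP; have /andP[fP _] := iP.
have [-> lt] := broken_admissible br (operation_feasible op fP); split=> //.
exact: leq_trans (operation_potential op iP) lt.
Qed.

Lemma steps_admissible P s : steps G P s -> admissible P ->
  admissible (last P s) /\ potential P + size s <= potential (last P s).
Proof.
elim: s P => [|P' s IH] P /=; first by rewrite addn0.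
case=> st /IH H iP; have [iP' lt] := step_admissible st iP; have [-> le] := H iP'.
by split=> //; lia.
Qed.

Lemma admissible_nil : admissible [::].
Proof. by []. Qed.

Lemma output_admissible s : execution G s -> admissible (output s).
Proof. by move=> ex; case: (steps_admissible ex admissible_nil). Qed.

Lemma covered_card P : feasible G P -> #|covered P| = size (flatten P).
Proof. by rewrite feasibleE => /andP[U _]; rewrite cardsE; apply/card_uniqP. Qed.

Lemma potential_bound P : feasible G P -> potential P <= 3 * #|T|.
Proof.
move=> fP; have := max_card (mem (covered P)); rewrite covered_card // => le.
suff: 4 * num4 P <= size (flatten P) by rewrite /potential; lia.
move: fP; rewrite feasibleE => /andP[_]; elim: P {le} => //= p P IH /andP[/andP[_ s4] /IH].
by rewrite size_cat /num4 /=; case: (_ == 4) => /=; lia.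
Qed.

Lemma execution_size s : execution G s -> size s <= 3 * #|T|.
Proof.
move=> ex; have [/andP[fP _] le] := steps_admissible ex admissible_nil.
have := potential_bound fP; apply: leq_trans; apply: leq_trans le.
exact: leq_addl.
Qed.

End Collections.

(** * Charging uncovered vertices to covered ones *)

Section Sides.
Variables (T : finType) (G : sgraph T) (O : coll T).
Hypothesis feasO : feasible G O.

Definition host (v : T) := nth [::] O (find (fun q => v \in q) O).

(** The rest of the path of [O] through [v] in one of its two directions, read away from [v]. It is
    empty if [v] lies on no path, because [host] then is the default [[::]]. *)
Definition side (b : bool) (v : T) : seq T :=
  if b then drop (index v (host v)).+1 (host v)
  else rev (take (index v (host v)) (host v)).

Arguments side : simpl never.

Lemma side_out b v : v \notin flatten O -> side b v = [::].
Proof.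
move=> vO; suff E : host v = [::] by rewrite /side E; case: b.
rewrite /host hasNfind ?nth_default //; apply/hasP=> -[q qO vq].
by case/negP: vO; apply/flattenP; exists q.
Qed.

Lemma side_split l v r : l ++ v :: r \in O -> side true v = r /\ side false v = rev l.
Proof.
move=> qO; have /andP[U _] : uniq (flatten O) && all (long G) O by rewrite -feasibleE.
have vq : v \in l ++ v :: r by rewrite mem_cat inE eqxx orbT.
have hE : host v = l ++ v :: r.
  have hv : has (fun q => v \in q) O by apply/hasP; exists (l ++ v :: r).
  apply: (flatten_uniq_mem U _ qO _ vq); first by rewrite mem_nth -?has_find.
  exact: (nth_find [::] hv).
have uq : uniq (l ++ v :: r).
  case/splitPr: qO U => O1 O2.
  by rewrite flatten_cat /= !cat_uniq => /and3P[_ _ /and3P[]].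
have vl : v \notin l.
  by move: uq; rewrite cat_uniq /= negb_or => /and3P[_ /andP[]].
have iE : index v (l ++ v :: r) = size l.
  by rewrite index_cat (negbTE vl) /= eqxx addn0.
by rewrite /side hE iE take_size_cat // -cat_rcons drop_size_cat ?size_rcons.
Qed.

Lemma side_host v : v \in flatten O ->
  exists l r, [/\ l ++ v :: r \in O, side true v = r & side false v = rev l].
Proof.
case/flattenP=> q qO vq; case/splitPr: vq qO => l r qO.
by exists l, r; have [-> ->] := side_split qO.
Qed.

Lemma side_turn b v l w r : side b v = l ++ w :: r ->
  side b w = r /\ side (~~ b) w = rev l ++ v :: side (~~ b) v.
Proof.
case vO: (v \in flatten O); last by rewrite side_out ?vO //; case: l.
have [L [R [qO Et Ef]]] := side_host (idP vO).
case: b; rewrite ?Et ?Ef /= ?Et ?Ef => E.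
  move: qO; rewrite E -cat_cons catA => /side_split[-> ->].
  by rewrite rev_cat rev_cons cat_rcons.
have EL : L = rev r ++ w :: rev l by rewrite -[L]revK E rev_cat rev_cons cat_rcons.
move: qO; rewrite EL -catA cat_cons => /side_split[-> ->].
by rewrite revK.
Qed.

Lemma side_path b v : path G v (side b v).
Proof.
case vO: (v \in flatten O); last by rewrite side_out ?vO.
have [l [r [qO Et Ef]]] := side_host (idP vO).
move: feasO; rewrite feasibleE => /andP[_ /allP/(_ _ qO)/andP[]].
by rewrite sorted_around => /andP[pl pr] _; case: b; rewrite ?Et ?Ef.
Qed.

Lemma side_uniq v : v \in flatten O -> uniq (v :: side true v ++ side false v).
Proof.
move=> vO; have [l [r [qO -> ->]]] := side_host vO.
have := feasO; rewrite /feasible => /andP[_ /allP/(_ _ qO)/andP[/andP[U _] _]].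
move: U; congr (is_true _); apply: perm_uniq.
by apply/permP=> a; rewrite /= !count_cat /= count_rev; lia.
Qed.

Lemma side_uniq1 b v : uniq (v :: side b v).
Proof.
case vO: (v \in flatten O); last by rewrite side_out ?vO.
have := side_uniq (idP vO); rewrite /= cat_uniq mem_cat negb_or.
by case/and4P=> /andP[vt vf] ut _ uf; case: b; rewrite ?vt ?vf.
Qed.

Lemma side_disjoint b v x : x \in side b v -> x \notin side (~~ b) v.
Proof.
case vO: (v \in flatten O); last by rewrite !side_out ?vO.
have := side_uniq (idP vO); rewrite /= cat_uniq => /and4P[_ _ /hasPn D _].
case: b => /= [xt|]; last exact: D.
by apply/negP => /D; rewrite /= xt.
Qed.

Lemma side_size v : v \in flatten O -> 3 <= size (side true v) + size (side false v).
Proof.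
move=> vO; have [l [r [qO -> ->]]] := side_host vO.
move: feasO; rewrite feasibleE => /andP[_ /allP/(_ _ qO)/andP[_]].
by rewrite size_cat size_rev /=; lia.
Qed.

Section Charge.
Variables (cov heavy : pred T).

(* Twice the charge that v receives from its neighboring uncovered vertices in
   the direction s: they are all charged to v if no covered vertex follows
   them, and otherwise shared evenly with that vertex, except that a heavy
   vertex takes all of them from a vertex that is not heavy. *)
Definition charge_along v (s : seq T) :=
  let k := find cov s in
  if drop k s is w :: _ then
    if heavy v then (if heavy w then k else k.*2)
    else if heavy w then 0 else k
  else k.*2.

Definition charge b v := charge_along v (side b v).

Lemma charge_along_end v s : ~~ has cov s -> charge_along v s = (size s).*2.
Proof. by move=> ns; rewrite /charge_along hasNfind // drop_size. Qed.

Lemma charge_along_cat v s w r : ~~ has cov s -> cov w ->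
  charge_along v (s ++ w :: r) =
  if heavy v then (if heavy w then size s else (size s).*2)
  else if heavy w then 0 else size s.
Proof.
move=> ns cw; rewrite /charge_along find_cat (negbTE ns) /= cw addn0.
by rewrite drop_size_cat.
Qed.

Lemma charge_along_both v w s r r' : ~~ has cov s -> cov v -> cov w ->
  (size s).*2 <=
    charge_along v (rev s ++ w :: r) + charge_along w (s ++ v :: r').
Proof.
move=> ns cv cw; rewrite !charge_along_cat ?has_rev // size_rev.
by case: (heavy v); case: (heavy w); lia.
Qed.

(** [l] is the reversed prefix already passed, so that one pass over the path collects both charges
    of each covered vertex. *)
Fixpoint charge_total (l r : seq T) :=
  if r is w :: r' then
    (if cov w then charge_along w l + charge_along w r' else 0)
    + charge_total (w :: l) r'
  else 0.

(** [m] is the uncovered segment open since the last covered vertex [v], whose forward charge is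
    still pending. The next covered vertex closes the segment and the two charges together pay for
    it; if there is none, [v] pays alone. *)
Lemma charge_total_after v m l r : cov v -> ~~ has cov m ->
  (size m).*2 + (count (predC cov) r).*2 <=
    charge_along v (rev m ++ r) + charge_total (m ++ v :: l) r.
Proof.
elim: r v m l => [|w r IH] v m l cv nm /=.
  by rewrite cats0 charge_along_end ?has_rev // size_rev; lia.
case cw: (cov w) => /=; last first.
  have := IH v (w :: m) l cv; rewrite /= cw => /(_ nm).
  by rewrite rev_cons cat_rcons; lia.
have := IH w [::] (m ++ v :: l) cw isT; have := charge_along_both r l nm cv cw.
rewrite /=; lia.
Qed.

(** The initial uncovered segment has no earlier covered vertex to share it, so the first covered
    vertex takes it whole. *)
Lemma charge_total_ge m r : has cov r -> ~~ has cov m ->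
  (size m).*2 + (count (predC cov) r).*2 <= charge_total m r.
Proof.
elim: r m => [|w r IH] m //=.
case cw: (cov w) => /= hr nm; last first.
  by have := IH (w :: m) hr; rewrite /= cw => /(_ nm); lia.
have := @charge_total_after w [::] m r cw isT.
rewrite (charge_along_end w nm) /=; lia.
Qed.

Lemma charge_total_host q l r : q = rev l ++ r -> q \in O ->
  charge_total l r = \sum_(v <- r | cov v) (charge true v + charge false v).
Proof.
elim: r l => [|w r IH] l E qO; first by rewrite big_nil.
rewrite big_cons /= (IH (w :: l)) //; last by rewrite E rev_cons cat_rcons.
have [Et Ef] := side_split (etrans (f_equal (fun s => s \in O) (esym E)) qO).
by rewrite /charge Et Ef revK; case: (cov w) => //; rewrite [charge_along w l + _]addnC.
Qed.

Lemma charge_ge : all (has cov) O ->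
  (count (predC cov) (flatten O)).*2 <=
    \sum_(v | cov v) (charge true v + charge false v).
Proof.
move=> hO; have /andP[U _] : uniq (flatten O) && all (long G) O by rewrite -feasibleE.
apply: (@leq_trans (\sum_(v | (v \in flatten O) && cov v) (charge true v + charge false v))).
  rewrite big_mkcondr -big_uniq //= -big_mkcond big_flatten count_flatten.
  rewrite sumnE big_map -mul2n big_distrr /= !big_seq; apply: leq_sum => q qO.
  rewrite -(@charge_total_host q [::] q) // mul2n.
  by have := @charge_total_ge [::] q (allP hO _ qO) isT.
rewrite [leqRHS](bigID (fun v => v \in flatten O)) /=.
rewrite (eq_bigl (fun v => cov v && (v \in flatten O))) ?leq_addr // => v.
by rewrite andbC.
Qed.

End Charge.
End Sides.

Arguments side {T} O b v : simpl never.

(** * Constraints at the vertices of a path in a terminal collection *)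

Section Terminal.
Variables (T : finType) (G : sgraph T) (P O : coll T).
Hypotheses (invP : admissible G P) (termP : terminal G P) (feasO : feasible G O).

Notation cov := (mem (flatten P)).
Definition rest : {pred T} := [pred v | v \notin flatten P].

Definition rep_free P0 := forall P', ~ rep G P0 P'.

Lemma rep_free_size P0 pre w suf Q e :
  rep_free P0 -> takes P0 (pre ++ w :: suf) Q ->
  size pre < uphalf (size (pre ++ w :: suf)) -> extension G P0 w e ->
  size e <= size pre.
Proof.
move=> rf tk half ext; rewrite leqNgt; apply/negP => lt.
apply: (rf ((rev e ++ w :: suf) :: Q)); exists w, e, pre, suf, Q; split=> //.
Qed.

Lemma repP : rep_free P.
Proof. by move=> P' op; apply: (termP (i := 1)); exists P'. Qed.

(* The centers of the paths of order 7. *)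
Definition heavy_in (P0 : coll T) v :=
  has (fun p => (size p == 7) && (v == nth v p 3)) P0.

Definition heavy v := heavy_in P v.

Lemma reading (P0 : coll T) w : w \in flatten P0 ->
  exists pre suf Q, [/\ takes P0 (pre ++ w :: suf) Q,
    size pre < uphalf (size (pre ++ w :: suf))
    & pre ++ w :: suf \in P0 \/ rev (pre ++ w :: suf) \in P0].
Proof.
case/flattenP=> p pP wp; case/splitPr: wp pP => l r lrP.
case: (leqP (size l) (size r)) => lr.
  exists l, r, (rem (l ++ w :: r) P0); split; [|by rewrite size_cat /=; move: lr; move: (size l) (size r) => a b; lia|by left].
  by left; apply: perm_to_rem.
exists (rev r), (rev l), (rem (l ++ w :: r) P0).
have -> : rev r ++ w :: rev l = rev (l ++ w :: r) by rewrite rev_cat rev_cons cat_rcons.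
split; [|by rewrite !size_rev size_cat /=; move: lr; move: (size l) (size r) => a b; lia|by right; rewrite revK].
by right; rewrite revK; apply: perm_to_rem.
Qed.

Lemma uniqP : uniq (flatten P).
Proof. by case/andP: invP; rewrite feasibleE => /andP[]. Qed.

Lemma takes_sizes p Q : takes P p Q -> 4 <= size p <= 7.
Proof.
case/andP: invP => fP sP tk; move: fP sP.
rewrite (takes_feasible G tk) (takes_small tk) feasibleE /= => /andP[_ /andP[/andP[_ ->] _]].
by case/andP.
Qed.

Lemma takes_sorted p Q : takes P p Q -> sorted G p.
Proof.
case/andP: invP => fP _ tk; move: fP.
by rewrite (takes_feasible G tk) feasibleE /= => /andP[_ /andP[/andP[->]]].
Qed.

Lemma takes_uniq p Q : takes P p Q -> uniq (p ++ flatten Q).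
Proof.
by case/andP: invP => fP _ tk; rewrite -(perm_uniq (takes_perm tk)) uniqP.
Qed.

Lemma takes_in p Q v : takes P p Q -> v \in p -> v \in flatten P.
Proof. by move=> tk vp; rewrite (perm_mem (takes_perm tk)) mem_cat vp. Qed.

Lemma heavyE pre w suf Q : takes P (pre ++ w :: suf) Q ->
  heavy w = (size pre == 3) && (size suf == 3).
Proof.
move=> tk; have wp : w \in pre ++ w :: suf by rewrite mem_cat inE eqxx orbT.
have up : uniq (pre ++ w :: suf) by have := takes_uniq tk; rewrite cat_uniq => /andP[].
have key (l r : seq T) : uniq (l ++ w :: r) -> size (l ++ w :: r) = 7 ->
    (w == nth w (l ++ w :: r) 3) = (size l == 3) && (size r == 3).
  move=> ulr s7; have := s7; rewrite size_cat /= => s7'.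
  have -> : (size l == 3) && (size r == 3) = (size l == 3) by lia.
  rewrite -{1}[w](@nth_index _ w w (l ++ w :: r)); last by rewrite mem_cat inE eqxx orbT.
  rewrite nth_uniq ?s7 ?index_size //; last first.
    by rewrite -s7 index_mem mem_cat inE eqxx orbT.
  rewrite index_cat; case: ifP => [wl|_]; last by rewrite /= eqxx addn0.
  by move: ulr; rewrite uniq_catC /= mem_cat wl orbT.
apply/hasP/andP => [[q qP /andP[/eqP q7 wq]]|[/eqP p3 /eqP s3]].
  have wq' : w \in q by rewrite (eqP wq) mem_nth ?q7.
  apply/andP; case: (takes_mem tk) => pP.
    have E := flatten_uniq_mem uniqP qP pP wq' wp.
    by rewrite -key // -E.
  have E : q = rev suf ++ w :: rev pre.
    rewrite (flatten_uniq_mem uniqP qP pP wq') ?mem_rev //.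
    by rewrite rev_cat rev_cons cat_rcons.
  rewrite andbC -(size_rev suf) -(size_rev pre) -key -?E //.
  rewrite E -cat_rcons -rev_cons -rev_cat rev_uniq //.
case: (takes_mem tk) => pP; [exists (pre ++ w :: suf) | exists (rev (pre ++ w :: suf))] => //.
  by rewrite size_cat /= nth_cat p3 s3 ltnn /=.
rewrite size_rev rev_cat rev_cons cat_rcons nth_cat size_rev size_cat /= p3 s3.
by rewrite ltnn /=.
Qed.

Notation ch := (charge O cov heavy).
Notation sd := (side O).
(** The order of the uncovered segment next to [v] on [O]; this segment is an extension at [v],
    hence limited by Rep. *)
Definition run b v := find cov (sd b v).

Lemma run_extension b v : extension G P v (take (run b v) (sd b v)).
Proof.
apply/and3P; split.
- by have := side_path feasO b v; rewrite -{1}(cat_take_drop (run b v) (sd b v)) cat_path => /andP[].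
- by rewrite take_uniq //; have := side_uniq1 feasO b v; rewrite /= => /andP[].
apply/allP => y yt; apply/negP => yP.
have : has cov (take (run b v) (sd b v)) by apply/hasP; exists y.
by rewrite has_take_leq ?ltnn ?find_size.
Qed.

Lemma size_run b v : size (take (run b v) (sd b v)) = run b v.
Proof. by rewrite size_takel // find_size. Qed.

Lemma run_le pre v suf Q b : takes P (pre ++ v :: suf) Q ->
  size pre < uphalf (size (pre ++ v :: suf)) -> run b v <= size pre.
Proof.
by move=> tk half; rewrite -size_run; apply: (rep_free_size repP tk half); apply: run_extension.
Qed.

Lemma charge_le b v : ch b v <= (run b v).*2.
Proof.
rewrite /charge /charge_along -/(run b v); case: drop => [|w _] //.
by case: (heavy v); case: (heavy w); lia.
Qed.

Lemma end_rest x suf Q y : takes P (x :: suf) Q -> y \in rest -> G x y = false.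
Proof.
move=> tk yR; apply/negP => xy.
have := @rep_free_size P [::] x suf Q [:: y] repP tk isT.
by rewrite /extension /= xy inE in yR *; rewrite yR => /(_ isT).
Qed.

Lemma end_charge x suf Q b : takes P (x :: suf) Q -> ch b x = 0.
Proof.
move=> tk; apply/eqP; rewrite -leqn0; apply: leq_trans (charge_le b x) _.
by have := @run_le [::] x suf Q b tk isT; case: run.
Qed.

Lemma second_rest u0 u1 suf Q y z : takes P (u0 :: u1 :: suf) Q ->
  y \in rest -> z \in rest -> y != z -> G u1 y -> G y z = false.
Proof.
move=> tk; rewrite !inE => yR zR yz uy; apply/negP => Gyz.
have half : 1 < uphalf (size (u0 :: u1 :: suf)).
  by have /andP[? _] := takes_sizes tk; size_lia.
have := @rep_free_size P [:: u0] u1 suf Q [:: y; z] repP tk half.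
by rewrite /extension /= uy Gyz inE yz yR zR => /(_ isT).
Qed.

Lemma second_heavy u0 u1 suf Q : takes P (u0 :: u1 :: suf) Q -> heavy u1 = false.
Proof. by move=> tk; rewrite (@heavyE [:: u0] _ suf Q). Qed.

Lemma second_run u0 u1 suf Q b : takes P (u0 :: u1 :: suf) Q -> run b u1 <= 1.
Proof.
move=> tk; apply: (@run_le [:: u0] _ _ _ _ tk).
by have := takes_sizes tk; move=> /=; lia.
Qed.

(** As [u1] is not heavy, a single vertex is charged 2 only if no covered vertex follows it; then it
    ends the path of [O], since the run has order at most 1. *)
Lemma second_charge1 u0 u1 suf Q b : takes P (u0 :: u1 :: suf) Q ->
  ch b u1 <= 1 \/ ch b u1 = 2 /\ size (sd b u1) <= 1.
Proof.
move=> tk; have := second_run b tk.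
rewrite /charge /charge_along -/(run b u1) (second_heavy tk) => k1.
case E: drop => [|w r]; last by left; case: ifP.
have : size (sd b u1) <= 1.
  have : size (drop (run b u1) (sd b u1)) = 0 by rewrite E.
  by rewrite size_drop; lia.
by case: (run b u1) k1 => [|[|//]] _ ?; [left | right].
Qed.

(** A charge of 2 on both sides would leave [u1] on a path of [O] of order at most 3. *)
Lemma second_charge u0 u1 suf Q : takes P (u0 :: u1 :: suf) Q ->
  ch true u1 + ch false u1 <= 3.
Proof.
move=> tk; case vO: (u1 \in flatten O); last first.
  by rewrite /charge !side_out ?vO.
have := side_size feasO (idP vO).
by have [|[-> ?]] := second_charge1 true tk; have [|[-> ?]] := second_charge1 false tk; lia.
Qed.

Lemma double_repP P' : ~ double_rep G P P'.
Proof. by move=> op; apply: (termP (i := 2)); exists P'. Qed.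

(** DoubleRep would cut the path into [v0 v1 v2 c], with an empty extension at [c], and
    [y u2 u1 u0]. *)
Lemma third7_rest u0 u1 u2 c v2 v1 v0 Q y :
  takes P [:: u0; u1; u2; c; v2; v1; v0] Q -> y \in rest -> G u2 y = false.
Proof.
rewrite inE => tk yR; apply/negP => uy.
apply: (@double_repP (([:: v0; v1; v2] ++ [:: c]) :: (rev [:: y] ++ u2 :: [:: u1; u0]) :: Q)).
exists [:: v0; v1; v2], c, [::], u2, [:: u1; u0], Q, [::], [:: y]; split=> //.
- exact: (takes_rev tk).
- by split=> //; rewrite /extension /= uy yR.
Qed.

(** Distinct [y] and [z] would let DoubleRep form [u0 u1 u2 y] and [z v2 v1 v0]. *)
Lemma third6_rest u0 u1 u2 v2 v1 v0 Q y z :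
  takes P [:: u0; u1; u2; v2; v1; v0] Q -> y \in rest -> z \in rest ->
  G u2 y -> G v2 z -> y = z.
Proof.
rewrite !inE => tk yR zR uy vz; apply/eqP/negP => yz.
apply: (@double_repP (([:: u0; u1; u2] ++ [:: y]) :: (rev [:: z] ++ v2 :: [:: v1; v0]) :: Q)).
exists [:: u0; u1], u2, [::], v2, [:: v1; v0], Q, [:: y], [:: z]; split=> //.
by rewrite /extension /= uy vz yR zR inE; split=> //; rewrite andbT; apply/negP.
Qed.

(** * Collections one Look-ahead replacement away *)

Section Swap.
Variables (pre suf e : seq T) (c : T) (Q : coll T).
Hypotheses (tk : takes P (pre ++ c :: suf) Q)
  (half : size pre < uphalf (size (pre ++ c :: suf)))
  (t23 : size pre \in [:: 2; 3])
  (ext : extension G P c e) (se : size e = size pre).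

(** Its point is that the vertices of [pre] are now uncovered and may serve in extensions, while the
    inapplicability of Look-ahead still forbids every Rep. *)
Definition swap : coll T := (rev e ++ c :: suf) :: Q.

Lemma swap_rep_free : rep_free swap.
Proof.
move=> P' R; apply: (termP (i := 4)); exists P', pre, c, suf, Q, e; split=> //.
by left; exists (rev e ++ c :: suf); split=> //; left.
Qed.

Lemma swap_feasible : feasible G swap.
Proof. by case/andP: invP => fP _; case: (look_ahead_swap tk ext se fP). Qed.

Lemma swap_small : all (fun p => size p <= 7) swap.
Proof.
case/andP: invP => _; rewrite (takes_small tk) /= => /andP[+ ->].
by rewrite !size_cat size_rev se => ->.
Qed.

Lemma swap_free y : y \in pre \/ y \in rest /\ y \notin e -> y \notin flatten swap.
Proof.
have := takes_uniq tk; rewrite -catA cat_uniq => /and3P[_ /hasPn D _].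
have /extensionP[_ _ De] := ext.
case=> [yp | [yR ye]]; rewrite /= -catA mem_cat mem_rev negb_or.
  apply/andP; split; last by apply: contraL yp => /D.
  by apply: contraL yp => /De; apply: contra => yp; apply: (takes_in tk); rewrite mem_cat yp.
rewrite ye; move: yR; rewrite inE (perm_mem (takes_perm tk)) -catA mem_cat.
by case/norP.
Qed.

Lemma swap_in w : w \in flatten P -> w \notin pre -> w \in flatten swap.
Proof.
rewrite (perm_mem (takes_perm tk)) -catA mem_cat => /orP[-> //|H _].
by rewrite /= -catA mem_cat H orbT.
Qed.

Lemma swap_heavy w : w \notin e -> w \notin pre -> heavy_in swap w -> heavy w.
Proof.
move=> we wp /orP[/andP[/eqP s7 /eqP wE]|/hasP[q qQ wq]]; last first.
  by apply/hasP; exists q; [apply: (takes_sub tk qQ) | exact: wq].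
have t3 : size pre <= 3 by move: t23; rewrite !inE => /orP[] /eqP->.
have s7' : size (pre ++ c :: suf) = 7.
  by move: s7; rewrite !size_cat size_rev se.
have wE' : w = nth w (pre ++ c :: suf) 3.
  by rewrite {1}wE !nth_cat size_rev se ltnNge t3.
apply/hasP; case: (takes_mem tk) => pP; [exists (pre ++ c :: suf) | exists (rev (pre ++ c :: suf))] => //.
  by rewrite s7' -wE' !eqxx.
by rewrite size_rev nth_rev s7' // -wE' !eqxx.
Qed.

(** The swapped path keeps its other end, and all other paths are unchanged. *)
Lemma swap_near w : w \notin pre -> has (near_end w) P -> has (near_end w) swap.
Proof.
move=> wp /hasP[q qP wq].
have s2 : 2 <= size suf.
  by move: half t23; rewrite size_cat /= !inE => ? /orP[] /eqP E; size_lia.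
have t2 : 2 <= size pre by move: t23; rewrite !inE => /orP[] /eqP->.
have key : near_end w (pre ++ c :: suf) -> has (near_end w) swap.
  rewrite /near_end takel_cat // => /orP[/mem_take|]; first by rewrite (negbTE wp).
  rewrite rev_cat rev_cons cat_rcons takel_cat ?size_rev // => H.
  rewrite /= /near_end rev_cat rev_cons cat_rcons [take 2 (rev suf ++ _)]takel_cat ?size_rev //.
  by rewrite H orbT.
have : q \in P by [].
case: tk => /perm_mem->; rewrite inE => /orP[/eqP Eq|qQ].
- by apply: key; rewrite -Eq.
- by rewrite /= orbC; apply/orP; left; apply/hasP; exists q.
- by apply: key; rewrite -near_end_rev -Eq.
by rewrite /= orbC; apply/orP; left; apply/hasP; exists q.
Qed.

(** As no Rep applies in [swap], the order of an extension is at most the distance to the nearer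
    end. Outside [pre] and [e], a heavy vertex of [swap] is heavy in [P], and a vertex near an end
    in [P] stays near one. *)
Lemma swap_size w g : w \in flatten P -> w \notin pre -> extension G swap w g ->
  [/\ size g <= 3, ~~ heavy w -> size g <= 2 & has (near_end w) P -> size g <= 1].
Proof.
move=> wP wp extg.
have we : w \notin e.
  have /extensionP[_ _ De] := ext.
  by apply: contraL wP => /De.
have [pre' [suf' [Q' [tk' half' mem']]]] := reading (swap_in wP wp).
have le := rep_free_size swap_rep_free tk' half' extg.
have s7 : size (pre' ++ w :: suf') <= 7.
  by case: mem' => /(allP swap_small); rewrite ?size_rev.
have s4 : 4 <= size (pre' ++ w :: suf').
  have := swap_feasible; rewrite feasibleE => /andP[_ /allP sw].
  by case: mem' => /sw /andP[_]; rewrite ?size_rev.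
move: (half') s7 s4; rewrite size_cat /= => half2 s7 s4.
split; first by size_lia.
  move=> nh; suff : size pre' != 3. by size_lia.
  apply: contra nh => /eqP p3; have s3 : size suf' = 3 by size_lia.
  apply: (swap_heavy we wp); apply/hasP.
  case: mem' => mem'; [exists (pre' ++ w :: suf') | exists (rev (pre' ++ w :: suf'))] => //.
    by rewrite size_cat /= p3 s3 /= nth_cat p3 ltnn subnn.
  rewrite size_rev nth_rev size_cat /= p3 s3 //= nth_cat p3 ltnn subnn.
  by rewrite eqxx.
move=> /(swap_near wp)/hasP[q qs wq].
have := near_end_takes swap_feasible tk' qs (near_end_mem wq).
by rewrite wq => /esym/orP[] ?; size_lia.
Qed.

End Swap.

Lemma path_pred a s y : path G a s -> uniq (a :: s) -> y \in s ->
  exists z, [/\ z \in a :: s, z != y & G y z].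
Proof.
move=> ps us ys; case/splitPr: ys ps us => s1 s2.
rewrite cat_path => /andP[_ /andP[Gy _]].
rewrite -cat_cons uniq_catC cons_uniq mem_cat negb_or => /andP[/andP[_ ys1] _].
exists (last a s1); split.
- by rewrite mem_cat mem_last.
- by apply: contraNneq ys1 => <-; apply: mem_last.
by rewrite adjC.
Qed.

Lemma path_nbr c e y : path G c e -> uniq e -> 2 <= size e -> y \in e ->
  exists z, [/\ z \in e, z != y & G y z].
Proof.
case: e => [|a [|b e]] //= /andP[_ pe] ue _; rewrite inE => /orP[/eqP->|ye].
  exists b; case/andP: pe => ab _; rewrite !inE eqxx orbT; split=> //.
  by apply: contraTneq ue => ->; rewrite /= inE eqxx.
exact: path_pred ye.
Qed.

(** * Vertices [c] whose run is as long as Rep allows *)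

Section Full.
Variables (u0 u1 c : T) (pre2 suf : seq T) (Q : coll T) (b0 : bool).
Let pre := u0 :: u1 :: pre2.
Hypotheses (tk : takes P (pre ++ c :: suf) Q)
  (half : size pre < uphalf (size (pre ++ c :: suf)))
  (t23 : size pre \in [:: 2; 3])
  (full : run b0 c = size pre).

Let e := take (run b0 c) (sd b0 c).
Let ext : extension G P c e := run_extension b0 c.
Let se : size e = size pre := etrans (size_run b0 c) full.

(** If [y] were on [e], which has at least two vertices, it would have a neighbor there, and [u1]
    would start an extension of order 2. *)
Lemma full_rest y : y \in rest -> G u1 y -> y \notin flatten (swap suf e c Q).
Proof.
move=> yR uy; apply: (swap_free tk ext); right; split=> //.
apply/negP=> ye; have /extensionP[pe ue De] := ext.
have [|z [ze zy Gyz]] := path_nbr pe ue _ ye.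
  by rewrite se /pre.
have := second_rest tk yR _ _ uy; rewrite eq_sym in zy.
by move=> /(_ z (De _ ze) zy); rewrite Gyz.
Qed.

Lemma pre_free x : x \in pre -> x \notin flatten (swap suf e c Q).
Proof. by move=> xp; apply: (swap_free tk ext); left. Qed.

(** If a run of one vertex [y] is followed by a covered [w] that is not heavy, then with [pre] freed
    [y u1 u0] is an extension of order 3 at [w], one too many. A heavy [w] takes the whole charge.
    So [u1] pays for [y] only if [y] ends its path of [O]. *)
Lemma full_second b : ch b u1 = 0 \/ ch b u1 = 2 /\ size (sd b u1) = 1.
Proof.
have k1 := second_run b tk; have nh := second_heavy tk.
rewrite /charge /charge_along -/(run b u1) nh.
case k0: (run b u1) k1 => [|[|//]] _.
  by left; case: drop => // w r; case: ifP.
have [hc pl] : size (sd b u1) >= 1 /\ extension G P u1 (take 1 (sd b u1)).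
  by rewrite -k0 find_size run_extension.
have := side_path feasO b u1; have := side_uniq1 feasO b u1.
have := k0; rewrite /run.
case: (sd b u1) hc pl => [|y [|w r]] //= _.
  by move=> *; right.
move=> pl; have yR : y \in rest by case/and3P: pl => _ _ /andP[].
rewrite (negbTE (yR : y \notin flatten P)) /=.
case wP: (w \in flatten P) => //= _ uq /and3P[uy yw _].
case hw: (heavy w); first by left.
(* [u0] has no uncovered neighbor, [w] differs from [u1] on [O], and [pre] has a third vertex only
   in a path of order 7, where that vertex has no uncovered neighbor either. *)
have wp : w \notin pre.
  rewrite /pre !inE !negb_or; apply/and3P; split.
  - apply/negP=> /eqP wu; have := end_rest tk yR.
    by rewrite -wu adjC yw.
  - by apply: contraTneq uq => ->; rewrite /= !inE eqxx orbT.
  apply/negP => wp2; move: half t23 wp2 tk; rewrite /pre.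
  case: (pre2) => [|u2 [|? ?]] //= h _; rewrite inE => /eqP <-.
  move=> tk7; have := takes_sizes tk7; move: h tk7.
  case: (suf) => [|v2 [|v1 [|v0 [|? ?]]]] //= _ tk7 _.
  by have := third7_rest tk7 yR; rewrite adjC yw.
have extg : extension G (swap suf e c Q) w [:: y; u1; u0].
  apply/and3P; split.
  - rewrite /= adjC yw adjC uy /= andbT.
    have := takes_sorted tk; rewrite /pre /= => /andP[+ _].
    by rewrite adjC.
  - have uP : {in pre, forall x, x != y}.
      move=> x xp; apply: contraTneq yR => <-; rewrite inE negbK.
      by apply: (takes_in tk); rewrite mem_cat xp.
    rewrite /= !inE negb_or ![y == _]eq_sym !uP /pre ?inE ?eqxx ?orbT //= andbT.
    have := takes_uniq tk; rewrite /pre /= !inE !negb_or => /andP[/andP[+ _] _].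
    by rewrite eq_sym.
  rewrite /= full_rest // !pre_free // /pre !inE ?eqxx ?orbT //.
by have [_ /(_ (negbT hw)) /= ] := swap_size tk half t23 ext se wP wp extg.
Qed.

Lemma full_second_charge : ch true u1 + ch false u1 <= 2.
Proof.
have := second_charge tk.
by have [->|[-> _]] := full_second true; have [->|[-> _]] := full_second false.
Qed.

Hypothesis u1_charge : ch true u1 + ch false u1 = 2.

Lemma full_u1_rest : exists y, y \in rest /\ G u1 y.
Proof.
have [b b2] : exists b, 1 <= ch b u1.
  move: u1_charge; case E: (ch true u1) => [|k] H; last by exists true; rewrite E.
  by exists false; move: H; rewrite add0n => ->.
have := leq_trans b2 (charge_le b u1).
have kle : run b u1 <= size (sd b u1) by apply: find_size.
have := run_extension b u1; rewrite /extension.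
case: (sd b u1) kle => [|y s] /=; first by case: (run b u1).
case: (run b u1) => [|k] //= _ /and3P[/andP[uy _] _ /andP[yP _]] _.
by exists y; rewrite inE.
Qed.

Lemma full_path w g : w \in flatten P -> w \notin pre ->
  path G w g -> uniq g -> {subset g <= pre} ->
  [/\ ~~ heavy w -> size g <= 2 & has (near_end w) P -> size g <= 1].
Proof.
move=> wP wp pg ug gp.
have extg : extension G (swap suf e c Q) w g.
  by apply/and3P; split=> //; apply/allP=> x /gp; apply: pre_free.
by have [] := swap_size tk half t23 ext se wP wp extg.
Qed.

(** A neighbor [z] of [u0] on [O] other than [u1] is covered, by Rep at [u0], and is not near an
    end: with [pre] freed, [u0 u1] would be an extension of order 2 at [z]. It remains to see that
    such a neighbor exists. *)
Lemma full_end_nbr : u0 \in flatten O -> exists b z,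
  [/\ ohead (sd b z) = Some u0, z \in flatten P & ~~ has (near_end z) P].
Proof.
move=> uO.
have key b z s : sd b u0 = z :: s -> z != u1 ->
    z \in flatten P /\ ~~ has (near_end z) P.
  move=> E zu; have := side_path feasO b u0; rewrite E /= => /andP[uz _].
  have zP : z \in flatten P.
    by apply/negPn/negP=> zR; have := end_rest tk zR; rewrite uz.
  split=> //; apply/negP => zn.
  have zu0 : z != u0.
    by have := side_uniq1 feasO b u0; rewrite E /= !inE negb_or eq_sym => /andP[/andP[]].
  have zp2 : z \notin pre2.
    apply/negP => zp2; move: zn => /hasP[q qP zq].
    have [l [r E2]] : exists l r, pre2 = l ++ z :: r.
      by case/splitPr: zp2 => l r; exists l, r.
    have tk' : takes P ((u0 :: u1 :: l) ++ z :: (r ++ c :: suf)) Q.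
      by move: tk; rewrite /pre E2 /= -catA.
    case/andP: invP => fP _; have := near_end_takes fP tk' qP (near_end_mem zq).
    rewrite zq /= size_cat /=; move: half; rewrite /pre E2 /= !size_cat /= ?size_cat /=.
    by size_lia.
  have zp : z \notin pre by rewrite /pre !inE !negb_or zu0 zu zp2.
  have := @full_path z [:: u0; u1] zP zp; rewrite /= adjC uz.
  have := takes_sorted tk; rewrite /pre /= => /andP[-> _] /(_ isT).
  have := takes_uniq tk; rewrite /pre /= !inE !negb_or => /andP[/andP[-> _] _].
  case=> // [x|_ /(_ zn)] //.
  by rewrite !inE => /orP[] ->; rewrite ?orbT.
have good b z s : sd b u0 = z :: s -> z != u1 -> exists b z,
    [/\ ohead (sd b z) = Some u0, z \in flatten P & ~~ has (near_end z) P].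
  move=> E zu; have [zP zn] := key _ _ _ E zu; exists (~~ b), z; split=> //.
  by have [_ ->] := side_turn feasO (E : sd b u0 = [::] ++ z :: s).
have sz := side_size feasO uO.
(* If [u0] ended its path of [O] next to [u1], then [u1] would be charged nothing toward [u0], hence
   2 on the other side, where the path ends after one vertex: its order would be 3. *)
have one b : size (sd (~~ b) u0) = 0 -> exists b z,
    [/\ ohead (sd b z) = Some u0, z \in flatten P & ~~ has (near_end z) P].
  move=> s0; have s3 : 3 <= size (sd b u0) by move: s0 sz; case: b => /= ->; rewrite ?addn0.
  case E: (sd b u0) s3 => [|z s] //= s3.
  have [zu|zu] := eqVneq z u1; last exact: good E zu.
  subst z; have [E1 E2] := side_turn feasO (E : sd b u0 = [::] ++ u1 :: s).
  have c0 : ch (~~ b) u1 = 0.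
    apply/eqP; rewrite -leqn0; apply: leq_trans (charge_le (~~ b) u1) _.
    have uP : u0 \in flatten P by apply: (takes_in tk); rewrite /pre !inE eqxx.
    by rewrite /run E2 /= uP.
  have [|[_ s1]] := full_second b; last by move: s3; rewrite -E1 s1.
  by move=> cb; move: c0 cb u1_charge; case: (b) => /= -> ->.
case Et: (sd true u0) => [|z s]; first by apply: (one false); rewrite /= Et.
have [zu|zu] := eqVneq z u1; last exact: good Et zu.
case Ef: (sd false u0) => [|z' s']; first by apply: (one true); rewrite /= Ef.
apply: (good _ _ _ Ef); rewrite -zu.
have := @side_disjoint _ _ _ feasO true u0 z; rewrite Et Ef !inE eqxx => /(_ isT).
by rewrite negb_or eq_sym => /andP[].
Qed.

(** With [pre] freed, [u2 u0 u1 y] would be an extension of order 4 at [c], too long even for a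
    heavy vertex. *)
Lemma full_no_chord u2 : pre2 = [:: u2] -> G u2 u0 = false.
Proof.
move=> E; apply/negP=> u20; have [y [yR uy]] := full_u1_rest.
have up := takes_uniq tk; have sp := takes_sorted tk.
have cP : c \in flatten P.
  by apply: (takes_in tk); rewrite mem_cat [c \in c :: _]inE eqxx orbT.
have cp : c \notin pre.
  by move: up; rewrite -catA uniq_catC /= mem_cat negb_or => /andP[/andP[_ ->]].
have yp : y \notin pre.
  by apply: contraL yR => yp; rewrite inE negbK; apply: (takes_in tk); rewrite mem_cat yp.
have extg : extension G (swap suf e c Q) c [:: u2; u0; u1; y].
  apply/and3P; split.
  - move: sp; rewrite /pre E /= => /and4P[u01 _ u2c _].
    by rewrite adjC u2c u20 u01 uy.
  - move: yp up; rewrite /pre E /= -!cat_cons !inE !negb_or.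
    case/and3P=> y0 y1 y2 /andP[/and3P[u01 u02 _] /andP[/andP[u12 _] _]].
    by rewrite ![y == _]eq_sym in y0 y1 y2; rewrite u01 y0 y1 y2 [u2 == u0]eq_sym u02 [u2 == u1]eq_sym u12.
  rewrite /= (full_rest yR uy) !pre_free // /pre E !inE ?eqxx ?orbT //.
by have [] := swap_size tk half t23 ext se cP cp extg.
Qed.

End Full.

(** * Bad ends and the payments to them *)

Definition charge2 v := ch true v + ch false v.

(* p is read from its end x: its center has the largest possible charge and
   the second vertex is charged one uncovered vertex. *)
Definition bad_reading (p : seq T) :=
  if p is x :: u1 :: _ then
    [&& 5 <= size p, x \in flatten O,
        charge2 (nth x p (size p).-1./2) == 4 * (size p).-1./2
      & charge2 u1 == 2]
  else false.

Definition bad x :=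
  has (fun p => (ohead p == Some x) && bad_reading p
             || (ohead (rev p) == Some x) && bad_reading (rev p)) P.

Lemma mem_takes p : p \in P -> takes P p (rem p P).
Proof. by move=> pP; left; apply: perm_to_rem. Qed.

(** Charges are doubled and there are two sides, so [4 * size pre] is reached only by two runs of
    order [size pre], both charged to [c] alone. *)
Lemma center_full pre c suf Q : takes P (pre ++ c :: suf) Q ->
  size pre < uphalf (size (pre ++ c :: suf)) ->
  charge2 c = 4 * size pre -> forall b, run b c = size pre.
Proof.
move=> tk half; rewrite /charge2.
have := charge_le true c; have := charge_le false c.
have := run_le true tk half; have := run_le false tk half.
by move=> ? ? ? ? ? []; lia.
Qed.

Lemma bad_elim x : bad x -> exists u1 pre2 c suf Q, let pre := x :: u1 :: pre2 in
  [/\ takes P (pre ++ c :: suf) Q,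
      size pre < uphalf (size (pre ++ c :: suf)),
      size pre \in [:: 2; 3], forall b, run b c = size pre
    & [/\ charge2 u1 = 2, x \in flatten O & (size (pre ++ c :: suf)).-1./2 = size pre]].
Proof.
have main p Q : takes P p Q -> ohead p = Some x -> bad_reading p ->
    exists u1 pre2 c suf Q, let pre := x :: u1 :: pre2 in
  [/\ takes P (pre ++ c :: suf) Q,
      size pre < uphalf (size (pre ++ c :: suf)),
      size pre \in [:: 2; 3], forall b, run b c = size pre
    & [/\ charge2 u1 = 2, x \in flatten O & (size (pre ++ c :: suf)).-1./2 = size pre]].
  case: p => [|x' [|u1 [|a [|a1 [|a2 p]]]]] //= tk [?]; subst x'.
  have /= := takes_sizes tk.
  case: p tk => [|a3 [|a4 [|//]]] tk _ /and3P[xO /eqP cc /eqP c1].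
  - exists u1, [::], a, [:: a1; a2], Q; split=> // b.
    exact: (@center_full [:: x; u1] a [:: a1; a2] Q).
  - exists u1, [::], a, [:: a1; a2; a3], Q; split=> // b.
    exact: (@center_full [:: x; u1] a [:: a1; a2; a3] Q).
  exists u1, [:: a], a1, [:: a2; a3; a4], Q; split=> // b.
  exact: (@center_full [:: x; u1; a] a1 [:: a2; a3; a4] Q).
case/hasP=> p pP /orP[] /andP[/eqP h].
  exact: main (mem_takes pP) h.
exact: main (takes_rev (mem_takes pP)) h.
Qed.

Lemma bad_cov x : bad x -> x \in flatten P.
Proof.
by case/bad_elim => u1 [pre2 [c [suf [Q [tk _ _ _ _]]]]]; apply: (takes_in tk); rewrite inE eqxx.
Qed.

(** Next to a full center, [u1] is charged at most 2. A charge of 2 makes [u0] bad if it lies on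
    [O]; otherwise the budget of [u0] has 2 extra units. *)
Lemma bad_intro u0 u1 pre2 c suf Q : let pre := u0 :: u1 :: pre2 in
  takes P (pre ++ c :: suf) Q -> 5 <= size (pre ++ c :: suf) ->
  (size (pre ++ c :: suf)).-1./2 = size pre ->
  charge2 c = 4 * size pre ->
  charge2 u1 <= 1 + bad u0 + (u0 \notin flatten O).*2.
Proof.
move=> pre tk s5 ct cc.
have half : size pre < uphalf (size (pre ++ c :: suf)).
  by move: ct s5; move: (size pre) (size _) => a d; lia.
have s7 := takes_sizes tk.
have t23 : size pre \in [:: 2; 3].
  move: ct s5 s7; rewrite !inE; move: (size pre) (size _) => a d; lia.
have := full_second_charge tk half t23 (center_full tk half cc true).
rewrite -/(charge2 u1); case uO: (u0 \in flatten O); last by lia.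
move=> le2; case: (leqP (charge2 u1) 1) => [|gt1]; first by lia.
suff -> : bad u0 by lia.
have br : bad_reading (pre ++ c :: suf).
  rewrite /bad_reading /pre /= in s5 ct cc *; rewrite uO /=.
  apply/and3P; split=> //; last by rewrite eqn_leq le2.
  by rewrite ct -[_ :: _ :: _ ++ _]/(pre ++ c :: suf) nth_cat ltnn subnn /= cc.
apply/hasP; case: (takes_mem tk) => pP.
  by exists (pre ++ c :: suf) => //; rewrite br eqxx.
by exists (rev (pre ++ c :: suf)) => //; rewrite revK br eqxx !orbT.
Qed.

(* h pays half a vertex to the path of the bad end x next to it. *)
Definition links b h x :=
  [&& ohead (sd b h) == Some x, bad x, h \in flatten P & ~~ has (near_end h) P].

Definition pay b h : nat :=
  if ohead (sd b h) is Some x then links b h x else false.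

Lemma pay_sum b h : pay b h = \sum_x links b h x.
Proof.
rewrite /pay; case E: (ohead (sd b h)) => [x|]; last first.
  by rewrite big1 // => x _; rewrite /links E.
rewrite (bigD1 x) //= big1 ?addn0 // => y yx.
rewrite /links E; case: eqP => // -[xy]; by rewrite xy eqxx in yx.
Qed.

Lemma bad_links x : bad x -> exists b h, links b h x.
Proof.
move=> bx; have [u1 [pre2 [c [suf [Q [tk half t23 fl [c1 xO _]]]]]]] := bad_elim bx.
have [b [z [E zP zn]]] := full_end_nbr tk half t23 (fl true) c1 xO.
by exists b, z; rewrite /links E eqxx bx zP.
Qed.

(** Every bad end has a link; exchanging the two sums counts the links at their payers. *)
Lemma pay_total : \sum_x bad x <= \sum_(h | cov h) (pay true h + pay false h).
Proof.
rewrite [leqRHS](eq_bigr (fun h => \sum_x (links true h x + links false h x)%N)); last first.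
  by move=> h _; rewrite !pay_sum big_split.
rewrite exchange_big /=; apply: leq_sum => x _.
case bx: (bad x) => //; have [b [h lk]] := bad_links bx.
have hP : cov h by case/and4P: lk.
rewrite (bigD1 h) //=; case: b lk => ->; lia.
Qed.

(** * Charges and payments against the budget of each path *)

Definition act b v := ch b v + pay b v.

Lemma pay_le b v : pay b v <= 1.
Proof. by rewrite /pay; case: ohead => // x; case: links. Qed.

Lemma pay_near b v : has (near_end v) P -> pay b v = 0.
Proof. by move=> vn; rewrite /pay; case: ohead => // x; rewrite /links vn !andbF. Qed.

(** A nonempty run and a payment never occur in the same direction, since a linked end is covered
    and stops the run at once. *)
Lemma act_cases b v :
  ch b v = (run b v).*2 /\ act b v = (run b v).*2 \/ act b v <= maxn (run b v) 1.
Proof.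
case r0: (run b v) => [|r].
  right; rewrite /act; have := charge_le b v; rewrite r0 leqn0 => /eqP->.
  exact: pay_le.
have -> : act b v = ch b v.
  rewrite /act (_ : pay b v = 0) ?addn0 //.
  move: r0; rewrite /pay /links /run.
  case: (sd b v) => //= y s; case: ifP => // yP _.
  case yb: (bad y); last by rewrite andbF.
  by rewrite (bad_cov yb) in yP.
rewrite /charge /charge_along -/(run b v) r0.
case: drop => [|w _]; first by left.
case: (heavy v); case: (heavy w); by [left | right; lia].
Qed.

Definition act2 v := act true v + act false v.

(** Only two runs of order 2, both charged in full, give 8; any other total is at most 4 + 2, and
    without a run of order 2 charged in full it is at most 2 + 2. *)
Lemma act2_third v : (forall b, run b v <= 2) ->
  [/\ act2 v <= 8, act2 v <= 6 \/ charge2 v = 8 & 4 < act2 v -> exists b, run b v = 2].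
Proof.
move=> r2; have rt := r2 true; have rf := r2 false; rewrite /act2 /charge2.
have At := act_cases true v; have Af := act_cases false v.
split.
- by case: At => [[]|]; case: Af => [[]|]; lia.
- by case: At => [[]|]; case: Af => [[]|]; lia.
move=> gt; case: (eqVneq (run true v) 2) => [|nt]; first by exists true.
by exists false; case: At => [[]|]; case: Af => [[]|]; lia.
Qed.

Lemma act2_fourth v : (forall b, run b v <= 3) ->
  [/\ act2 v <= 12, act2 v <= 10 \/ charge2 v = 12 & 8 < act2 v -> exists b, run b v = 3].
Proof.
move=> r2; have rt := r2 true; have rf := r2 false; rewrite /act2 /charge2.
have At := act_cases true v; have Af := act_cases false v.
split.
- by case: At => [[]|]; case: Af => [[]|]; lia.
- by case: At => [[]|]; case: Af => [[]|]; lia.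
move=> gt; case: (eqVneq (run true v) 3) => [|nt]; first by exists true.
by exists false; case: At => [[]|]; case: Af => [[]|]; lia.
Qed.

Lemma takes_near p Q v : takes P p Q -> near_end v p -> has (near_end v) P.
Proof.
move=> tk vp; apply/hasP; case: (takes_mem tk) => pP; first by exists p.
by exists (rev p) => //; rewrite near_end_rev.
Qed.

Lemma act2_end x suf Q : takes P (x :: suf) Q -> act2 x = 0.
Proof.
move=> tk; rewrite /act2 /act !(end_charge _ tk) !pay_near //.
  by apply: (takes_near tk); rewrite /near_end /= inE eqxx.
by apply: (takes_near tk); rewrite /near_end /= inE eqxx.
Qed.

Lemma act2_second u0 u1 suf Q : takes P (u0 :: u1 :: suf) Q -> act2 u1 = charge2 u1.
Proof.
move=> tk; have n1 : has (near_end u1) P.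
  by apply: (takes_near tk); rewrite /near_end /= take0 !inE eqxx orbT.
by rewrite /act2 /act !pay_near // !addn0.
Qed.

(** The budget in half vertices: a whole vertex for [v], the half that a bad end receives through
    its link, and a whole vertex more if [O] misses [v]. *)
Definition quota v := 2 + bad v + (v \notin flatten O).*2.

Lemma quota_ge v : 2 <= quota v.
Proof. by rewrite /quota; lia. Qed.

Lemma path4_bound a b c d Q : takes P [:: a; b; c; d] Q ->
  \sum_(v <- [:: a; b; c; d]) act2 v <= \sum_(v <- [:: a; b; c; d]) quota v.
Proof.
move=> tk; have tk' : takes P [:: d; c; b; a] Q := takes_rev tk.
rewrite !big_cons !big_nil (act2_end tk) (act2_end tk') (act2_second tk) (act2_second tk').
have := second_charge tk; have := second_charge tk'; rewrite -!/(charge2 _).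
have := quota_ge a; have := quota_ge b; have := quota_ge c; have := quota_ge d.
lia.
Qed.

(** The ends carry nothing. A center carrying at most 4 leaves 3 for each second vertex; one
    carrying 5 or 6 has a full run, which limits them to 2; at 8 they are limited to 1, up to the
    extra budget of [u0] and [v0]. The total is at most 10 each time. *)
Lemma path5_bound u0 u1 c v1 v0 Q : takes P [:: u0; u1; c; v1; v0] Q ->
  \sum_(v <- [:: u0; u1; c; v1; v0]) act2 v <= \sum_(v <- [:: u0; u1; c; v1; v0]) quota v.
Proof.
move=> tk; have tk' : takes P [:: v0; v1; c; u1; u0] Q := takes_rev tk.
rewrite !big_cons !big_nil (act2_end tk) (act2_end tk') (act2_second tk) (act2_second tk').
have := second_charge tk; have := second_charge tk'; rewrite -!/(charge2 _) => U V.
have rc b : run b c <= 2 by apply: (@run_le [:: u0; u1] c [:: v1; v0] Q b).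
have [A8 A6 full] := act2_third rc.
have q1 := quota_ge u1; have q2 := quota_ge c; have q3 := quota_ge v1.
case: (leqP (act2 c) 4) => [|gt].
  by have := quota_ge u0; have := quota_ge v0; lia.
case: A6 => [le6|c8].
  have [b fb] := full gt.
  have := @full_second_charge u0 u1 c [::] [:: v1; v0] Q b tk isT isT fb.
  have := @full_second_charge v0 v1 c [::] [:: u1; u0] Q b tk' isT isT fb.
  rewrite -!/(charge2 _) => U2 V2.
  by have := quota_ge u0; have := quota_ge v0; lia.
have := @bad_intro u0 u1 [::] c [:: v1; v0] Q tk isT erefl c8.
have := @bad_intro v0 v1 [::] c [:: u1; u0] Q tk' isT erefl c8.
rewrite /(quota u0) /(quota v0); bool_lia.
Qed.

Lemma takes_other p Q q Q' x : takes P p Q -> takes P q Q' ->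
  x \in q -> x \notin p -> exists Q2, takes Q q Q2.
Proof.
move=> tk tk' xq xp; have : x \in flatten Q.
  have := takes_in tk' xq.
  by rewrite (perm_mem (takes_perm tk)) mem_cat (negbTE xp).
case/flattenP=> r rQ xr; have rP := takes_sub tk rQ; exists (rem r Q).
case: (takes_mem tk') => qP.
  by left; rewrite -(flatten_uniq_mem uniqP rP qP xr xq); apply: perm_to_rem.
right; rewrite -(flatten_uniq_mem uniqP rP qP xr) ?mem_rev //.
exact: perm_to_rem.
Qed.

Lemma takes_same p Q q Q' x : takes P p Q -> takes P q Q' ->
  x \in q -> x \in p -> q = p \/ q = rev p.
Proof.
move=> tk tk' xq xp; have E := @flatten_uniq_mem _ P _ _ x uniqP.
case: (takes_mem tk) => pP; case: (takes_mem tk') => qP.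
- by left; apply: E.
- by right; rewrite -[q]revK; congr rev; apply: E; rewrite ?mem_rev.
- by right; apply: E; rewrite ?mem_rev.
by left; apply: (can_inj revK); apply: E; rewrite ?mem_rev.
Qed.

(** Once uncovered by the replacement, [v2 v1 v0] would be an extension at [w], an end of its path,
    and Look-ahead of the second kind would apply. *)
Lemma look_ahead_ii_absurd u0 u1 c v2 v1 v0 Q e w suf Q' :
  takes P [:: u0; u1; c; v2; v1; v0] Q -> extension G P c e -> size e = 2 ->
  [|| w \in e, w \in [:: u0; u1] | has (near_end w) Q] ->
  takes (([:: u0; u1] ++ c :: e) :: Q) (w :: suf) Q' ->
  G w v2 = false.
Proof.
move=> tk ext se wH tk'; apply/negP => wv.
pose P' := (rev [:: v2; v1; v0] ++ w :: suf) :: Q'.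
apply: (termP (i := 4)); exists P', [:: u0; u1], c, [:: v2; v1; v0], Q, e.
split=> //; right; split=> //; exists w, [:: v2; v1; v0]; split=> //; first by left.
exists [::], suf, Q'; split=> //.
have := takes_sorted tk; rewrite /= => /and5P[_ _ _ v21 /andP[v10 _]].
have up := takes_uniq tk.
have up' : uniq ([:: v2; v1; v0] ++ [:: u0; u1; c] ++ flatten Q).
  by rewrite uniq_catCA.
have ue : {in [:: v2; v1; v0], forall y, y \notin e}.
  move=> y yv; have /extensionP[_ _ De] := ext.
  apply/negP=> /De/negP; apply; apply: (takes_in tk).
  by rewrite -[[:: u0; u1; c; v2; v1; v0]]/([:: u0; u1; c] ++ [:: v2; v1; v0]) mem_cat yv orbT.
rewrite /extension; apply/and3P; split.
- by rewrite /= wv v21 v10.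
- by move: up'; rewrite cat_uniq => /andP[].
apply/allP=> y yv; move: up'; rewrite cat_uniq => /and3P[_ /hasPn D _].
have : y \notin [:: u0; u1; c] ++ flatten Q by apply: contraL yv => /D.
have := ue y yv; rewrite /= !inE !mem_cat !negb_or.
by move=> -> /and4P[-> -> -> ->].
Qed.

(* A link to v_2 would make the second kind of Look-ahead applicable. *)
Lemma sixth_pay u0 u1 c v2 v1 v0 Q b0 b :
  takes P [:: u0; u1; c; v2; v1; v0] Q -> run b0 c = 2 ->
  (forall b, run b v2 = 0) -> pay b v2 = 0.
Proof.
move=> tk full rv; rewrite /pay; case E: (sd b v2) => [|x s] //=.
case lk: (links b v2 x) => //; case/and4P: lk => _ bx _ _.
have := side_path feasO b v2; rewrite E /= adjC => /andP[xv _].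
have [u1' [pre2 [c' [suf [Q' [tk' half t23 fl _]]]]]] := bad_elim bx.
have ext := run_extension b0 c; have se := size_run b0 c; rewrite full in ext se.
have xq : x \in (x :: u1' :: pre2) ++ c' :: suf by rewrite inE eqxx.
have absurd := @look_ahead_ii_absurd u0 u1 c v2 v1 v0 Q _ x _ _ tk ext se.
case xp: (x \in [:: u0; u1; c; v2; v1; v0]); last first.
  have [Q2 tk2] := takes_other tk tk' xq (negbT xp).
  have xQ : x \in flatten Q.
    have := takes_in tk' xq.
    by rewrite (perm_mem (takes_perm tk)) mem_cat xp.
  case/flattenP: xQ => q qQ xq'.
  suff : G x v2 = false by rewrite xv.
  apply: (absurd (u1' :: pre2 ++ c' :: suf) (([:: u0; u1] ++ c :: take 2 (sd b0 c)) :: Q2)).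
    apply/or3P; apply: Or33; apply/hasP; exists q => //.
    case/andP: invP => fP _.
    have tk0 : takes P ([::] ++ x :: (u1' :: pre2 ++ c' :: suf)) Q' := tk'.
    by rewrite (near_end_takes fP tk0 (takes_sub tk qQ) xq').
  case: tk2 => tk2; [left | right].
    apply: (@perm_trans _ (([:: u0; u1] ++ c :: take 2 (sd b0 c)) :: (x :: u1' :: pre2 ++ c' :: suf) :: Q2)).
      by rewrite perm_cons.
    exact: perm_cons_swap.
  apply: (@perm_trans _ (([:: u0; u1] ++ c :: take 2 (sd b0 c)) :: rev (x :: u1' :: pre2 ++ c' :: suf) :: Q2)).
    by rewrite perm_cons.
  exact: perm_cons_swap.
(* On the path itself, [x] is [u0], still an end after the replacement, or [v0]; in the latter case
   [v2] is the center of the bad reading and has a run of order 2, contrary to [rv]. *)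
have [pE|pE] := takes_same tk tk' xq xp.
  case: pE => xu _ _; subst x.
  suff : G u0 v2 = false by rewrite xv.
  apply: (absurd (u1 :: c :: take 2 (sd b0 c)) Q); last by left.
  by rewrite !inE eqxx /= orbT.
move: pE half t23 fl; rewrite [rev _]/=.
case: (pre2) => [|a2 [|? ?]] //=.
  by case=> _ _ -> _ _ _ /(_ b); rewrite rv.
case=> _ _ _ _ ->.
by [].
Qed.

(** If [u2] carries at most 4, then [v2] adds at most 2 for its links and the second vertices 3
    each. A larger [u2] has a full run, which forbids links at [v2]: the total is at most 6 + 2 + 3,
    or 8 + 1 + 3 up to the extra budget of [u0]. *)
Lemma path6_one_sided u0 u1 u2 v2 v1 v0 Q :
  takes P [:: u0; u1; u2; v2; v1; v0] Q -> (forall b, run b v2 = 0) ->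
  act2 u2 + act2 v2 + charge2 u1 + charge2 v1 <= 12 + bad u0 + (u0 \notin flatten O).*2.
Proof.
move=> tk rv; have tk' : takes P [:: v0; v1; v2; u2; u1; u0] Q := takes_rev tk.
have := second_charge tk; have := second_charge tk'; rewrite -!/(charge2 _) => U V.
have rc b : run b u2 <= 2 by apply: (@run_le [:: u0; u1] u2 [:: v2; v1; v0] Q b).
have [A8 A6 full] := act2_third rc.
have B2 : act2 v2 <= 2.
  rewrite /act2; have := act_cases true v2; have := act_cases false v2.
  by rewrite !rv => H1 H2; case: H1 => [[]|]; case: H2 => [[]|]; lia.
case: (leqP (act2 u2) 4) => [|gt]; first by lia.
have [b fb] := full gt.
have B0 : act2 v2 = 0.
  have c0 b' : ch b' v2 = 0.
    by apply/eqP; rewrite -leqn0; apply: leq_trans (charge_le b' v2) _; rewrite rv.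
  by rewrite /act2 /act !c0 !(sixth_pay _ tk fb rv).
case: A6 => [le6|c8].
  have := @full_second_charge u0 u1 u2 [::] [:: v2; v1; v0] Q b tk isT isT fb.
  by rewrite -!/(charge2 _); lia.
have := @bad_intro u0 u1 [::] u2 [:: v2; v1; v0] Q tk isT erefl c8.
by bool_lia.
Qed.

Lemma run_pos b v : 0 < run b v -> exists y s, [/\ sd b v = y :: s, y \in rest & G v y].
Proof.
have := side_path feasO b v.
rewrite /run; case E: (sd b v) => [|a r] //= /andP[va _]; case: ifP => // yP _.
by exists a, r; rewrite inE yP.
Qed.

(** By DoubleRep the uncovered neighbors of [u2] and [v2] on [O] are one vertex [y], whose charge
    the two share evenly. On its other side [u2] has no run and at most one link. *)
Lemma path6_two_sided u0 u1 u2 v2 v1 v0 Q b b' :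
  takes P [:: u0; u1; u2; v2; v1; v0] Q -> 0 < run b u2 -> 0 < run b' v2 ->
  act2 u2 <= 2.
Proof.
move=> tk ru rv.
have [y [s [Ey yR uy]]] := run_pos ru; have [z [s' [Ez zR vz]]] := run_pos rv.
have zy : z = y by rewrite (third6_rest tk yR zR uy vz).
subst z.
have r0 : run (~~ b) u2 = 0.
  apply/eqP; rewrite -leqn0 leqNgt; apply/negP => /run_pos[x [t [Ex xR ux]]].
  have xy := third6_rest tk xR yR ux vz; subst x.
  have := @side_disjoint _ _ _ feasO b u2 y; rewrite Ey Ex !inE eqxx.
  by move/(_ isT).
have uv : u2 != v2.
  have := takes_uniq tk; rewrite /= !inE !negb_or.
  by case/and4P=> _ _ /andP[-> _] _.
have [Es Eu] := side_turn feasO (Ey : sd b u2 = [::] ++ y :: s).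
have [Es' Ev] := side_turn feasO (Ez : sd b' v2 = [::] ++ y :: s').
have bb : b' = ~~ b.
  suff: b' != b by case: (b); case: (b').
  apply/eqP => bb; subst b'.
  move: Ev; rewrite Eu /= => -[E]; by rewrite E eqxx in uv.
have sv : sd b u2 = y :: v2 :: sd (~~ b') v2.
  have bb' : b = ~~ b' by rewrite bb negbK.
  by rewrite Ey -Es bb' Ev.
have h2 : heavy u2 = false by rewrite (@heavyE [:: u0; u1] _ [:: v2; v1; v0] Q).
have hv2 : heavy v2 = false by rewrite (@heavyE [:: u0; u1; u2] _ [:: v1; v0] Q).
have v2P : v2 \in flatten P by apply: (takes_in tk); rewrite !inE eqxx !orbT.
have yP : y \in flatten P = false by apply: negbTE.
have cb : ch b u2 = 1.
  by rewrite /charge /charge_along sv /= yP v2P /= h2 hv2.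
have := act_cases b u2; have := act_cases (~~ b) u2; rewrite r0 cb.
have -> : run b u2 = 1 by rewrite /run sv /= yP v2P.
rewrite /act2; case: (b) => /= H1 H2; clear -H1 H2; case: H1 => [[]|]; case: H2 => [[]|]; lia.
Qed.

Lemma path6_bound u0 u1 u2 v2 v1 v0 Q : takes P [:: u0; u1; u2; v2; v1; v0] Q ->
  \sum_(v <- [:: u0; u1; u2; v2; v1; v0]) act2 v <=
  \sum_(v <- [:: u0; u1; u2; v2; v1; v0]) quota v.
Proof.
move=> tk; have tk' : takes P [:: v0; v1; v2; u2; u1; u0] Q := takes_rev tk.
rewrite !big_cons !big_nil (act2_end tk) (act2_end tk') (act2_second tk) (act2_second tk').
have q1 := quota_ge u1; have q2 := quota_ge u2; have q3 := quota_ge v1; have q4 := quota_ge v2.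
have [rv|] := boolP [forall b, run b v2 == 0].
  have := path6_one_sided tk (fun b => eqP (forallP rv b)).
  by have := quota_ge v0; rewrite /(quota u0); bool_lia.
rewrite negb_forall => /existsP[b']; rewrite -lt0n => rv.
have [ru|] := boolP [forall b, run b u2 == 0].
  have := path6_one_sided tk' (fun b => eqP (forallP ru b)).
  by have := quota_ge u0; rewrite /(quota v0); bool_lia.
rewrite negb_forall => /existsP[b]; rewrite -lt0n => ru.
have := second_charge tk; have := second_charge tk'; rewrite -!/(charge2 _).
have := path6_two_sided tk ru rv; have := path6_two_sided tk' rv ru.
by have := quota_ge v0; have := quota_ge u0; lia.
Qed.

(** If the bad end [x] belongs to a path of order 5 or 6, Re-cover applies: [v0 v1 v2 c] is a
    4-path, and [u0 u1 u2] is joined to the other path at [x]. If the order is 7, freeing the half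
    at [x] gives [u2], which is not heavy, an extension of order 3. If [u2] itself lies in that
    half, then [x] is [u0] and the edge is the chord already excluded. *)
Lemma seven_third_pay u0 u1 u2 c v2 v1 v0 Q b :
  takes P [:: u0; u1; u2; c; v2; v1; v0] Q -> pay b u2 = 0.
Proof.
move=> tk; rewrite /pay; case E: (ohead (sd b u2)) => [x|] //=.
case lk: (links b u2 x) => //; case/and4P: lk => _ bx _ _.
have ux : G u2 x.
  by have := side_path feasO b u2; case: (sd b u2) E => //= y s [->] /andP[].
have [u1' [pre2 [c' [suf [Q' [tk' half t23 fl [c1 xO mid]]]]]]] := bad_elim bx.
have xq : x \in (x :: u1' :: pre2) ++ c' :: suf by rewrite inE eqxx.
have uP : u2 \in flatten P by apply: (takes_in tk); rewrite !inE eqxx !orbT.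
have hu : heavy u2 = false by rewrite (@heavyE [:: u0; u1] _ [:: c; v2; v1; v0] Q).
have sp := takes_sorted tk'; have up := takes_uniq tk'.
case E2: pre2 t23 => [|w2 [|//]] _.
  have xp : x \notin [:: u0; u1; u2; c; v2; v1; v0].
    apply/negP=> xp; move: mid; rewrite E2 in tk' xq *.
    by case: (takes_same tk tk' xq xp) => ->.
  have [Q2 tk2] := takes_other tk tk' xq xp.
  subst pre2; exfalso.
  set q := (x :: u1' :: [::]) ++ c' :: suf in tk' tk2 half xq sp up.
  have q5 : 5 <= size q.
    by move: half; rewrite /q /= => ?; size_lia.
  have [q' [tkq qq']] : exists q', perm_eq Q (q' :: Q2) /\ perm_eq q' q.
    by case: tk2 => ?; [exists q | exists (rev q)]; rewrite ?perm_rev.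
  have [p' [tkp pp']] : exists p', perm_eq P (p' :: Q) /\
      perm_eq p' [:: u0; u1; u2; c; v2; v1; v0].
    by case: tk => ?; eexists; split; try eassumption; rewrite ?perm_rev.
  have pN : perm_eq (flatten [:: [:: v0; v1; v2; c]; [:: u0; u1; u2] ++ q]) (p' ++ q').
    rewrite perm_sym.
    have -> : flatten [:: [:: v0; v1; v2; c]; [:: u0; u1; u2] ++ q] =
        ([:: v0; v1; v2; c] ++ [:: u0; u1; u2]) ++ q by rewrite /= cats0.
    apply: perm_cat qq'; apply: (perm_trans pp'); rewrite -perm_rev.
    by rewrite -[rev _]/([:: v0; v1; v2; c] ++ rev [:: u0; u1; u2]) perm_cat2l perm_rev.
  have tkpq : perm_eq P (p' :: q' :: Q2).
    by apply: (perm_trans tkp); rewrite perm_cons.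
  apply: (termP (i := 3)).
  exists ([:: [:: v0; v1; v2; c]; [:: u0; u1; u2] ++ q] ++ Q2).
  exists p', q', Q2, [:: [:: v0; v1; v2; c]; [:: u0; u1; u2] ++ q]; split=> //.
  - by rewrite (perm_size pp') (perm_size qq').
  - split=> //; rewrite feasibleE (perm_uniq pN).
    have U := uniqP; rewrite (perm_uniq (perm_flatten tkpq)) /= in U.
    move: U; rewrite catA cat_uniq => /andP[-> _] /=.
    have := takes_sorted tk; have := takes_sorted (takes_rev tk).
    rewrite /long /= => /and5P[-> -> -> _ _] /and5P[-> -> _ _ _].
    by rewrite ux /= andbT; move: sp; rewrite /q /= => ->.
case upre: (u2 \in [:: x; u1'; w2]); last first.
  exfalso; subst pre2.
  have := full_path tk' half isT (fl true) uP (negbT upre).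
  move: sp up; rewrite /= !inE !negb_or => /and4P[x1 x2 _ _].
  case/and3P=> /and3P[n1 n2 _] /andP[n3 _] _.
  move/(_ [:: x; u1'; w2]); rewrite /= ux x1 x2 !inE !negb_or n1 n2 n3 => /(_ isT isT).
  by case=> // /(_ (negbT hu)).
have [pE|pE] : (x :: u1' :: pre2) ++ c' :: suf = [:: u0; u1; u2; c; v2; v1; v0] \/
    (x :: u1' :: pre2) ++ c' :: suf = rev [:: u0; u1; u2; c; v2; v1; v0].
- apply: (takes_same (x := u2) tk tk'); last by rewrite !inE eqxx !orbT.
  by rewrite E2 mem_cat upre.
- have := full_no_chord tk' half _ (fl true) c1; rewrite E2 => /(_ isT _ erefl).
  by move: pE; rewrite E2 => -[_ _ -> _ _]; rewrite ux.
move: pE upre; rewrite E2 => -[-> -> -> _ _].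
have := takes_uniq tk; rewrite /= !inE !negb_or.
case/and4P=> _ _ /and5P[_ n1 n2 n3 _] _.
by rewrite (negbTE n1) (negbTE n2) (negbTE n3).
Qed.

Lemma seven_third u0 u1 u2 c v2 v1 v0 Q :
  takes P [:: u0; u1; u2; c; v2; v1; v0] Q -> act2 u2 = 0.
Proof.
move=> tk; have c0 b : ch b u2 = 0.
  apply/eqP; rewrite -leqn0; apply: leq_trans (charge_le b u2) _.
  case r: (run b u2) => [|k] //.
  have : 0 < run b u2 by rewrite r.
  case/run_pos=> y [s [_ yR uy]].
  by have := third7_rest tk yR; rewrite uy.
by rewrite /act2 /act !c0 !(seven_third_pay _ tk).
Qed.

(** The third vertices carry nothing, and the cases are 8 + 3 + 3, 10 + 2 + 2 and 12 + 1 + 1 up to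
    bad or missed ends, against 14. *)
Lemma path7_bound u0 u1 u2 c v2 v1 v0 Q : takes P [:: u0; u1; u2; c; v2; v1; v0] Q ->
  \sum_(v <- [:: u0; u1; u2; c; v2; v1; v0]) act2 v <=
  \sum_(v <- [:: u0; u1; u2; c; v2; v1; v0]) quota v.
Proof.
move=> tk; have tk' : takes P [:: v0; v1; v2; c; u2; u1; u0] Q := takes_rev tk.
rewrite !big_cons !big_nil (act2_end tk) (act2_end tk') (act2_second tk) (act2_second tk').
rewrite (seven_third tk) (seven_third tk').
have := second_charge tk; have := second_charge tk'; rewrite -!/(charge2 _) => U V.
have rc b : run b c <= 3 by apply: (@run_le [:: u0; u1; u2] c [:: v2; v1; v0] Q b).
have [A8 A6 full] := act2_fourth rc.
have q1 := quota_ge u1; have q2 := quota_ge c; have q3 := quota_ge v1.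
have q4 := quota_ge u2; have q5 := quota_ge v2.
case: (leqP (act2 c) 8) => [|gt].
  by have := quota_ge u0; have := quota_ge v0; lia.
case: A6 => [le6|c8].
  have [b fb] := full gt.
  have := @full_second_charge u0 u1 c [:: u2] [:: v2; v1; v0] Q b tk isT isT fb.
  have := @full_second_charge v0 v1 c [:: v2] [:: u2; u1; u0] Q b tk' isT isT fb.
  rewrite -!/(charge2 _) => U2 V2.
  by have := quota_ge u0; have := quota_ge v0; lia.
have := @bad_intro u0 u1 [:: u2] c [:: v2; v1; v0] Q tk isT erefl c8.
have := @bad_intro v0 v1 [:: v2] c [:: u2; u1; u0] Q tk' isT erefl c8.
rewrite /(quota u0) /(quota v0); bool_lia.
Qed.

Lemma path_bound p : p \in P -> \sum_(v <- p) act2 v <= \sum_(v <- p) quota v.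
Proof.
move=> /mem_takes tk; have := takes_sizes tk; move: tk; move: (rem p P) => Q.
case: p => [|a [|b [|c [|d p]]]] //.
case: p => [|e [|f [|g [|h p]]]] // tk _.
- exact: path4_bound tk.
- exact: path5_bound tk.
- exact: path6_bound tk.
exact: path7_bound tk.
Qed.

(** * Summation over all paths *)

Lemma hosts_meet : all (has cov) O.
Proof.
apply/allP=> q qO; apply/negPn/negP => nq.
have := feasO; rewrite /feasible => /andP[_ /allP/(_ _ qO)/andP[/andP[uq sq] s4]].
apply: (termP (i := 0)); exists (take 4 q :: P), (take 4 q); split=> //.
- by rewrite size_takel.
- by rewrite /gpath take_uniq // take_sorted.
apply/allP=> y /mem_take yq; apply: contra nq => yP.
by apply/hasP; exists y.
Qed.

(** Once the bad ends cancel, the vertices of [O] outside [P] number at most those of [P] plus those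
    of [P] outside [O]. Adding the common vertices to both sides gives twice the size of [P]. *)
Lemma terminal_ratio : #|covered O| <= 2 * #|covered P|.
Proof.
have /andP[fP _] := invP.
rewrite (covered_card feasO) (covered_card fP).
have U := uniqP; have Uo : uniq (flatten O).
  by move: feasO; rewrite feasibleE => /andP[].
have sumP (F : T -> nat) : \sum_(v | cov v) F v = \sum_(p <- P) \sum_(v <- p) F v.
  by rewrite -big_flatten big_uniq.
have H1 := charge_ge feasO heavy hosts_meet.
have H2 := pay_total.
have H3 : \sum_(v | cov v) act2 v <= \sum_(v | cov v) quota v.
  by rewrite !sumP !big_seq; apply: leq_sum => p pP; apply: path_bound.
have E3 : \sum_(v | cov v) act2 v =
    \sum_(v | cov v) (ch true v + ch false v) + \sum_(v | cov v) (pay true v + pay false v).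
  by rewrite -big_split; apply: eq_bigr => v _; rewrite /act2 /act /= addnACA.
have Eb : \sum_(v | cov v) bad v <= \sum_v bad v.
  by rewrite [leqRHS](bigID cov) /= leq_addr.
have E4 : \sum_(v | cov v) quota v =
    2 * size (flatten P) + \sum_(v | cov v) bad v + (count (predC (mem (flatten O))) (flatten P)).*2.
  rewrite !big_split /= -!big_uniq //; congr (_ + _ + _).
    by rewrite big_const_seq count_predT iter_addn_0.
  elim: (flatten P) => [|v s IH]; rewrite ?big_nil // big_cons IH /=.
  by rewrite doubleD.
have E5 : size (flatten O) = count cov (flatten O) + count (predC cov) (flatten O).
  by rewrite count_predC.
have E6 : size (flatten P) = count (mem (flatten O)) (flatten P) + count (predC (mem (flatten O))) (flatten P).
  by rewrite count_predC.
have E7 : count cov (flatten O) = count (mem (flatten O)) (flatten P).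
  rewrite -!size_filter; apply/perm_size/uniq_perm; rewrite ?filter_uniq //.
  by move=> v; rewrite !mem_filter andbC.
move: E3 E4 E5 E6 E7 H1 H2 H3 Eb.
move: (\sum_(v | cov v) act2 v) (\sum_(v | cov v) quota v) (\sum_v bad v)
  (\sum_(v | cov v) bad v) (\sum_(v | cov v) (ch true v + ch false v))
  (\sum_(v | cov v) (pay true v + pay false v)) (count cov (flatten O))
  (count (predC cov) (flatten O)) (count (mem (flatten O)) (flatten P))
  (count (predC (mem (flatten O))) (flatten P)) (size (flatten O)) (size (flatten P)).
clear; lia.
Qed.

End Terminal.

(** * An instance of ratio 16/9 *)

Section IndependentRest.
Variables (T : finType) (G : sgraph T) (P : coll T).
Hypothesis indep : forall x y, x \notin flatten P -> y \notin flatten P -> ~~ G x y.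

Lemma independent_add : ~ applicable G 0 P.
Proof.
case=> P' [[|x [|y p]] []] //= _ /andP[_ /= /andP[xy _]].
by case/and3P=> /indep Hx /Hx; rewrite xy.
Qed.

Lemma independent_extension x e : extension G P x e -> size e <= 1.
Proof.
case: e => [|y [|z e]] //= /and3P[/and3P[_ yz _] _ /and3P[/indep Hy /Hy]].
by rewrite yz.
Qed.

(** Extensions have order at most 1, and none but the empty one starts at an end. Rep needs longer
    ones, DoubleRep needs 8 vertices where there are at most 5 + 2, Re-cover needs two paths of
    order at least 5, and Look-ahead an extension of order at least 2. *)
Lemma independent_terminal :
  (forall x suf Q y, takes P (x :: suf) Q -> y \notin flatten P -> ~~ G x y) ->
  all (fun p => size p <= 5) P -> count (fun p => 5 <= size p) P <= 1 ->
  terminal G P.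
Proof.
move=> ends s5 c5 [|[|[|[|[|i]]]]].
- exact: independent_add.
- case=> P' [x [e [pre [suf [Q [tk _ ext le _]]]]]].
  have := independent_extension ext.
  case: pre tk le => [|? pre] /= tk le; last by lia.
  case: e ext le => // y e /and3P[/andP[xy _] _ /andP[yP _]] _ _.
  by have := ends _ _ _ _ tk yP; rewrite xy.
- case=> P' [pre [x [mid [y [suf [Q [e [f [tk _ [ee ef _] [le lf] _]]]]]]]]].
  have := independent_extension ee; have := independent_extension ef.
  have : size (pre ++ x :: mid ++ y :: suf) <= 5.
    by case: (takes_mem tk) => /(allP s5); rewrite ?size_rev.
  by rewrite size_cat /= size_cat /=; lia.
- case=> P' [p [q [Q [N [/permP/(_ (fun p => 5 <= size p)) E [lp lq] _ _ _]]]]].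
  by move: c5; rewrite E /= lp lq.
- case=> P' [pre [x [suf [Q [e [_ [_]]]]]]].
  by rewrite !inE => + /independent_extension => /orP[] /eqP->; lia.
by case=> P'; rewrite /operation /= nth_nil.
Qed.

End IndependentRest.

(** The output consists of [0 1 2 3 4] and [5 6 7 8]. The optimum covers all 16 vertices:
    [9 1 10 2 11 3 12] and [13 6 14 7 15] weave the uncovered vertices through the inner ones, and
    [0 5 4 8] collects the four ends. *)
Definition edges16 : seq (nat * nat) :=
  [:: (0, 1); (1, 2); (2, 3); (3, 4); (5, 6); (6, 7); (7, 8);
      (9, 1); (1, 10); (10, 2); (2, 11); (11, 3); (3, 12);
      (13, 6); (6, 14); (14, 7); (7, 15); (0, 5); (5, 4); (4, 8)].

Definition adj16 (x y : 'I_16) :=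
  ((x : nat, y : nat) \in edges16) || ((y : nat, x : nat) \in edges16).

Lemma adj16_all (p : pred (nat * nat)) (x y : 'I_16) :
  all p edges16 -> adj16 x y -> p (x : nat, y : nat) || p (y : nat, x : nat).
Proof. by move/allP=> H /orP[] /H ->; rewrite ?orbT. Qed.

Lemma adj16_sym : symmetric adj16.
Proof. by move=> x y; rewrite /adj16 orbC. Qed.

Lemma adj16_irr : irreflexive adj16.
Proof.
move=> x; apply/negP=> /(@adj16_all (fun e => e.1 != e.2) _ _ isT) /=.
by rewrite eqxx.
Qed.

Definition graph16 := SGraph adj16_sym adj16_irr.

Notation "'vtx' k" := (@Ordinal 16 k isT) (at level 0, k at level 0).

Definition path_x := [:: vtx 5; vtx 6; vtx 7; vtx 8].
Definition path_u := [:: vtx 1; vtx 2; vtx 3; vtx 4].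

Lemma rest16 (k : nat) (P : coll 'I_16) (x : 'I_16) :
  all (fun j => (k <= j < 9) ==> (j \in map val (flatten P))) (iota 0 16) ->
  x \notin flatten P -> (x < k) || (9 <= x).
Proof.
move/allP/(_ x); rewrite mem_iota /= ltn_ord => /(_ isT).
rewrite mem_map; last exact: val_inj.
by case: (x \in _) => //=; rewrite implybF; lia.
Qed.

Lemma indep16 k P x y :
  all (fun j => (k <= j < 9) ==> (j \in map val (flatten P))) (iota 0 16) ->
  all (fun e => ~~ [&& (e.1 < k) || (9 <= e.1) & (e.2 < k) || (9 <= e.2)]) edges16 ->
  x \notin flatten P -> y \notin flatten P -> ~~ graph16 x y.
Proof.
move=> HP HE /(rest16 HP) Hx /(rest16 HP) Hy; apply/negP=> /(adj16_all HE) /=.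
by rewrite Hx Hy.
Qed.

(** Add only inserts 4-paths, so the path of order 5 arises from [1 2 3 4] by a Rep at 1 with the
    extension 0. *)
Lemma tight_execution :
  complete_execution graph16
    [:: [:: path_x]; [:: path_u; path_x]; [:: vtx 0 :: path_u; path_x]].
Proof.
have nobreak P : all (fun p => size p <= 7) P -> @broken 'I_16 P P.
  by move=> s7; apply: Broken_done.
split=> /=.
  split; [|split; [|split=> //]].
  - exists 0, [:: path_x]; split=> //; first by exists path_x; split.
    exact: nobreak.
  - exists 0, [:: path_u; path_x]; split=> //; first by exists path_u; split.
    exact: nobreak.
  exists 1, [:: vtx 0 :: path_u; path_x]; split; last exact: nobreak.
    move=> [|//] _; apply: independent_add => x y; exact: (@indep16 1).
  exists (vtx 1), [:: vtx 0], [::], [:: vtx 2; vtx 3; vtx 4], [:: path_x]; split=> //.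
  by left.
apply: independent_terminal => // [x y|]; first exact: (@indep16 0).
move=> x suf Q y tk /(@rest16 0 [:: vtx 0 :: path_u; path_x] y isT) /= y9.
have : x \in [:: vtx 0; vtx 4; vtx 5; vtx 8].
  have hd (z : 'I_16) s : x :: suf = z :: s -> x = z by case.
  case: (takes_mem tk) => [|/(map_f rev)]; rewrite ?revK !inE => /orP[] /eqP E.
  - by rewrite (hd _ _ E).
  - by rewrite (hd _ _ E).
  - by rewrite (hd (vtx 4) (rev [:: vtx 0; vtx 1; vtx 2; vtx 3]) E).
  by rewrite (hd (vtx 8) (rev [:: vtx 5; vtx 6; vtx 7]) E).
rewrite !inE => Hx; apply/negP.
move=> /(@adj16_all (fun e => ~~ [&& e.1 \in [:: 0; 4; 5; 8] & 9 <= e.2]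
  && ~~ [&& e.2 \in [:: 0; 4; 5; 8] & 9 <= e.1]) _ _ isT) /=.
rewrite y9 !andbT.
by case/or4P: Hx => /eqP-> /=; rewrite ?andbF.
Qed.

Lemma tight_ratio : exists (T : finType) (G : sgraph T) (s : seq (coll T)) (m : nat),
  [/\ complete_execution G s, is_opt G m, 0 < m
    & 16 * #|covered (output s)| = 9 * m].
Proof.
exists 'I_16, graph16,
  [:: [:: path_x]; [:: path_u; path_x]; [:: vtx 0 :: path_u; path_x]], 16.
have ex := tight_execution; split=> //; last first.
  by case: ex => /output_admissible/andP[/covered_card-> _] _.
split=> [|Q _]; last by have := max_card (covered Q); rewrite card_ord.
exists [:: [:: vtx 9; vtx 1; vtx 10; vtx 2; vtx 11; vtx 3; vtx 12];
  [:: vtx 13; vtx 6; vtx 14; vtx 7; vtx 15]; [:: vtx 0; vtx 5; vtx 4; vtx 8]].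
  by vm_compute.
by rewrite (@covered_card _ graph16) //; vm_compute.
Qed.

(** * Programs for the random access machine *)

Section Runs.
Variables (n : nat) (G : sgraph 'I_n).
Implicit Types (m : memory) (c : cmd) (R : memory -> seq nat -> Prop).

(** Total correctness with a bound on the cost. *)
Definition runs c m R (b : nat) :=
  exists m' o t, [/\ exec G c m m' o t, t <= b & R m' o].

Lemma runs_weaken c m R R' b b' :
  runs c m R b -> b <= b' -> (forall m' o, R m' o -> R' m' o) -> runs c m R' b'.
Proof.
case=> m' [o [t [ex le r]]] bb' RR'; exists m', o, t; split=> //; last exact: RR'.
exact: leq_trans bb'.
Qed.

Lemma runs_skip m R : R m [::] -> runs Skip m R 1.
Proof. by move=> r; exists m, [::], 1; split=> //; constructor. Qed.

Lemma runs_write a e1 e2 m R :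
  R (update m a (eval G m e1) (eval G m e2)) [::] ->
  runs (Write a e1 e2) m R (ecost e1 + ecost e2).+1.
Proof. by move=> r; do 3!eexists; split; [constructor| |exact: r]. Qed.

Lemma runs_print e m R : R m [:: eval G m e] -> runs (Print e) m R (ecost e).+1.
Proof. by move=> r; do 3!eexists; split; [constructor| |exact: r]. Qed.

Lemma runs_seq c1 c2 m R1 R b1 b2 :
  runs c1 m R1 b1 ->
  (forall m1 o1, R1 m1 o1 -> runs c2 m1 (fun m2 o2 => R m2 (o1 ++ o2)) b2) ->
  runs (Seq c1 c2) m R (b1 + b2).+1.
Proof.
case=> m1 [o1 [t1 [ex1 le1 r1]]] /(_ _ _ r1) [m2 [o2 [t2 [ex2 le2 r2]]]].
exists m2, (o1 ++ o2), (t1 + t2).+1; split=> //; last by rewrite ltnS leq_add.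
exact: Exec_seq ex1 ex2.
Qed.

Lemma runs_if e c1 c2 m R b :
  runs (if eval G m e != 0 then c1 else c2) m R b ->
  runs (If e c1 c2) m R (ecost e + b).+1.
Proof.
case=> m' [o [t [ex le r]]]; exists m', o, (ecost e + t).+1.
by split=> //; [constructor | rewrite ltnS leq_add2l].
Qed.

Lemma runs_while_end e c m R :
  eval G m e = 0 -> R m [::] -> runs (While e c) m R (ecost e).+1.
Proof. by move=> e0 r; do 3!eexists; split; [constructor| |exact: r]. Qed.

Lemma runs_while_loop e c m R1 R b1 b2 :
  eval G m e != 0 -> runs c m R1 b1 ->
  (forall m1 o1, R1 m1 o1 -> runs (While e c) m1 (fun m2 o2 => R m2 (o1 ++ o2)) b2) ->
  runs (While e c) m R (ecost e + b1 + b2).+1.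
Proof.
move=> e1 [m1 [o1 [t1 [ex1 le1 r1]]]] /(_ _ _ r1) [m2 [o2 [t2 [ex2 le2 r2]]]].
exists m2, (o1 ++ o2), (ecost e + t1 + t2).+1; split=> //.
  exact: Exec_while_loop ex1 ex2.
by rewrite ltnS leq_add // leq_add2l.
Qed.

End Runs.

(* Array 0 holds the scratch variables: variable 0 is the answer of a search,
   variable 1 tells whether the main loop goes on, variable 2 counts the paths
   being printed, variables 3 to 9 are those of the nested loops and the
   variables from 10 on hold the vertices of a rule. *)
Definition var k := Read 0 (Cst k).
Definition assign k e := Write 0 (Cst k) e.

Definition nonzero e := Eq (Eq e (Cst 0)) (Cst 0).
(** Conjunction by truncated subtraction: the truth value of [e1] minus that of the negation of
    [e2]. *)
Definition both e1 e2 := Defs.Sub (nonzero e1) (Eq e2 (Cst 0)).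

Definition conj_all (es : seq expr) := foldr both (Cst 1) es.

(** A loop stops as soon as the answer is set, without advancing its variable, so that the loop
    variables still hold the instance found. *)
Fixpoint search (ks : seq nat) (g : expr) : cmd :=
  if ks is k :: ks' then
    Seq (assign 0 (Cst 0)) (Seq (assign k (Cst 0))
      (While (both (Defs.Sub NVert (var k)) (Eq (var 0) (Cst 0)))
        (Seq (search ks' g) (If (var 0) Skip (assign k (Succ (var k)))))))
  else assign 0 (nonzero g).

Fixpoint search_cost n (g : expr) (r : nat) :=
  if r is r'.+1 then 40 + n.+1 * (40 + search_cost n g r') else 10 + ecost g.

Lemma search_cost_bound n g r :
  search_cost n g r <= (10 + ecost g + 80 * r) * n.+1 ^ r.
Proof.
elim: r => [|r IH] /=; first by rewrite muln1; lia.
have : 0 < n.+1 ^ r by rewrite expn_gt0.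
rewrite expnS; move: IH; move: (search_cost n g r) (n.+1 ^ r) => S X IH X0.
rewrite mulnCA; apply: (@leq_trans (n.+1 * (80 + S))); first by lia.
rewrite leq_mul2l /=; apply: leq_trans (leq_add (leqnn 80) IH) _.
have -> : 10 + ecost g + 80 * r.+1 = (10 + ecost g + 80 * r) + 80 by lia.
by rewrite [leqRHS]mulnDl addnC leq_add2l leq_pmulr.
Qed.

Section Search.
Variables (n : nat) (G : sgraph 'I_n).
Implicit Types (m : memory).

Lemma eval_nonzero m e : eval G m (nonzero e) = (eval G m e != 0).
Proof. by rewrite /=; case: (eval G m e). Qed.

Lemma eval_both m e1 e2 :
  eval G m (both e1 e2) = (eval G m e1 != 0) && (eval G m e2 != 0).
Proof. by rewrite /=; case: (eval G m e1); case: (eval G m e2). Qed.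

Lemma eval_conj m es :
  (eval G m (conj_all es) != 0) = all (fun e => eval G m e != 0) es.
Proof.
elim: es => // e es IH.
by rewrite -[conj_all (e :: es)]/(both e (conj_all es)) eval_both IH /=; case: (_ && _).
Qed.

Definition agree (S : seq nat) m m1 :=
  forall a i, ~~ ((a == 0) && (i \in S)) -> m1 a i = m a i.

Lemma agree_refl S m : agree S m m.
Proof. by []. Qed.

Lemma agree_trans S m1 m2 m3 : agree S m1 m2 -> agree S m2 m3 -> agree S m1 m3.
Proof. by move=> H1 H2 a i ai; rewrite H2 ?H1. Qed.

Lemma agree_sub S S' m m1 : {subset S <= S'} -> agree S m m1 -> agree S' m m1.
Proof. by move=> sub H a i ai; apply: H; apply: contra ai => /andP[-> /sub]. Qed.

Lemma agree_update S m k v : k \in S -> agree S m (update m 0 k v).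
Proof.
by move=> kS a i; rewrite /update; case: eqP => //= ->; case: eqP => //= ->; rewrite kS.
Qed.

(** [phi] is the guard as a function of the loop variables: the guard depends on nothing else that
    the search changes. *)
Lemma search_spec ks g m (phi : seq nat -> bool) :
  uniq (0 :: ks) ->
  (forall m1, agree (0 :: ks) m m1 -> all (gtn n) (map (m1 0) ks) ->
     (eval G m1 g != 0) = phi (map (m1 0) ks)) ->
  runs G (search ks g) m (fun m' o => [/\ o = [::], agree (0 :: ks) m m' &
     [/\ m' 0 0 = 1, all (gtn n) (map (m' 0) ks) & phi (map (m' 0) ks)] \/
     m' 0 0 = 0 /\ forall vs, size vs = size ks -> all (gtn n) vs -> ~~ phi vs])
   (search_cost n g (size ks)).
Proof.
elim: ks m phi => [|k ks IH] m phi uks gE.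
  apply: runs_weaken (runs_write (R := fun m' o => o = [::] /\ m' = update m 0 0 (eval G m g != 0)) _) _ _.
  - by rewrite /= -/(nonzero g); split=> //; congr update; apply: eval_nonzero.
  - by rewrite /=; lia.
  move=> m' o [-> ->]; split=> //; first by apply: agree_update; rewrite inE.
  rewrite {1 3}/update /=; have := gE m (@agree_refl _ _) isT => /= ->.
  by case p: (phi [::]); [left | right; split=> // -[] // _ _; rewrite p].
have k0 : k != 0 by move: uks; rewrite /= !inE !negb_or eq_sym => /andP[/andP[]].
have ks0 : uniq (0 :: ks) by move: uks; rewrite /= !inE !negb_or => /and3P[/andP[_ ->] _].
have kks : k \notin ks by case/and3P: uks.
set S := 0 :: k :: ks.
have sub : {subset 0 :: ks <= S} by move=> i; rewrite !inE => /orP[->|->]; rewrite ?orbT.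
pose Post m' (o : seq nat) := [/\ o = [::], agree S m m' &
     [/\ m' 0 0 = 1, all (gtn n) (map (m' 0) (k :: ks)) & phi (map (m' 0) (k :: ks))] \/
     m' 0 0 = 0 /\ forall vs, size vs = size (k :: ks) -> all (gtn n) vs -> ~~ phi vs].
pose bd := 30 + search_cost n g (size ks).
(* [d] counts the values of the loop variable still to be tried; all values below [v] have
   failed. *)
have loop d v m1 : v + d = n -> agree S m m1 -> m1 0 k = v -> m1 0 0 = 0 ->
    (forall u vs, u < v -> size vs = size ks -> all (gtn n) vs -> ~~ phi (u :: vs)) ->
    runs G (While (both (Defs.Sub NVert (var k)) (Eq (var 0) (Cst 0)))
        (Seq (search ks g) (If (var 0) Skip (assign k (Succ (var k)))))) m1 Post (d * bd + 20).
  elim: d v m1 => [|d IHd] v m1 vd ag mk m0 none.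
    apply: runs_weaken (runs_while_end (R := Post) _ _ _) _ _ => //; last first.
    - split=> //; right; split=> // -[//|u vs] [sz] /= /andP[un]; apply: none => //.
      by rewrite addn0 in vd; rewrite vd.
    - by rewrite eval_both /= mk m0; rewrite addn0 in vd; rewrite vd subnn.
  have vn : v < n by lia.
  have grd : eval G m1 (both (Defs.Sub NVert (var k)) (Eq (var 0) (Cst 0))) != 0.
    by rewrite eval_both /= mk m0 subn_eq0 leqNgt vn.
  pose phi' vs := phi (v :: vs).
  have gE' : forall m2, agree (0 :: ks) m1 m2 -> all (gtn n) (map (m2 0) ks) ->
      (eval G m2 g != 0) = phi' (map (m2 0) ks).
    move=> m2 ag2 al; have m2k : m2 0 k = v.
      by rewrite ag2 // inE (negbTE k0) (negbTE kks).
    rewrite gE /= ?m2k //; first exact: agree_trans ag (agree_sub sub ag2).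
    by rewrite vn.
  apply: runs_weaken (runs_while_loop (R := Post) (b2 := d * bd + 20) grd (runs_seq
    (R := fun m2 o => o = [::] /\ ((Post m2 [::] /\ m2 0 0 = 1) \/ 
       [/\ agree S m m2, m2 0 k = v.+1, m2 0 0 = 0 & 
        (forall u vs, u < v.+1 -> size vs = size ks -> all (gtn n) vs -> ~~ phi (u :: vs))]))
    (IH m1 phi' ks0 gE') _) _) _ _ => //.
  - move=> m2 o [-> ag2 res].
    have m2k : m2 0 k = v by rewrite ag2 // inE (negbTE k0) (negbTE kks).
    have agm : agree S m m2 := agree_trans ag (agree_sub sub ag2).
    apply: (@runs_weaken _ _ _ _ _ _ 10 10); last (by move=> m' o' H; exact: H); last by [].
    apply: (@runs_if _ _ (var 0) _ _ _ _ 7) => /=.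
    case: res => [[m20 al ph]|[m20 no]]; rewrite m20 /=.
      apply: runs_weaken (runs_skip _ (R := fun m' o => o = [::] /\ m' = m2) _) _ _ => // m' o' [-> ->].
      split=> //; left; split=> //; split=> //; left; split=> //=.
        by rewrite m2k vn.
      by rewrite m2k.
    apply: runs_weaken (runs_write (R := fun m' o => o = [::] /\ m' = update m2 0 k v.+1) _) _ _ => //.
      by rewrite /= m2k.
    move=> m' o' [-> ->]; split=> //; right; split=> //.
    - by apply: agree_trans agm _; apply: agree_update; rewrite !inE eqxx orbT.
    - by rewrite /update !eqxx.
    - by rewrite /update eqxx [0 == k]eq_sym (negbTE k0).
    move=> u vs; rewrite ltnS leq_eqVlt => /orP[/eqP->|]; [exact: no | exact: none].
  - move=> m2 o [-> [[post m20]|[ag2 m2k m20 none2]]]; last first.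
      by apply: (IHd v.+1) => //; lia.
    apply: runs_weaken (runs_while_end (R := Post) _ _ post) _ _ => //.
      by rewrite eval_both /= m20 andbF.
    by rewrite /=; lia.
  by rewrite /bd /=; lia.
rewrite [search _ _]/=.
have le : (3 + (3 + (n * bd + 20)).+1).+1 <= search_cost n g (size (k :: ks)).
  by rewrite /bd /=; lia.
apply: runs_weaken le (fun m' o H => H).
apply: runs_seq (runs_write (R := fun m' o => o = [::] /\ m' = update m 0 0 0) _) _ => //.
move=> m1 o1 [-> ->].
apply: runs_seq (runs_write (R := fun m' o => o = [::] /\ m' = update (update m 0 0 0) 0 k 0) _) _ => //.
move=> m2 o2 [-> ->]; apply: (loop n 0) => //.
- apply: agree_trans (agree_update _ _ (_ : 0 \in S)) (agree_update _ _ _); rewrite !inE eqxx ?orbT //.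
- by rewrite /update !eqxx.
by rewrite /update eqxx [0 == k]eq_sym (negbTE k0).
Qed.

End Search.

(** * Memory layout and blocks of writes *)

Definition write := (nat * expr * expr)%type.

Definition block (ws : seq write) : cmd :=
  foldr (fun w c => Seq (Write w.1.1 w.1.2 w.2) c) Skip ws.

Fixpoint puts a (idx : expr) (ds : seq nat) : seq write :=
  if ds is d :: ds' then (a, idx, var (10 + d)) :: puts a.+1 idx ds' else [::].

Definition put idx ds : seq write := (3, idx, Cst (size ds)) :: puts 4 idx ds.

Fixpoint put_all (idxs : seq expr) (ls : seq (seq nat)) : seq write :=
  match idxs, ls with
  | idx :: idxs', l :: ls' => put idx l ++ put_all idxs' ls'
  | _, _ => [::]
  end.

Fixpoint saves d (es : seq expr) : seq write :=
  if es is e :: es' then (0, Cst (10 + d), e) :: saves d.+1 es' else [::].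

Definition marks v (ds : seq nat) : seq write :=
  [seq (2, var (10 + d), Cst v) | d <- ds].

Definition slot (m : memory) I (L : seq nat) :=
  m 3 I = size L /\ forall j, j < size L -> m (4 + j) I = nth 0 L j.

Definition slots m (P : coll nat) := forall I, I < size P -> slot m I (nth [::] P I).

(** Cell 0 of array 1 holds the number of paths, array 2 marks the covered vertices, array 3 holds
    the orders, and array [4 + j] the vertex at position [j] of each path. *)
Definition stores m (P : coll nat) :=
  [/\ m 1 0 = size P, slots m P & forall y, m 2 y = (y \in flatten P)].

Fixpoint overwrite (P : coll nat) (Is : seq nat) (Ls : coll nat) : coll nat :=
  match Is, Ls with
  | k :: Is', L :: Ls' => overwrite (set_nth [::] P k L) Is' Ls'
  | _, _ => P
  end.

(** No index skips a cell past the current length, so [set_nth] never pads the collection with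
    default paths. *)
Fixpoint in_order N (Is : seq nat) :=
  if Is is k :: Is' then (k <= N) && in_order (maxn k.+1 N) Is' else true.

Section Blocks.
Variables (n : nat) (G : sgraph 'I_n).
Implicit Types (m : memory) (P : coll nat).

Fixpoint runw m (ws : seq write) : memory :=
  if ws is w :: ws' then runw (update m w.1.1 (eval G m w.1.2) (eval G m w.2)) ws'
  else m.

Definition block_cost (ws : seq write) :=
  sumn [seq (ecost w.1.2 + ecost w.2).+2 | w <- ws] + 1.

Lemma runs_block ws m R :
  R (runw m ws) [::] -> runs G (block ws) m R (block_cost ws).
Proof.
elim: ws m => [|w ws IH] m r /=; first exact: runs_skip.
rewrite /block_cost /= -addnA !addSn -/(block_cost ws) -addSn.
apply: runs_seq (runs_write (R := fun m' o => o = [::] /\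
  m' = update m w.1.1 (eval G m w.1.2) (eval G m w.2)) _) _ => // m1 o1 [-> ->].
exact: IH.
Qed.

Lemma runw_cat m ws1 ws2 : runw m (ws1 ++ ws2) = runw (runw m ws1) ws2.
Proof. by elim: ws1 m => //= w ws1 IH m; rewrite IH. Qed.

(* Expressions that read neither the temporaries nor the arrays from 3 on. *)
Definition stable m e := forall m',
  (forall a i, a <= 2 -> m' a i = m a i) -> eval G m' e = eval G m e.

Lemma runw_puts m a0 idx ds : 3 <= a0 -> stable m idx ->
  forall a i, runw m (puts a0 idx ds) a i =
    if (i == eval G m idx) && (a0 <= a < a0 + size ds)
    then m 0 (10 + nth 0 ds (a - a0)) else m a i.
Proof.
elim: ds m a0 => [|d ds IH] m a0 a3 st a i /=; first by rewrite addn0 ltnNge andbN andbF.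
set m1 := update _ _ _ _.
have m1E b j : b <= 2 -> m1 b j = m b j.
  by move=> b2; rewrite /m1 /update; case: eqP => // ba; move: b2 a3; rewrite ba; lia.
have st1 : stable m1 idx.
  by move=> m' H; rewrite !(st m') ?(st m1) // => b j b2; rewrite ?H ?m1E.
rewrite (IH m1 a0.+1 (leqW a3) st1) (st _ m1E) m1E //.
case: (ltngtP a0 a) => [lt|gt|<-].
- have -> : a - a0 = (a - a0.+1).+1 by lia.
  rewrite /= addSn addnS; case: ifP => // _.
  by rewrite /m1 /update gtn_eqF.
- by rewrite !andbF /m1 /update ltn_eqF.
rewrite subnn andbF /m1 /update eqxx /= addnS ltnS leq_addr andbT.
by case: eqP.
Qed.

Lemma runw_put m idx ds : stable m idx ->
  let m' := runw m (put idx ds) in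
  [/\ forall a i, a <= 2 -> m' a i = m a i,
      forall a i, i != eval G m idx -> m' a i = m a i
    & slot m' (eval G m idx) [seq m 0 (10 + d) | d <- ds]].
Proof.
move=> st /=; set m1 := update _ _ _ _.
have m1E b j : b <= 2 -> m1 b j = m b j.
  by move=> b2; rewrite /m1 /update; case: eqP => // ba; move: b2; rewrite ba.
have st1 : stable m1 idx.
  by move=> m' H; rewrite !(st m') ?(st m1) // => b j b2; rewrite ?H ?m1E.
have E := runw_puts ds (isT : 3 <= 4) st1; rewrite (st _ m1E) in E.
split.
- by move=> a i a2; rewrite E (m1E a i a2); case: ifP => // /and3P[_ a4 _]; lia.
- by move=> a i /negbTE ni; rewrite E ni /= /m1 /update ni andbF.
split; first by rewrite E /= andbF /m1 /update !eqxx size_map.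
move=> j; rewrite size_map => jd; rewrite E eqxx leq_addr ltn_add2l jd m1E //.
by rewrite addKn (nth_map 0).
Qed.

Lemma slots_put m P idx ds : stable m idx -> slots m P -> eval G m idx <= size P ->
  slots (runw m (put idx ds))
    (set_nth [::] P (eval G m idx) [seq m 0 (10 + d) | d <- ds]).
Proof.
move=> st sl le I; have [_ other new] := runw_put ds st.
rewrite size_set_nth nth_set_nth [X in slot _ _ X]/= => IP; case: eqP => [->//|/eqP nI].
have IP' : I < size P by move: IP nI le; rewrite leq_max ltnS => /orP[] //; lia.
have [s v] := sl I IP'; split; first by rewrite other.
by move=> j js; rewrite other // v.
Qed.

Lemma stable_agree m m' e :
  (forall a i, a <= 2 -> m' a i = m a i) -> stable m e -> stable m' e.
Proof. by move=> H st m2 H2; rewrite (st m' H) st // => a i a2; rewrite H2 ?H. Qed.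

Fixpoint all_stable m (es : seq expr) :=
  if es is e :: es' then stable m e /\ all_stable m es' else True.

Lemma all_stable_agree m m' es :
  (forall a i, a <= 2 -> m' a i = m a i) -> all_stable m es ->
  all_stable m' es /\ map (eval G m') es = map (eval G m) es.
Proof.
move=> H; elim: es => //= e es IH [st /IH[st' ->]].
by split; [split=> //; apply: stable_agree st | rewrite (st m' H)].
Qed.

Lemma slots_put_all m P idxs ls :
  all_stable m idxs -> slots m P -> in_order (size P) (map (eval G m) idxs) ->
  let m' := runw m (put_all idxs ls) in
  (forall a i, a <= 2 -> m' a i = m a i) /\
  slots m' (overwrite P (map (eval G m) idxs) (map (map (fun d => m 0 (10 + d))) ls)).
Proof.
elim: idxs ls m P => [|e idxs IH] [|l ls] m P // [st sts] sl /andP[le ord] m'.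
have {m'} -> : m' = runw (runw m (put e l)) (put_all idxs ls) by rewrite -runw_cat.
have [low _ _] := runw_put l st; have sl' := @slots_put m P e l st sl le.
have [sts' E] := all_stable_agree low sts.
have [|low' sl2] := IH ls _ _ sts' sl'; first by rewrite E size_set_nth.
split=> [a i a2|]; first by rewrite low' // low.
rewrite E in sl2; move: sl2; congr (slots _ (overwrite _ _ _)).
 apply: eq_map => l'; apply: eq_map => d; exact: low.
Qed.

Definition keeps_temps m m' := forall a i, (a != 0) || (i < 10) -> m' a i = m a i.

Lemma runw_saves m d es :
  (forall m' k, keeps_temps m m' -> eval G m' (nth (Cst 0) es k) = eval G m (nth (Cst 0) es k)) ->
  let m' := runw m (saves d es) in
  [/\ keeps_temps m m', forall k, k < d -> m' 0 (10 + k) = m 0 (10 + k)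
    & forall k, k < size es -> m' 0 (10 + (d + k)) = eval G m (nth (Cst 0) es k)].
Proof.
elim: es m d => [|e es IH] m d pure //=.
set m1 := update _ _ _ _.
have k1 : keeps_temps m m1.
  move=> a i; rewrite /m1 /update; case: eqP => //= ->.
  by case: eqP => // ->; rewrite ltnNge leq_addr.
have [|km kd ke] := IH m1 d.+1.
  move=> m' k km; have E := pure m1 k.+1 k1; rewrite /= in E; rewrite E.
  by apply: (pure m' k.+1) => a i ai; rewrite km // k1.
split.
- by move=> a i ai; rewrite km // k1.
- move=> k kd'; rewrite kd; last exact: leqW.
  by rewrite /m1 /update eqn_add2l (ltn_eqF kd').
case=> [_|k ks]; first by rewrite addn0 kd // /m1 /update !eqxx.
by rewrite addnS -addSn ke //; apply: (pure m1 k.+1).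
Qed.

Lemma runw_marks m v ds a i : runw m (marks v ds) a i =
  if (a == 2) && (i \in [seq m 0 (10 + d) | d <- ds]) then v else m a i.
Proof.
elim: ds m => [|d ds IH] m /=; first by rewrite andbF.
rewrite IH; set m1 := update _ _ _ _.
have -> : [seq m1 0 (10 + d) | d <- ds] = [seq m 0 (10 + d) | d <- ds] by [].
rewrite inE /m1 /update; case: eqP => //= _.
by case: (i \in _); rewrite ?orbT // orbF.
Qed.

End Blocks.

(** * Applying rules in memory *)

(** [k] is fuel; the length of [l] is enough, as each cut removes 4 vertices. *)
Fixpoint cut (A : Type) k (l : seq A) :=
  if k is k'.+1 then
    if size l <= 7 then [:: l] else take 4 l :: cut k' (drop 4 l)
  else [:: l].

Definition pieces (A : Type) (ls : seq (seq A)) := flatten [seq cut (size l) l | l <- ls].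

Lemma pieces_map (A B : Type) (f : A -> B) ls :
  pieces (map (map f) ls) = map (map f) (pieces ls).
Proof.
rewrite /pieces map_flatten -!map_comp; congr flatten; apply: eq_map => l /=.
rewrite size_map; move: (size l) => k; elim: k l => //= k IH l.
by rewrite size_map; case: ifP => // _; rewrite /= -map_take -map_drop IH.
Qed.

Lemma flatten_pieces (A : Type) (ls : seq (seq A)) : flatten (pieces ls) = flatten ls.
Proof.
elim: ls => //= l ls IH; rewrite /pieces /= flatten_cat -/(pieces ls) IH; congr (_ ++ _).
move: (size l) => k; elim: k l => [|k IHk] l /=; first by rewrite cats0.
by case: ifP => _ /=; rewrite ?cats0 // IHk cat_take_drop.
Qed.

Lemma size_pieces (A : Type) (ls : seq (seq A)) : size ls <= size (pieces ls).
Proof.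
elim: ls => //= l ls IH; rewrite /pieces /= size_cat -add1n leq_add //.
by case: (size l) => //= k; case: ifP.
Qed.

(* A rule replaces some paths, of the given orders, by new ones.  The vertices
   of a rule are coded by their positions in the concatenation of the replaced
   paths followed by the given path_count of uncovered vertices; the rule applies
   when its third component consists of sequences of consecutively adjacent
   vertices. *)
Definition rule := (seq nat * nat * seq (seq nat) * seq (seq nat))%type.
Definition orders (r : rule) := r.1.1.1.
Definition fresh (r : rule) := r.1.1.2.
Definition walks (r : rule) := r.1.2.
Definition results (r : rule) := r.2.

Definition path_vars (r : rule) := iota 3 (size (orders r)).
Definition vertex_vars (r : rule) := iota (3 + size (orders r)) (fresh r).

Definition path_exprs (ks sz : seq nat) : seq expr :=
  flatten [seq [seq Read (4 + j) (var p.1) | j <- iota 0 p.2] | p <- zip ks sz].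

Definition vertex_exprs r :=
  path_exprs (path_vars r) (orders r) ++ map var (vertex_vars r).

Fixpoint distinct (es : seq expr) : seq expr :=
  if es is e :: es' then
    [seq Eq (Eq e e') (Cst 0) | e' <- es'] ++ distinct es'
  else [::].

Definition edges (es : seq expr) : seq expr :=
  if es is e :: es' then pairmap Edge e es' else [::].

Definition path_count := Read 1 (Cst 0).

Definition guard r : expr := conj_all
  ([seq Defs.Sub path_count (var k) | k <- path_vars r]
   ++ [seq Eq (Read 3 (var p.1)) (Cst p.2) | p <- zip (path_vars r) (orders r)]
   ++ distinct (map var (path_vars r))
   ++ [seq Eq (Read 2 (var k)) (Cst 0) | k <- vertex_vars r]
   ++ distinct (map var (vertex_vars r))
   ++ flatten [seq edges [seq nth (Cst 0) (vertex_exprs r) c | c <- l] | l <- walks r]).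

Definition chosen (P : coll nat) (is_ : seq nat) := [seq nth [::] P i | i <- is_].

Definition matches (E : rel nat) (r : rule) (P : coll nat) (is_ ys : seq nat) :=
  let D := flatten (chosen P is_) ++ ys in
  all (gtn (size P)) is_ &&
  [&& [seq size p | p <- chosen P is_] == orders r, uniq is_,
      all (fun y => y \notin flatten P) ys, uniq ys
    & all (fun l => sorted E [seq nth 0 D c | c <- l]) (walks r)].

(** The vertices are saved first because the new paths overwrite the cells they are read from. The
    old vertices are unmarked before the new ones are marked, so that the vertices kept end up
    marked. *)
Definition rule_writes r : seq write :=
  let F := pieces (results r) in
  let d := size F - size (orders r) in
  saves 0 (vertex_exprs r) ++ marks 0 (iota 0 (sumn (orders r)))
  ++ put_all (map var (path_vars r) ++ [seq iter j Succ path_count | j <- iota 0 d]) F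
  ++ (1, Cst 0, iter d Succ path_count) :: marks 1 (flatten F).

Definition apply_rule r : cmd := block (rule_writes r).

Section Rules.
Variables (n : nat) (G : sgraph 'I_n).
Implicit Types (m : memory) (P : coll nat) (r : rule).

Definition edge_rel : rel nat := fun i j => edge_query G i j != 0.

Lemma eval_distinct m es :
  all (fun e => eval G m e != 0) (distinct es) = uniq (map (eval G m) es).
Proof.
elim: es => //= e es IH; rewrite all_cat IH all_map; congr (_ && _).
elim: es {IH} => //= e' es IH; rewrite inE negb_or IH; congr (_ && _).
by case: (eval G m e == eval G m e').
Qed.

Lemma eval_edges m es :
  all (fun e => eval G m e != 0) (edges es) = sorted edge_rel (map (eval G m) es).
Proof. by case: es => //= e es; elim: es e => //= e' es IH e; rewrite IH. Qed.

Lemma eval_path_exprs m P ks sz : slots m P ->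
  all (gtn (size P)) (map (m 0) ks) ->
  [seq size p | p <- chosen P (map (m 0) ks)] = sz ->
  map (eval G m) (path_exprs ks sz) = flatten (chosen P (map (m 0) ks)).
Proof.
move=> sl al <-; rewrite /path_exprs /chosen.
elim: ks al => //= k ks IH /andP[kP /IH E].
rewrite map_cat E; congr (_ ++ _); rewrite -map_comp.
have [s v] := sl _ kP; rewrite -[RHS](mkseq_nth 0) /mkseq.
by apply/eq_in_map => j; rewrite mem_iota => /andP[_ js]; rewrite /= -v.
Qed.

Lemma guard_eval m P r : stores m P ->
  (eval G m (guard r) != 0) =
  matches edge_rel r P (map (m 0) (path_vars r)) (map (m 0) (vertex_vars r)).
Proof.
case=> mN sl mu; rewrite /guard eval_conj /matches all_cat.
have -> : all (fun e => eval G m e != 0) [seq Defs.Sub path_count (var k) | k <- path_vars r]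
    = all (gtn (size P)) (map (m 0) (path_vars r)).
  rewrite !all_map; apply: eq_all => k /=.
  by rewrite mN subn_eq0 -ltnNge.
(* The further tests read cells that are meaningful only for indices in range. *)
apply: andb_id2l => al; rewrite !all_cat !eval_distinct.
have -> : all (fun e => eval G m e != 0)
     [seq Eq (Read 3 (var p.1)) (Cst p.2) | p <- zip (path_vars r) (orders r)]
    = ([seq size p | p <- chosen P (map (m 0) (path_vars r))] == orders r).
  move: al; have := size_iota 3 (size (orders r)); rewrite -/(path_vars r).
  rewrite /chosen -!map_comp; elim: (path_vars r) (orders r) => [|k ks IH] [|s sz] //=.
  case=> ss /andP[kP al]; rewrite eqseq_cons IH //; congr (_ && _).
  by have [-> _] := sl _ kP; rewrite /=; case: (size _ == s).
apply: andb_id2l => /eqP szE; rewrite -!map_comp; congr [&& _, _, _ & _].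
- by rewrite !all_map; apply: eq_all => k /=; rewrite mu; case: (_ \in _).
elim: (walks r) => //= l ls IH; rewrite all_cat IH; congr (_ && _).
rewrite eval_edges -map_comp; congr sorted; apply: eq_map => c /=.
rewrite -[0]/(eval G m (Cst 0)); set D := vertex_exprs r.
have -> : flatten (chosen P (map (m 0) (path_vars r))) ++ map (m 0) (vertex_vars r)
    = map (eval G m) D.
  by rewrite /D map_cat (eval_path_exprs sl al szE) -map_comp.
case: (ltnP c (size D)) => cD; first by rewrite (nth_map (Cst 0)).
by rewrite !nth_default // size_map.
Qed.

Lemma overwrite_append P Ls : overwrite P (iota (size P) (size Ls)) Ls = P ++ Ls.
Proof.
elim: Ls P => [|L Ls IH] P /=; first by rewrite cats0.
rewrite set_nthE ltnn subnn /=.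
have -> : (size P).+1 = size (P ++ [:: L]) by rewrite size_cat addn1.
by rewrite IH -catA.
Qed.

Lemma perm_set_nth (S : eqType) (s t : seq S) x0 i x :
  i < size s -> perm_eq s (nth x0 s i :: t) -> perm_eq (set_nth x0 s i x) (x :: t).
Proof.
move=> si; rewrite set_nthE si -{1}(cat_take_drop i s) (drop_nth x0 si).
have key y A B : perm_eq (A ++ y :: B) (y :: t) = perm_eq (A ++ B) t.
  by rewrite -[y :: B]cat1s perm_catCA /= perm_cons.
by rewrite !key.
Qed.

(** The new paths take the cells of the old ones and the surplus is appended; as there are at least
    as many new paths as old ones, no cell is left stale. *)
Lemma overwrite_perm P Q is_ Ls : uniq is_ -> all (gtn (size P)) is_ ->
  size is_ <= size Ls -> perm_eq P (chosen P is_ ++ Q) ->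
  perm_eq (overwrite P (is_ ++ iota (size P) (size Ls - size is_)) Ls) (Ls ++ Q).
Proof.
elim: is_ Ls P Q => [|i is_ IH] Ls P Q /=.
  by move=> _ _ _ PQ; rewrite subn0 overwrite_append perm_catC perm_cat2l.
case: Ls => // L Ls /andP[ii ui] /andP[iP al] le PQ.
have sP : size (set_nth [::] P i L) = size P.
  by rewrite size_set_nth; apply/maxn_idPr.
have ch : chosen (set_nth [::] P i L) is_ = chosen P is_.
  apply/eq_in_map => j ji; rewrite nth_set_nth /=; case: eqP => // ji'.
  by rewrite -ji' ji in ii.
have := IH Ls (set_nth [::] P i L) (L :: Q) ui; rewrite sP => /(_ al le).
rewrite subSS ch => H; apply: perm_trans (H _) _.
  apply: perm_trans (perm_set_nth L iP PQ) _.
  by rewrite -[L :: chosen P is_ ++ Q]/([:: L] ++ chosen P is_ ++ Q) perm_catCA.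
by rewrite -[L :: Q]/([:: L] ++ Q) perm_catCA.
Qed.

Definition low_expr (e : expr) :=
  match e with
  | Read 0 (Cst k) => k < 10
  | Read a (Read 0 (Cst k)) => (a != 0) && (k < 10)
  | _ => false
  end.

Lemma low_expr_pure m m' e : low_expr e -> keeps_temps m m' -> eval G m' e = eval G m e.
Proof.
move=> le km; case: e le => // -[|a] [] //=.
- by move=> k k10; rewrite km.
- by case=> // e; case: e => // k.
by move=> [|b] // [] // k k10; rewrite !km.
Qed.

Lemma low_vertex_exprs r : size (orders r) + fresh r <= 7 -> all low_expr (vertex_exprs r).
Proof.
move=> le7; rewrite /vertex_exprs all_cat; apply/andP; split; last first.
  rewrite all_map; apply/allP=> k; rewrite mem_iota /=; lia.
have : all (fun k => k < 10) (path_vars r).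
  by apply/allP=> k; rewrite mem_iota; lia.
rewrite /path_exprs; elim: (path_vars r) (orders r) => [|k ks IH] [|s sz] //= /andP[k10 al].
rewrite all_cat IH // andbT all_map.
by apply/allP=> j _ /=; rewrite k10.
Qed.

Lemma all_stable_map (S : Type) m (f : S -> expr) ks :
  (forall k, stable G m (f k)) -> all_stable G m (map f ks).
Proof. by move=> H; elim: ks => //= k ks IH; split. Qed.

Lemma all_stable_cat m es1 es2 :
  all_stable G m es1 -> all_stable G m es2 -> all_stable G m (es1 ++ es2).
Proof. by elim: es1 => //= e es1 IH [st /IH H] /H. Qed.

Lemma all_flatten (S : Type) (a : pred S) ss : all a (flatten ss) = all (all a) ss.
Proof. by elim: ss => //= s ss <-; rewrite all_cat. Qed.

Lemma apply_spec m P Q r : size (orders r) + fresh r <= 7 -> stores m P -> uniq (flatten P) ->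
  let is_ := map (m 0) (path_vars r) in
  let D := flatten (chosen P is_) ++ map (m 0) (vertex_vars r) in
  matches edge_rel r P is_ (map (m 0) (vertex_vars r)) ->
  perm_eq P (chosen P is_ ++ Q) ->
  size (orders r) <= size (pieces (results r)) ->
  all (all (gtn (size D))) (results r) ->
  runs G (apply_rule r) m (fun m' o => o = [::] /\ m' 0 1 = m 0 1 /\
    exists2 P', stores m' P' &
      perm_eq P' (pieces [seq [seq nth 0 D c | c <- l] | l <- results r] ++ Q))
    (block_cost (rule_writes r)).
Proof.
move=> le7 st uP is_ D mt PQ leF codes; have [mN sl mu] := st.
apply: runs_block; rewrite /rule_writes; set F := pieces (results r) in leF *; set d := size F - size (orders r).
case/andP: mt => al /and5P[/eqP szE uis _ _ _].
have DE : map (eval G m) (vertex_exprs r) = D.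
  by rewrite /vertex_exprs map_cat (eval_path_exprs sl al szE) -map_comp.
have sD : size (vertex_exprs r) = size D by rewrite -DE size_map.
have pure m' k : keeps_temps m m' ->
    eval G m' (nth (Cst 0) (vertex_exprs r) k) = eval G m (nth (Cst 0) (vertex_exprs r) k).
  case: (ltnP k (size (vertex_exprs r))) => ks km; last by rewrite !nth_default.
  by apply: low_expr_pure km; apply: all_nthP ks; apply: low_vertex_exprs.
have [km _ tmp] := runw_saves 0 pure.
rewrite !runw_cat; set m1 := runw G m _ in km tmp *.
have temp c : c < size D -> m1 0 (10 + c) = nth 0 D c.
  by move=> cD; rewrite -DE (nth_map (Cst 0)) ?sD // -tmp ?sD.
set m2 := runw G m1 _.
have old : [seq m1 0 (10 + c) | c <- iota 0 (sumn (orders r))] = flatten (chosen P is_).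
  have sO : sumn (orders r) = size (flatten (chosen P is_)).
    by rewrite size_flatten -szE.
  rewrite -[RHS](mkseq_nth 0) /mkseq -sO; apply/eq_in_map=> c.
  rewrite mem_iota add0n sO => /andP[_ cs].
  by rewrite temp /D ?nth_cat ?cs // size_cat ltn_addr.
have m2E a i : m2 a i = if (a == 2) && (i \in flatten (chosen P is_)) then 0 else m1 a i.
  by rewrite /m2 runw_marks old.
have m2hi a i : a != 2 -> m2 a i = m1 a i by move=> /negbTE a2; rewrite m2E a2.
have m1hi a i : a != 0 -> m1 a i = m a i by move=> a0; rewrite km // a0.
have sl2 : slots m2 P.
  move=> k kP; have [s v] := sl k kP; split; first by rewrite m2hi ?m1hi.
  by move=> j js; rewrite m2hi // m1hi // v.
have low2 k : k < 10 -> m2 0 k = m 0 k by move=> k10; rewrite m2hi // km // k10 orbT.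
set idxs := map var (path_vars r) ++ [seq iter j Succ path_count | j <- iota 0 d].
have iterE m' j : eval G m' (iter j Succ path_count) = j + m' 1 0.
  by elim: j => //= j ->.
have st2 : all_stable G m2 idxs.
  apply: all_stable_cat; apply: all_stable_map => k m' H; first by rewrite /= H.
  by rewrite !iterE H.
have idxE : map (eval G m2) idxs = is_ ++ iota (size P) d.
  rewrite map_cat; congr (_ ++ _).
    rewrite -map_comp; apply/eq_in_map => k; rewrite mem_iota /= => /andP[_ k10].
    by rewrite low2 //; lia.
  rewrite -map_comp -[size P]addn0 iotaDl; apply: eq_map => j.
  by rewrite /= iterE m2hi // m1hi // mN addnC.
have sI : size is_ = size (orders r) by rewrite size_map size_iota.
have ord : in_order (size P) (map (eval G m2) idxs).
  rewrite idxE; move: al; clear; elim: is_ => [|i is_ IH] /=.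
    move=> _; elim: d (size P) => //= k IH N.
    by rewrite leqnn (maxn_idPl (leqnSn N)) IH.
  by case/andP=> iP al; rewrite (ltnW iP) (maxn_idPr iP) IH.
have [low3 sl3] := slots_put_all F st2 sl2 ord.
set m3 := runw G m2 _ in low3 sl3 *.
have codesF : all (all (gtn (size D))) F by rewrite -all_flatten flatten_pieces all_flatten.
have temp2 l : all (gtn (size D)) l -> [seq m2 0 (10 + c) | c <- l] = [seq nth 0 D c | c <- l].
  by move=> /allP lD; apply/eq_in_map => c /lD /= cD; rewrite m2hi // temp.
have tempF : map (map (fun c => m2 0 (10 + c))) F = map (map (nth 0 D)) F.
  by apply/eq_in_map => l /(allP codesF)/temp2.
set Ls := map (map (nth 0 D)) F in tempF; rewrite tempF idxE in sl3.
set P' := overwrite _ _ _ in sl3.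
have permP' : perm_eq P' (Ls ++ Q).
  rewrite /P'; have -> : d = size Ls - size is_ by rewrite /Ls size_map sI.
  by apply: overwrite_perm; rewrite // /Ls size_map sI.
have sP' : size P' = size P + d.
  rewrite (perm_size permP') (perm_size PQ) !size_cat /Ls size_map /d.
  by rewrite /chosen size_map sI; lia.
set m4 := runw G m3 _.
have m4E a i : m4 a i = if (a == 2) && (i \in flatten Ls) then 1
    else if (a == 1) && (i == 0) then size P' else m3 a i.
  rewrite /m4 /= runw_marks; set m5 := update _ _ _ _.
  have -> : [seq m5 0 (10 + c) | c <- flatten F] = flatten Ls.
    rewrite /Ls -map_flatten; apply/eq_in_map => c cF.
    rewrite /m5 /update /= low3 // m2hi // temp //.
    by apply: (allP (_ : all (gtn (size D)) (flatten F))); rewrite // all_flatten.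
  case: ifP => // _; rewrite /m5 /update iterE low3 // m2hi // m1hi // mN addnC -sP'.
  by [].
split=> //; split.
  by rewrite m4E /= low3 // low2.
exists P'; last by rewrite pieces_map.
split.
- by rewrite m4E.
- move=> k kP; have [s v] := sl3 k kP.
  by split=> [|j js]; rewrite m4E //= v.
move=> y; rewrite m4E eqxx /= (perm_mem (perm_flatten permP')) flatten_cat mem_cat.
case: (y \in flatten Ls) => //=; rewrite low3 // m2E eqxx m1hi // mu.
have := uP; rewrite (perm_uniq (perm_flatten PQ)) (perm_mem (perm_flatten PQ)).
rewrite flatten_cat mem_cat cat_uniq => /and3P[_ /hasPn D' _].
by case yc: (y \in flatten (chosen P is_)) => //=; case yQ: (y \in flatten Q) => //; have := D' y yQ; rewrite /= yc.
Qed.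

(** * Printing a collection *)

Definition encode_nat P := size P :: flatten [seq size L :: L | L <- P].

Definition print_path : cmd :=
  Seq (Print (Read 3 (var 2)))
    (foldr (fun j c => Seq (If (Defs.Sub (Read 3 (var 2)) (Cst j))
                               (Print (Read (4 + j) (var 2))) Skip) c)
       Skip (iota 0 7)).

Definition print_coll : cmd :=
  Seq (Print path_count) (Seq (assign 2 (Cst 0))
    (While (Defs.Sub path_count (var 2))
      (Seq print_path (assign 2 (Succ (var 2)))))).

Lemma print_path_spec m L : slot m (m 0 2) L -> size L <= 7 ->
  runs G print_path m (fun m' o => m' = m /\ o = size L :: L) 200.
Proof.
case=> s v s7.
have tail d j : size L <= j + d -> runs G (foldr (fun j c => Seq (If (Defs.Sub (Read 3 (var 2)) (Cst j))
       (Print (Read (4 + j) (var 2))) Skip) c) Skip (iota j d)) m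
     (fun m' o => m' = m /\ o = drop j L) (20 * d + 1).
  elim: d j => [|d IH] j sj /=.
    by apply: runs_skip; rewrite drop_oversize //; rewrite addn0 in sj.
  have le : ((ecost (Defs.Sub (Read 3 (var 2)) (Cst j)) + 5).+1 + (20 * d + 1)).+1 <= 20 * d.+1 + 1.
    by rewrite /=; lia.
  apply: runs_weaken le (fun m' o H => H).
  apply: (runs_seq (R1 := fun m' o => m' = m /\ o = take 1 (drop j L))).
    apply: runs_if => /=; rewrite s subn_eq0 -ltnNge; case: ltnP => jL.
      apply: runs_weaken (runs_print (R := fun m' o => m' = m /\ o = take 1 (drop j L)) _) _ _ => //=.
      by rewrite v // (drop_nth 0 jL) /= take0.
    apply: runs_weaken (runs_skip _ (R := fun m' o => m' = m /\ o = take 1 (drop j L)) _) _ _ => //=.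
    by rewrite drop_oversize.
  move=> m1 o1 [-> ->]; apply: runs_weaken (IH j.+1 _) _ _ => //; first by rewrite addSn -addnS.
  move=> m' o [-> ->]; split=> //.
  by rewrite -[j.+1]add1n -drop_drop cat_take_drop.
apply: (@runs_weaken _ _ _ _ (fun m' o => m' = m /\ o = size L :: L) _ (4 + (20 * 7 + 1)).+1) => //.
apply: (runs_seq (R1 := fun m' o => m' = m /\ o = [:: size L])).
  apply: runs_weaken (runs_print (R := fun m' o => m' = m /\ o = [:: size L]) _) _ _ => //=.
  by rewrite s.
move=> m1 o1 [-> ->]; apply: runs_weaken (tail 7 0 s7) _ _ => // m' o [-> ->].
by rewrite drop0.
Qed.

Lemma print_coll_spec m P : stores m P -> all (fun L => size L <= 7) P ->
  runs G print_coll m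
    (fun m' o => [/\ o = encode_nat P, stores m' P & m' 0 1 = m 0 1])
    (300 * (size P).+1).
Proof.
move=> st s7.
pose keep m' := forall a i, (a == 0) && (i == 2) = false -> m' a i = m a i.
pose body := Seq print_path (assign 2 (Succ (var 2))).
have loop d k m1 : k + d = size P -> keep m1 -> m1 0 2 = k ->
    runs G (While (Defs.Sub path_count (var 2)) body) m1
      (fun m' o => keep m' /\ o = flatten [seq size L :: L | L <- drop k P]) (250 * d + 20).
  elim: d k m1 => [|d IH] k m1 kd km mk.
    rewrite addn0 in kd; have [mN _ _] := st.
    apply: runs_weaken (runs_while_end (R := fun m' o => keep m' /\
      o = flatten [seq size L :: L | L <- drop k P]) _ _ _) _ _ => //.
    - by rewrite /= km // mN mk kd subnn.
    - by split=> //; rewrite drop_oversize // kd.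
  have kP : k < size P by lia.
  have [mN sl _] := st.
  have sl1 : slot m1 (m1 0 2) (nth [::] P k).
    by have [s v] := sl k kP; split=> [|j js]; rewrite km ?mk //= v.
  have le : (ecost (Defs.Sub path_count (var 2)) + (200 + 5).+1 + (250 * d + 20)).+1 <= 250 * d.+1 + 20.
    by rewrite /=; lia.
  apply: runs_weaken le (fun m' o H => H).
  apply: (runs_while_loop (R1 := fun m' o => m' = update m1 0 2 k.+1 /\ o = size (nth [::] P k) :: nth [::] P k)).
  - by rewrite /= km // mN mk subn_eq0 -ltnNge.
  - apply: (runs_seq (print_path_spec sl1 _)).
      by apply: (allP s7); apply: mem_nth.
    move=> m2 o2 [-> ->].
    apply: runs_weaken (runs_write (R := fun m' o => m' = update m1 0 2 k.+1 /\ o = [::]) _) _ _ => //=.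
      by rewrite mk.
    by move=> m' o [-> ->]; rewrite cats0.
  move=> m2 o2 [-> ->]; apply: runs_weaken (IH k.+1 _ _ _ _) _ _ => //.
  - by rewrite addSn -addnS.
  - by move=> a i ai; rewrite /update ai km.
  by move=> m' o [km' ->]; split=> //; rewrite [in RHS](drop_nth [::] kP).
have le : ((ecost path_count).+1 + (3 + (250 * size P + 20)).+1).+1 <= 300 * (size P).+1.
  by rewrite /=; lia.
apply: runs_weaken le (fun m' o H => H).
have [mN sl mu] := st.
apply: (runs_seq (R1 := fun m' o => m' = m /\ o = [:: size P])).
  by apply: runs_print; rewrite /= mN.
move=> m1 o1 [-> ->].
apply: (runs_seq (R1 := fun m' o => m' = update m 0 2 0 /\ o = [::])).
  by apply: runs_write.
move=> m2 o2 [-> ->]; apply: runs_weaken (loop (size P) 0 _ _ _ _) _ _ => //.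
  by move=> a i ai; rewrite /update ai.
move=> m' o [km ->]; split; [by rewrite drop0 | | exact: km].
split; [by rewrite km | | by move=> y; rewrite km].
by move=> k kP; have [s v] := sl k kP; split=> [|j js]; rewrite km //= v.
Qed.

End Rules.

(** * Rules and collections *)

Lemma cut_small (A : Type) k (l : seq A) :
  size l <= 4 * k + 7 -> all (fun p => size p <= 7) (cut k l).
Proof.
elim: k l => [|k IH] l le /=; first by rewrite andbT.
case: ifP => [s7 /=|/negbT]; first by rewrite s7.
rewrite -ltnNge => lt /=; rewrite IH ?size_drop; last by lia.
by rewrite size_take; case: ifP; lia.
Qed.

Lemma pieces_small (A : Type) (ls : seq (seq A)) : all (fun p => size p <= 7) (pieces ls).
Proof.
rewrite /pieces all_flatten all_map; apply: sub_all (all_predT ls) => l _ /=.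
by apply: cut_small; lia.
Qed.

Section Broken.
Variable T : finType.
Implicit Types P Q : coll T.

Lemma broken_perm P1 P2 P' : perm_eq P1 P2 -> broken P2 P' -> broken P1 P'.
Proof.
move=> + br; case: br => {P2 P'} [P2 P' s7 PP|P2 p Q P' tk s8 br] E.
  by apply: Broken_done; [rewrite (perm_all _ E) | apply: perm_trans PP].
apply: Broken_split s8 br; case: tk => tk; [left | right]; exact: perm_trans tk.
Qed.

Lemma broken_cut k l Q P' : size l <= 4 * k + 7 ->
  broken (cut k l ++ Q) P' -> broken (l :: Q) P'.
Proof.
elim: k l Q => [|k IH] l Q //= le; case: ifP => // /negbT; rewrite -ltnNge => s8 br.
apply: (Broken_split (or_introl (perm_refl _)) s8).
apply: broken_perm (perm_cons_swap _ _ _) _; apply: IH.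
  by rewrite size_drop; lia.
apply: broken_perm br; rewrite -cat1s perm_catCA; exact: perm_refl.
Qed.

Lemma broken_pieces (Ls : coll T) Q P' : all (fun p => size p <= 7) Q ->
  perm_eq P' (pieces Ls ++ Q) -> broken (Ls ++ Q) P'.
Proof.
move=> s7 PP'.
suff: forall R, broken (pieces Ls ++ R) P' -> broken (Ls ++ R) P'.
  apply; apply: Broken_done; last by rewrite perm_sym.
  by rewrite all_cat s7 pieces_small.
elim: Ls {PP'} => //= l Ls IH R br; apply: (@broken_cut (size l)); first by lia.
have: broken (pieces Ls ++ (cut (size l) l ++ R)) P'.
  apply: broken_perm br; rewrite /pieces /= -/(pieces Ls) -catA.
  by rewrite perm_catCA perm_refl.
move/IH; apply: broken_perm; by rewrite perm_catCA perm_refl.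
Qed.

End Broken.

Lemma perm_map_inv (A B : eqType) (f : A -> B) s t :
  perm_eq s (map f t) -> exists2 t', s = map f t' & perm_eq t' t.
Proof.
case: t => [|x0 t]; first by move/perm_nilP=> ->; exists [::].
case/(perm_iotaP (f x0)) => Is pI ->; exists (map (nth x0 (x0 :: t)) Is).
  rewrite -map_comp; apply/eq_in_map => i; rewrite (perm_mem pI) mem_iota /= add0n size_map.
  by move=> it; rewrite (nth_map x0 (f x0) f (s := x0 :: t)).
by apply/(perm_iotaP x0); exists Is; rewrite // -(size_map f).
Qed.

(** * Matches of a rule in the graph and in memory *)

Definition natc n (P : coll 'I_n) : coll nat := map (map val) P.

Section Fits.
Variables (n : nat) (G : sgraph 'I_n).
Implicit Types (P Q ps : coll 'I_n) (ys : seq 'I_n) (r : rule).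

Definition fits (x0 : 'I_n) P r ps Q ys :=
  [/\ perm_eq P (ps ++ Q), map size ps = orders r, size ys = fresh r,
      uniq ys & all (fun y => y \notin flatten P) ys] /\
  all (fun l => sorted G [seq nth x0 (flatten ps ++ ys) c | c <- l]) (walks r).

Definition outcome (x0 : 'I_n) r ps Q ys : coll 'I_n :=
  [seq [seq nth x0 (flatten ps ++ ys) c | c <- l] | l <- results r] ++ Q.

Definition fires P r := exists x0 ps Q ys, fits x0 P r ps Q ys.

(** The bound 7 on the number of loops yields the seventh power in the cost of a step; having at
    least as many results as replaced paths lets the update work in place. *)
Definition static r :=
  [&& 0 < size (orders r) + fresh r, size (orders r) + fresh r <= 7,
      size (orders r) <= size (results r)
    & all (all (gtn (sumn (orders r) + fresh r))) (results r ++ walks r)].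

Lemma edge_relE (x y : 'I_n) : edge_rel G x y = G x y.
Proof.
rewrite /edge_rel /edge_query; case: existsP => [[a /existsP[b /and3P[/eqP xa /eqP yb]]]|H].
  by rewrite (val_inj xa) (val_inj yb) => ->.
by symmetry; apply/negP => xy; apply: H; exists x; apply/existsP; exists y; rewrite !eqxx.
Qed.

Lemma edge_rel_sorted (s : seq 'I_n) : sorted (edge_rel G) (map val s) = sorted G s.
Proof. by rewrite sorted_map; apply: eq_sorted => x y; apply: edge_relE. Qed.

Lemma size_coll P : admissible G P -> size P <= n.
Proof.
case/andP=> fP _; have := max_card (mem (covered P)).
rewrite card_ord (covered_card fP); move: fP; rewrite feasibleE => /andP[_].
move=> al le; apply: leq_trans le; elim: P al => //= p P IH /andP[/andP[_ p4] /IH le].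
by rewrite size_cat -add1n leq_add // (leq_trans _ p4).
Qed.

Lemma nth_nat (x0 : 'I_n) (D : seq 'I_n) c : c < size D -> nth 0 (map val D) c = nth x0 D c.
Proof. by move=> cD; rewrite (nth_map x0). Qed.

Lemma codes_nat (x0 : 'I_n) (D : seq 'I_n) ls : all (all (gtn (size D))) ls ->
  map (map (nth 0 (map val D))) ls = natc (map (map (nth x0 D)) ls).
Proof.
move=> al; rewrite /natc -map_comp; apply/eq_in_map => l /(allP al)/allP lD /=.
by rewrite -map_comp; apply/eq_in_map => c /lD cD; rewrite /= (nth_nat x0).
Qed.

Lemma chosen_nat P is_ : chosen (natc P) is_ = natc [seq nth [::] P i | i <- is_].
Proof.
rewrite /chosen /natc -map_comp; apply: eq_map => i /=.
by case: (ltnP i (size P)) => iP; [rewrite (nth_map [::]) | rewrite !nth_default ?size_map].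
Qed.

Lemma flatten_nat P : flatten (natc P) = map val (flatten P).
Proof. by rewrite /natc map_flatten. Qed.

Lemma walks_nat x0 r ps ys : static r -> map size ps = orders r -> size ys = fresh r ->
  all (fun l => sorted (edge_rel G) [seq nth 0 (flatten (natc ps) ++ map val ys) c | c <- l]) (walks r)
  = all (fun l => sorted G [seq nth x0 (flatten ps ++ ys) c | c <- l]) (walks r).
Proof.
case/and4P=> _ _ _ +; rewrite all_cat => /andP[_ /allP cd] so sy.
apply: eq_in_all => l /cd/allP lD; rewrite -edge_rel_sorted -map_comp; congr sorted.
apply/eq_in_map => c /lD /= cD; rewrite flatten_nat -map_cat (nth_nat x0) //.
by rewrite size_cat sy size_flatten -so in cD *.
Qed.

Lemma fires_matches P r : static r -> admissible G P -> fires P r ->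
  exists is_ yn : seq nat, [/\ size is_ = size (orders r), size yn = fresh r,
    all (gtn n) (is_ ++ yn) & matches (edge_rel G) r (natc P) is_ yn].
Proof.
move=> st aP [x0 [ps [Q [ys [[PE so sy uy ny] wk]]]]].
have : perm_eq (ps ++ Q) P by rewrite perm_sym.
case/(perm_iotaP [::]) => Is pI E.
have uI : uniq Is by rewrite (perm_uniq pI) iota_uniq.
have IP : all (gtn (size P)) Is.
  by apply/allP => i; rewrite (perm_mem pI) mem_iota.
have sI : size ps <= size Is by rewrite -(size_map (nth [::] P)) -E size_cat leq_addr.
pose is_ := take (size ps) Is.
have psE : ps = [seq nth [::] P i | i <- is_].
  by rewrite map_take -E take_size_cat.
have aI : all (gtn (size P)) is_ by apply/allP => i /mem_take /(allP IP).
exists is_, (map val ys); split.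
- by rewrite size_takel // -so size_map.
- by rewrite size_map.
- rewrite all_cat; apply/andP; split; last by rewrite all_map; apply/allP => y _ /=.
  by apply/allP => i /(allP aI) /= iP; apply: leq_trans iP (size_coll aP).
rewrite /matches size_map aI chosen_nat -psE /=; apply/and5P; split.
- by rewrite -so /natc -map_comp; apply/eqP; apply: eq_map => p /=; rewrite size_map.
- exact: take_uniq.
- by rewrite flatten_nat all_map; apply: sub_all ny => y; rewrite /= mem_map //; apply: val_inj.
- by rewrite map_inj_uniq //; apply: val_inj.
by rewrite (walks_nat x0).
Qed.

Lemma ord_seq (s : seq nat) : all (gtn n) s -> exists s' : seq 'I_n, s = map val s'.
Proof.
elim: s => [|x s IH] /=; first by exists [::].
by case/andP=> xn /IH[s' ->]; exists (Ordinal xn :: s').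
Qed.

Lemma chosen_rest P is_ : uniq is_ -> all (gtn (size P)) is_ ->
  exists Q, perm_eq P ([seq nth [::] P i | i <- is_] ++ Q).
Proof.
move=> ui al; exists [seq nth [::] P i | i <- [seq i <- iota 0 (size P) | i \notin is_]].
rewrite -map_cat perm_sym; apply/(perm_iotaP [::]).
exists (is_ ++ [seq i <- iota 0 (size P) | i \notin is_]) => //.
apply: uniq_perm; rewrite ?iota_uniq //.
  rewrite cat_uniq ui filter_uniq ?iota_uniq // andbT.
  by apply/hasPn => i; rewrite mem_filter => /andP[].
move=> i; rewrite mem_cat mem_filter mem_iota /= add0n.
by case ii: (i \in is_) => //=; have /= -> := allP al _ ii.
Qed.

Lemma matches_fits P r (is_ ys : seq nat) : static r ->
  size is_ = size (orders r) -> size ys = fresh r -> all (gtn n) (is_ ++ ys) ->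
  matches (edge_rel G) r (natc P) is_ ys ->
  exists x0 ps Q ys', [/\ fits x0 P r ps Q ys', chosen (natc P) is_ = natc ps,
    ys = map val ys' & perm_eq P (ps ++ Q)].
Proof.
move=> st si sy; rewrite all_cat => /andP[aI aY].
have n0 : 0 < n.
  have /and4P[K0 _ _ _] := st; move: K0; rewrite -si -sy.
  case: (is_) aI => [|i is'] /=; last by case/andP; case: (n).
  by case: (ys) aY => //= y ys' /andP[yn _] _; case: (n) yn.
have x0 : 'I_n := Ordinal n0.
have [ys' yE] := ord_seq aY; rewrite yE in sy *.
rewrite /matches size_map chosen_nat => /andP[al /and5P[/eqP so ui ny uy wk]].
have [Q PQ] := chosen_rest ui al.
exists x0, [seq nth [::] P i | i <- is_], Q, ys'; split=> //.
have so' : [seq size p | p <- [seq nth [::] P i | i <- is_]] = orders r.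
  by rewrite -so /natc -[RHS]map_comp; apply: eq_map => p /=; rewrite size_map.
rewrite size_map in sy.
split; last by rewrite -(walks_nat x0 st so' sy).
split=> //.
  by move: uy; rewrite map_inj_uniq //; apply: val_inj.
by move: ny; rewrite flatten_nat all_map; apply: sub_all => y; rewrite /= mem_map //; apply: val_inj.
Qed.

End Fits.

(** * The program *)

Fixpoint try_rules (rs : seq rule) : cmd :=
  if rs is r :: rs' then
    Seq (search (path_vars r ++ vertex_vars r) (guard r))
      (If (var 0) (Seq (apply_rule r) print_coll) (try_rules rs'))
  else assign 1 (Cst 0).

Section TryRules.
Variables (n : nat) (G : sgraph 'I_n).

Lemma encode_natE (P : coll 'I_n) : encode_nat (natc P) = encode_coll P.
Proof.
rewrite /encode_nat /encode_coll /natc size_map -map_comp; congr (_ :: flatten _).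
by apply: eq_map => p; rewrite /= /encode_path size_map.
Qed.

Lemma loop_vars_uniq r : static r ->
  uniq [:: 0, 1 & path_vars r ++ vertex_vars r].
Proof. by move=> _; rewrite /path_vars /vertex_vars -iotaD /= !inE !mem_iota iota_uniq. Qed.

Lemma stores_agree S m m' P : agree S m m' -> stores m P -> stores m' P.
Proof.
move=> ag [mN sl mu]; split; [by rewrite ag | | by move=> y; rewrite ag].
by move=> k kP; have [s v] := sl k kP; split=> [|j js]; rewrite ag //= v.
Qed.

Definition step_result (rs : seq rule) (P : coll 'I_n) m (m' : memory) (o : seq nat) :=
  (exists rs1 r rs2 x0 ps Q ys P', [/\ rs = rs1 ++ r :: rs2,
     forall r', r' \in rs1 -> ~ fires G P r', fits G x0 P r ps Q ys,
     perm_eq P' (pieces [seq [seq nth x0 (flatten ps ++ ys) c | c <- l] | l <- results r] ++ Q)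
     & [/\ stores m' (natc P'), o = encode_coll P' & m' 0 1 = m 0 1]]) \/
  [/\ forall r', r' \in rs -> ~ fires G P r', o = [::] , m' 0 1 = 0
    & stores m' (natc P)].

End TryRules.

Lemma rule_bound (r : rule) : static r -> exists A, forall n, 
  search_cost n (guard r) (size (orders r) + fresh r) <= A * n.+1 ^ 7.
Proof.
case/and4P=> _ le7 _ _.
exists (10 + ecost (guard r) + 80 * (size (orders r) + fresh r)) => n.
apply: leq_trans (search_cost_bound _ _ _) _.
by rewrite leq_mul2l leq_pexp2l ?orbT.
Qed.

Lemma pow_ge1 n : 1 <= n.+1 ^ 7.
Proof. by rewrite expn_gt0. Qed.

Lemma pow_gen n : n.+1 <= n.+1 ^ 7.
Proof. by rewrite -{1}(expn1 n.+1) leq_pexp2l. Qed.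

(** The constant depends on the rules alone. Updating takes constant time and printing linear time,
    both absorbed by the seventh power. *)
Lemma try_rules_spec (rs : seq rule) : all static rs ->
  exists A, forall n (G : sgraph 'I_n) (P : coll 'I_n) m,
    admissible G P -> stores m (natc P) ->
    runs G (try_rules rs) m (step_result G rs P m) (A * n.+1 ^ 7).
Proof.
elim: rs => [|r rs IH] /=.
  move=> _; exists 3 => n G P m aP st.
  have le : 3 <= 3 * n.+1 ^ 7 by rewrite leq_pmulr // pow_ge1.
  have rw := @runs_write n G 0 (Cst 1) (Cst 0) m
    (fun m' o => m' = update m 0 1 0 /\ o = [::]) (conj erefl erefl).
  apply: (runs_weaken rw le).
  move=> m' o [-> ->]; right; split=> //.
case/andP=> str /IH[A HA]; have [B HB] := rule_bound str.
have /and4P[K0 le7 leF codes] := str.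
pose C := block_cost (rule_writes r).
exists (B + (C + 300 * (8 + size (pieces (results r))) + A + 20)) => n G P m aP st.
set X := n.+1 ^ 7; have X1 : 1 <= X := pow_ge1 n.
have le : (search_cost n (guard r) (size (orders r) + fresh r) +
    (2 + ((C + 300 * (n + size (pieces (results r))).+1).+1 + A * X)).+1).+1
    <= (B + (C + 300 * (8 + size (pieces (results r))) + A + 20)) * X.
  have := HB n; rewrite -/X => leB; have leX : n.+1 <= X := pow_gen n.
  rewrite !mulnDl -addnS leq_add //.
  have cX k : k <= k * X by rewrite leq_pmulr.
  have := cX C; have := cX (300 * size (pieces (results r))).
  by rewrite !mulnDr !mulnDl; move: leX; move: (A * X) (C * X) (size (pieces _)) => a c s; lia.
apply: runs_weaken le (fun m' o H => H).
have u01 := loop_vars_uniq str; set ks := path_vars r ++ vertex_vars r in u01 *.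
have u0 : uniq (0 :: ks).
  by move: u01; rewrite /= !inE !negb_or => /and3P[/andP[_ ->] _ ->].
have ks1 : 1 \notin 0 :: ks by move: u01; rewrite /= !inE => /and3P[_ ->].
have ksE : ks = iota 3 (size (orders r) + fresh r) by rewrite /ks -iotaD.
have sks : size ks = size (orders r) + fresh r by rewrite ksE size_iota.
pose phi vs := matches (edge_rel G) r (natc P) (take (size (orders r)) vs) (drop (size (orders r)) vs).
have tk m1 : take (size (orders r)) (map (m1 0) ks) = map (m1 0) (path_vars r).
  by rewrite -map_take /ks take_size_cat // size_iota.
have dr m1 : drop (size (orders r)) (map (m1 0) ks) = map (m1 0) (vertex_vars r).
  by rewrite -map_drop /ks drop_size_cat // size_iota.
have gE m1 : agree (0 :: ks) m m1 -> all (gtn n) (map (m1 0) ks) ->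
    (eval G m1 (guard r) != 0) = phi (map (m1 0) ks).
  by move=> ag _; rewrite (guard_eval G r (stores_agree ag st)) /phi tk dr.
rewrite -sks; apply: (runs_seq (search_spec u0 gE)).
move=> m1 o1 [-> ag res]; have st1 := stores_agree ag st.
have m11 : m1 0 1 = m 0 1 by rewrite ag //= ks1.
apply: runs_if => /=; case: res => [[m10 al ph]|[m10 no]]; rewrite m10 /=; last first.
  have nf : ~ fires G P r.
    case/(fires_matches str aP) => is_ [yn [si sy aln mt]].
    have := no (is_ ++ yn); rewrite sks size_cat si sy => /(_ erefl aln).
    by rewrite /phi take_size_cat // drop_size_cat // mt.
  apply: runs_weaken (HA n G P m1 aP st1) _ _; first by rewrite leq_addl.
  move=> m2 o [[rs1 [r' [rs2 [x0 [ps [Q [ys [P' [E nf' ft pe [st2 oE m21]]]]]]]]]]|[nf' -> m21 st2]].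
    left; exists (r :: rs1), r', rs2, x0, ps, Q, ys, P'; split=> //; first by rewrite E.
      by move=> r''; rewrite inE => /orP[/eqP->|/nf'].
    by split=> //; rewrite m21.
  by right; split=> // r'; rewrite inE => /orP[/eqP->|/nf'].
rewrite /phi tk dr in ph; rewrite /ks map_cat in al.
have [||x0 [ps [Q [ys [ft chE yE PQ]]]]] := matches_fits str _ _ al ph;
  rewrite ?size_map ?size_iota //.
have [[PE so sy uy ny] wk] := ft.
have leC : (C + 300 * (n + size (pieces (results r))).+1).+1 <=
    (C + 300 * (n + size (pieces (results r))).+1).+1 + A * X by rewrite leq_addr.
apply: (runs_weaken _ leC (fun m' o H => H)).
have up : uniq (flatten (natc P)).
  rewrite flatten_nat map_inj_uniq; last exact: val_inj.
  by case/andP: aP; rewrite feasibleE => /andP[].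
have PQ' : perm_eq (natc P) (chosen (natc P) (map (m1 0) (path_vars r)) ++ natc Q).
  by rewrite chE /natc -map_cat perm_map.
have sD : size (flatten ps ++ ys) = sumn (orders r) + fresh r.
  by rewrite size_cat sy size_flatten -so.
have DE : flatten (chosen (natc P) (map (m1 0) (path_vars r))) ++ map (m1 0) (vertex_vars r)
    = map val (flatten ps ++ ys) by rewrite chE flatten_nat yE map_cat.
have cd : all (all (gtn (size (flatten ps ++ ys)))) (results r).
  by move: codes; rewrite sD all_cat => /andP[].
have leP : size (orders r) <= size (pieces (results r)) := leq_trans leF (size_pieces _).
have ap := @apply_spec n G m1 (natc P) (natc Q) r le7 st1 up ph PQ' leP.
rewrite DE size_map in ap; have {}ap := ap cd.
apply: (runs_seq ap) => m2 o2 [-> [m21 [Pn st2 pn]]].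
have [P' PnE pP'] : exists2 P', Pn = natc P' &
    perm_eq P' (pieces [seq [seq nth x0 (flatten ps ++ ys) c | c <- l] | l <- results r] ++ Q).
  by apply: perm_map_inv; rewrite map_cat -pieces_map -/(natc _) -(codes_nat x0 cd).
have s7 : all (fun L : seq nat => size L <= 7) Pn.
  rewrite PnE /natc all_map (perm_all _ pP') all_cat.
  have ae : (fun L : seq 'I_n => size (map val L) <= 7) =1 (fun L => size L <= 7).
    by move=> L; rewrite size_map.
  rewrite !(eq_all (a2 := fun L => size L <= 7)) // pieces_small /=.
  by case/andP: aP => _; rewrite (perm_all _ PE) all_cat => /andP[].
apply: runs_weaken (print_coll_spec G st2 s7) _ _.
  rewrite leq_mul2l /= ltnS (perm_size pn) size_cat addnC leq_add //.
    rewrite size_map; apply: leq_trans (size_coll aP); rewrite (perm_size PE) size_cat.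
    exact: leq_addl.
  by rewrite pieces_map size_map.
move=> m3 o [-> st3 m31]; left; exists [::], r, rs, x0, ps, Q, ys, P'; split=> //.
split; [by rewrite -PnE | by rewrite PnE encode_natE | by rewrite m31 m21].
Qed.

(** * The program given by a complete list of rules *)

Definition valid_rule i (r : rule) := static r /\
  forall n (G : sgraph 'I_n) P x0 ps Q ys, admissible G P ->
    fits G x0 P r ps Q ys ->
    exists2 P1, operation G i P P1 & perm_eq P1 (outcome x0 r ps Q ys).

(** An operation needs to be detected only when the earlier ones are inapplicable, which is when
    Approx2 checks it; for Look-ahead this restriction keeps the number of loops at 7. *)
Definition complete_rules (L : nat -> seq rule) :=
  forall i, (forall r, r \in L i -> valid_rule i r) /\
  forall n (G : sgraph 'I_n) P, admissible G P -> applicable G i P ->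
    (forall j, j < i -> ~ applicable G j P) ->
    exists2 r, r \in L i & fires G P r.

(** Locates a rule in the group of its operation: all rules of the earlier groups have been tried
    before it, so the priority of the operations is respected. *)
Lemma flatten_prefix (S : eqType) (rs1 rs2 : seq S) r ss : rs1 ++ r :: rs2 = flatten ss ->
  exists i, [/\ i < size ss, r \in nth [::] ss i & forall j, j < i -> {subset nth [::] ss j <= rs1}].
Proof.
elim: ss rs1 => [|s ss IH] rs1 /=; first by case: rs1.
case: (ltnP (size rs1) (size s)) => [lt E|le E].
  exists 0; split=> //=; have := congr1 (fun u => nth r u (size rs1)) E.
  by rewrite /= nth_cat ltnn subnn nth_cat lt /= => ->; apply: mem_nth.
have Es : rs1 = s ++ drop (size s) rs1.
  have := congr1 (take (size s)) E; rewrite takel_cat // take_size_cat // => {1}<-.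
  by rewrite cat_take_drop.
have E' : drop (size s) rs1 ++ r :: rs2 = flatten ss.
  have := congr1 (drop (size s)) E; rewrite {1}Es -catA.
  by rewrite !drop_size_cat.
have [i [lt ri H]] := IH _ E'; exists i.+1; split=> // -[|j] ji x xj /=.
  by rewrite Es mem_cat xj.
by rewrite Es mem_cat (H j ji x xj) orbT.
Qed.

Section Program.
Variable L : nat -> seq rule.
Hypothesis HL : complete_rules L.

Definition all_rules := flatten [seq L i | i <- iota 0 5].

Definition program : cmd :=
  Seq print_coll (Seq (assign 1 (Cst 1)) (While (var 1) (try_rules all_rules))).

Lemma all_rules_static : all static all_rules.
Proof.
apply/allP => r /flattenP[s /mapP[i _ ->] /(HL i).1] [].
by [].
Qed.

(** Strong induction, since completeness for one operation presupposes that the earlier ones are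
    inapplicable. *)
Lemma no_rule n (G : sgraph 'I_n) P i : admissible G P ->
  (forall j r, j < i -> r \in L j -> ~ fires G P r) ->
  forall j, j < i -> ~ applicable G j P.
Proof.
move=> aP none j; elim/ltn_ind: j => j IH ji app.
have [|r rj fr] := (HL j).2 n G P aP app.
  by move=> k kj; apply: IH => //; apply: ltn_trans ji.
exact: none ji rj fr.
Qed.

Lemma step_result_step n (G : sgraph 'I_n) P m m' o : admissible G P ->
  step_result G all_rules P m m' o ->
  (exists P', [/\ step G P P', stores m' (natc P'), o = encode_coll P' & m' 0 1 = m 0 1]) \/
  [/\ terminal G P, o = [::] & m' 0 1 = 0].
Proof.
move=> aP [[rs1 [r [rs2 [x0 [ps [Q [ys [P' [E nf ft pe [st oE m1]]]]]]]]]]|[nf -> m1 _]].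
  left; exists P'; split=> //.
  have [i []] := flatten_prefix (esym E).
  rewrite size_map size_iota => i5; rewrite (nth_map 0) ?size_iota // nth_iota // add0n.
  move=> ri sub; have [_ val] := (HL i).1 r ri.
  have [P1 op P1E] := val _ _ _ _ _ _ _ aP ft.
  exists i, P1; split=> //.
    apply: (no_rule aP) => j r' ji r'j; apply: nf; apply: (sub j ji).
    have j5 : j < 5 := ltn_trans ji i5.
    by rewrite (nth_map 0) ?size_iota // nth_iota // add0n.
  apply: (broken_perm P1E); apply: broken_pieces pe.
  have [[PE _ _ _ _] _] := ft; case/andP: aP => _.
  by rewrite (perm_all _ PE) all_cat => /andP[].
right; split=> // i app.
have i5 : i < 5.
  rewrite ltnNge; apply/negP => i5; case: app => P'.
  by rewrite /operation nth_default.
have none j r : j < i.+1 -> r \in L j -> ~ fires G P r.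
  move=> ji rj; apply: nf; apply/flattenP; exists (L j) => //.
  by apply: map_f; rewrite mem_iota /=; lia.
exact: (no_rule aP none (ltnSn i)).
Qed.

(** [d] bounds the potential still to be gained; with [d] equal to 0 no step is possible, as the
    potential is at most [3 * n]. *)
Lemma program_loop : exists A, forall n (G : sgraph 'I_n) d P m,
  admissible G P -> stores m (natc P) -> m 0 1 = 1 -> 3 * n <= potential P + d ->
  runs G (While (var 1) (try_rules all_rules)) m
    (fun m' o => exists s, [/\ steps G P s, terminal G (last P s)
       & o = flatten [seq encode_coll P' | P' <- s]])
    (d.+1 * (A * n.+1 ^ 7 + 3) + 3).
Proof.
have [A HA] := try_rules_spec all_rules_static; exists A => n G.
elim=> [|d IH] P m aP st m1 pot; set X := n.+1 ^ 7.
  have le : (ecost (var 1) + A * X + 3).+1 <= 1 * (A * X + 3) + 3 by rewrite /=; lia.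
  apply: runs_weaken le (fun m' o H => H).
  apply: (runs_while_loop (R1 := step_result G all_rules P m)); first by rewrite /= m1.
    exact: HA.
  move=> m2 o2 /(step_result_step aP)[[P' [stp _ _ _]]|[tm -> m21]].
    exfalso; have [aP' lt] := step_admissible stp aP.
    have /andP[fP' _] := aP'; have := potential_bound fP'; rewrite card_ord; lia.
  by apply: runs_while_end; [rewrite /= m21 | exists [::]].
have le : (ecost (var 1) + A * X + (d.+1 * (A * X + 3) + 3)).+1 <= d.+2 * (A * X + 3) + 3.
  by rewrite /=; lia.
apply: runs_weaken le (fun m' o H => H).
apply: (runs_while_loop (R1 := step_result G all_rules P m)); first by rewrite /= m1.
  exact: HA.
move=> m2 o2 /(step_result_step aP)[[P' [stp st2 -> m21]]|[tm -> m21]].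
  have [aP' lt] := step_admissible stp aP.
  apply: runs_weaken (IH P' m2 aP' st2 _ _) (leqnn _) _.
  - by rewrite m21.
  - by lia.
  by move=> m3 o [s [ss ts ->]]; exists (P' :: s).
apply: runs_weaken (runs_while_end (R := fun m' o => exists s, [/\ steps G P s, terminal G (last P s)
       & [::] ++ o = flatten [seq encode_coll P' | P' <- s]]) _ _ _) _ _ => //.
- by exists [::].
by rewrite /=; lia.
Qed.

Lemma program_spec : exists C, forall n (G : sgraph 'I_n),
  exists s m t, [/\ complete_execution G s,
    exec G program mem0 m (encode_execution s) t & 0 < n -> t <= C * n ^ 8].
Proof.
(* The factor [2 ^ 8] turns [n.+1 ^ 8] into [n ^ 8] for positive [n]. *)
have [A HA] := program_loop; exists ((4 * A + 400) * 2 ^ 8) => n G.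
have st0 : stores mem0 (natc (Nil (seq 'I_n))) by split.
have a0 := admissible_nil G.
have : runs G program mem0 (fun m' o => exists s, [/\ execution G s, terminal G (output s)
    & o = encode_execution s]) (300 + (3 + ((3 * n).+1 * (A * n.+1 ^ 7 + 3) + 3)).+1).+1.
  apply: (runs_seq (print_coll_spec G st0 isT)) => m1 o1 [-> st1 _].
  apply: (runs_seq (R1 := fun m' o => m' = update m1 0 1 1 /\ o = [::])).
    by apply: runs_write.
  move=> m2 o2 [-> ->].
  apply: runs_weaken (HA n G (3 * n) [::] _ a0 _ _ _) (leqnn _) _ => //.
  by move=> m' o [s [ss ts ->]]; exists s; split.
case=> m [o [t [ex le [s [exs ts oE]]]]]; exists s, m, t; split=> //.
  by rewrite -oE.
move=> n0; apply: leq_trans le _.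
have le2 : n.+1 ^ 8 <= 2 ^ 8 * n ^ 8.
  by rewrite -expnMn leq_exp2r // mul2n -addnn -addn1 leq_add2l.
rewrite -mulnA; apply: leq_trans (leq_mul (leqnn (4 * A + 400)) le2).
rewrite expnS; have := pow_ge1 n; have := pow_gen n.
move: (n.+1 ^ 7) => X nX X1.
nia.
Qed.

End Program.

(** * Rules read off applications of the operations *)

Fixpoint words (T : Type) (A : seq T) k : seq (seq T) :=
  if k is k'.+1 then [::] :: allpairs cons A (words A k') else [:: [::]].

Lemma mem_words (T : eqType) (A : seq T) k s :
  size s <= k -> {subset s <= A} -> s \in words A k.
Proof.
elim: k s => [|k IH] [|x s] //= le sub; rewrite inE //=.
apply: allpairs_f; first by apply: sub; rewrite inE eqxx.
by apply: IH => // y ys; apply: sub; rewrite inE ys orbT.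
Qed.

(** A finite superset of the rules that arise: at most 2 replaced paths of order at most 7 and at
    most 7 uncovered vertices make at most 21 vertices, and there are at most 3 walks and 3
    results. *)
Definition universe : seq rule :=
  let lists := words (words (iota 0 22) 21) 3 in
  [seq (abc, d) | abc <- [seq (ab, c) | ab <- [seq (a, b) | a <- words (iota 0 8) 2, b <- iota 0 8],
                                       c <- lists], d <- lists].

(** Validity of a rule quantifies over all graphs, so the valid rules are selected by excluded
    middle. *)
Lemma classical_filter (T : eqType) (A : T -> Prop) (s : seq T) :
  exists s' : seq T, forall x, x \in s' <-> x \in s /\ A x.
Proof.
elim: s => [|y s [s' H]]; first by exists [::] => x; split=> // -[].
case: (classic (A y)) => Ay; [exists (y :: s') | exists s'] => x; rewrite !inE.
  split=> [/orP[/eqP->|/H[xs Ax]]|[/orP[-> //|xs] Ax]]; first by rewrite eqxx.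
    by rewrite xs orbT.
  by apply/orP; right; apply/H.
split=> [/H[xs Ax]|[/orP[/eqP xy|xs] Ax]]; first by rewrite xs orbT.
  by rewrite xy in Ax.
exact/H.
Qed.

Lemma takes_small_all n (G : sgraph 'I_n) (P ps Q : coll 'I_n) : admissible G P ->
  perm_eq P (ps ++ Q) -> all (fun p => 4 <= size p <= 7) ps.
Proof.
case/andP; rewrite feasibleE => /andP[_ lg] s7 PE.
move: lg s7; rewrite !(perm_all _ PE) !all_cat => /andP[/allP lg _] /andP[/allP s7 _].
by apply/allP => p pp; rewrite (s7 p pp) andbT; have /andP[] := lg p pp.
Qed.

(* The rule read off one application of an operation is valid as soon as the
   application can be transported along every injection of the vertices
   involved that preserves the given walks. *)
Lemma make_rule i n (G : sgraph 'I_n) (P ps Q : coll 'I_n) (ys : seq 'I_n) (cks nws : coll 'I_n) :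
  admissible G P -> perm_eq P (ps ++ Q) -> uniq ys ->
  all (fun y => y \notin flatten P) ys -> all (sorted G) cks ->
  {subset flatten (nws ++ cks) <= flatten ps ++ ys} ->
  0 < size ps + size ys <= 7 -> size ps <= 2 -> size ps <= size nws <= 3 ->
  size cks <= 3 -> all (fun l => size l <= 21) (nws ++ cks) ->
  (forall n' (G' : sgraph 'I_n') (P' Q' : coll 'I_n') (f : 'I_n -> 'I_n'),
     admissible G' P' -> {in flatten ps ++ ys &, injective f} ->
     perm_eq P' (map (map f) ps ++ Q') -> all (fun y => y \notin flatten P') (map f ys) ->
     all (sorted G') (map (map f) cks) ->
     exists2 P1, operation G' i P' P1 & perm_eq P1 (map (map f) nws ++ Q')) ->
  exists2 r, r \in universe /\ valid_rule i r & fires G P r.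
Proof.
move=> aP PE uy ny sc sub /andP[K0 K7] ps2 /andP[leN N3] C3 s21 transport.
set D := flatten ps ++ ys in sub transport.
have ps47 := takes_small_all aP PE.
pose code := [fun l : seq 'I_n => [seq index v D | v <- l]].
pose r : rule := (map size ps, size ys, map code cks, map code nws).
have sD : size D = sumn (map size ps) + size ys by rewrite size_cat size_flatten.
have codes : all (all (gtn (size D))) (map code nws ++ map code cks).
  rewrite -map_cat all_map; apply/allP => l lN /=; rewrite all_map; apply/allP => v vl /=.
  by rewrite index_mem; apply: sub; apply/flattenP; exists l.
have D21 : size D <= 21.
  rewrite sD; move: ps2 K7 ps47; clear.
  case: ps => [|p [|q [|//]]] _ /=; first by lia.
    by move=> ? /andP[/andP[_ ?] _]; lia.
  by move=> ? /and3P[/andP[_ ?] /andP[_ ?] _]; lia.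
have lists (ls : coll 'I_n) : {subset ls <= nws ++ cks} -> size ls <= 3 ->
    map code ls \in words (words (iota 0 22) 21) 3.
  move=> lsub l3; apply: mem_words; first by rewrite size_map.
  move=> _ /mapP[l ll ->]; apply: mem_words.
    by rewrite size_map; apply: (allP s21); apply: lsub.
  move=> _ /mapP[v vl ->]; rewrite mem_iota /= add0n ltnS.
  apply: leq_trans D21; apply: ltnW; rewrite index_mem; apply: sub.
  by apply/flattenP; exists l => //; apply: lsub.
have st : static r.
  apply/and4P; split; rewrite /orders /fresh /results /walks /= ?size_map //.
  by rewrite -sD.
have D0 : exists x0 : 'I_n, True.
  have : 0 < size D.
    rewrite sD; move: K0 ps47; case: (ps) => [|p ps0] //= _ /andP[/andP[p4 _] _].
    by rewrite (leq_trans _ (leq_addr _ _)) // (leq_trans _ (leq_addr _ _)) // (leq_trans _ p4).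
  by case: (D) => // x0 D' _; exists x0.
have [x0 _] := D0.
exists r; [split|].
- apply: allpairs_f; [apply: allpairs_f; [apply: allpairs_f|]|].
  + apply: mem_words; first by rewrite size_map.
    by move=> _ /mapP[p pp ->]; rewrite mem_iota ltnS; have /andP[_ ->] := allP ps47 p pp.
  + by rewrite mem_iota /= ltnS; lia.
  + by apply: lists => // l; rewrite mem_cat => ->; rewrite orbT.
  by apply: lists => // l; rewrite mem_cat => ->.
- split=> // n' G' P' x0' ps' Q' ys' aP' [[PE' so sy uy' ny'] wk].
  rewrite /outcome; set D' := flatten ps' ++ ys' in wk *.
  have sD' : size D' = size D.
    by rewrite /D' size_cat size_flatten /shape so sy -sD.
  have uD' : uniq D'.
    rewrite /D' cat_uniq uy' andbT; apply/andP; split.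
      case/andP: aP'; rewrite feasibleE (perm_uniq (perm_flatten PE')) flatten_cat cat_uniq.
      by case/andP=> /andP[].
    apply/hasPn => y /(allP ny'); apply: contra => yp.
    by rewrite (perm_mem (perm_flatten PE')) flatten_cat mem_cat yp.
  (* [f] carries the original application to the match at hand, position by position. *)
  pose f v := nth x0' D' (index v D).
  have injf : {in D &, injective f}.
    move=> u v uD vD /eqP; rewrite nth_uniq ?sD' ?index_mem // => /eqP uv.
    by rewrite -(nth_index u uD) uv nth_index.
  have fD : map f D = D'.
    have uD : uniq D.
      rewrite /D cat_uniq uy andbT; apply/andP; split.
        case/andP: aP; rewrite feasibleE (perm_uniq (perm_flatten PE)) flatten_cat cat_uniq.
        by case/andP=> /andP[].
      apply/hasPn => y /(allP ny); apply: contra => yp.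
      by rewrite (perm_mem (perm_flatten PE)) flatten_cat mem_cat yp.
    apply: (@eq_from_nth _ x0'); rewrite size_map // => k kD.
    by rewrite (nth_map x0) // /f index_uniq.
  have [fps fys] : flatten (map (map f) ps) = flatten ps' /\ map f ys = ys'.
    have sfl : size (flatten (map (map f) ps)) = size (flatten ps').
      rewrite -map_flatten size_map !size_flatten /shape so.
      by [].
    move: fD; rewrite /D /D' map_cat map_flatten => /eqP.
    by rewrite eqseq_cat // => /andP[/eqP-> /eqP->].
  have psE : map (map f) ps = ps'.
    rewrite -[LHS]flattenK -[RHS]flattenK fps; congr reshape.
    by rewrite /shape so -map_comp; apply: eq_map => p /=; rewrite size_map.
  have mapE ls : map (fun l => [seq nth x0' D' c | c <- l]) (map code ls) = map (map f) ls.
    by rewrite -map_comp; apply: eq_map => l /=; rewrite -map_comp.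
  rewrite /results /= mapE; apply: transport => //.
  - by rewrite psE.
  - by rewrite fys.
  by move: wk; rewrite /walks /= -mapE [in X in _ -> X]all_map.
exists x0, ps, Q, ys; split; first by split.
rewrite /walks /= all_map; apply/allP => l lc /=; rewrite -map_comp.
have -> : [seq (nth x0 D \o index^~ D) v | v <- l] = l.
  rewrite -[RHS]map_id; apply/eq_in_map => v vl /=; apply: nth_index; apply: sub.
  by apply/flattenP; exists l => //; rewrite mem_cat lc orbT.
exact: (allP sc).
Qed.

Lemma takes_orient (T : finType) (P : coll T) p Q : takes P p Q ->
  exists2 p', perm_eq P (p' :: Q) & p' = p \/ p' = rev p.
Proof. by case=> PE; [exists p => //; left | exists (rev p) => //; right]. Qed.

Lemma takes_map (T T' : finType) (f : T -> T') (P' : coll T') p p' Q' :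
  p' = p \/ p' = rev p -> perm_eq P' (map f p' :: Q') -> takes P' (map f p) Q'.
Proof. by case=> ->; [left | right; rewrite -map_rev]. Qed.

Lemma orient_mem (T : finType) (p p' : seq T) : p' = p \/ p' = rev p -> p' =i p.
Proof. by case=> -> // v; rewrite mem_rev. Qed.

Lemma extension_intro (T : finType) (G : sgraph T) P x e :
  sorted G (x :: e) -> uniq e -> all (fun y => y \notin flatten P) e -> extension G P x e.
Proof. by rewrite /extension => /= -> -> ->. Qed.

Lemma extension_take (T : finType) (G : sgraph T) P x e k :
  extension G P x e -> extension G P x (take k e).
Proof.
case/and3P=> pe ue /allP De; apply: extension_intro.
- by rewrite /=; move: pe; rewrite -{1}(cat_take_drop k e) cat_path => /andP[].
- exact: take_uniq.
by apply/allP => y /mem_take /De.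
Qed.

(** * A rule for each application of an operation *)

Section OperationRules.
Variables (n : nat) (G : sgraph 'I_n) (P : coll 'I_n).
Hypothesis aP : admissible G P.
Implicit Types (Q : coll 'I_n) (p q e pre suf : seq 'I_n).

Let good_rule i := exists2 r, r \in universe /\ valid_rule i r & fires G P r.

Lemma add_rule : applicable G 0 P -> good_rule 0.
Proof.
case=> P1 [p [p4 /andP[up sp] np _]].
apply: (@make_rule 0 n G P [::] P p [:: p] [:: p]) => //=; rewrite ?p4 ?sp //.
  by move=> v; rewrite /= !cats0 mem_cat orbb.
move=> n' G' P' Q' f _ injf PE nf; rewrite andbT => sf.
exists (map f p :: P'); last by rewrite perm_cons.
exists (map f p); split=> //; first by rewrite size_map.
by rewrite /gpath sf andbT map_inj_in_uniq.
Qed.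

Lemma rep_rule : applicable G 1 P -> good_rule 1.
Proof.
case=> P1 [x [e0 [pre [suf [Q [tk half ext0 le _]]]]]].
have [p' PE pp'] := takes_orient tk; have s47 := takes_sizes aP tk.
set p := pre ++ x :: suf in tk half pp' s47.
(* An extension that is long enough is shortened to the least admissible order, at most 4, to bound
   the number of loops. *)
pose e := take (size pre).+1 e0.
have ext : extension G P x e := extension_take _ ext0.
have se : size e = (size pre).+1 by rewrite /e size_takel.
have /and3P[pe ue ne] := ext.
have pre3 : size pre <= 3 by have /andP[_ ?] := s47; size_lia.
have sp : sorted G p.
  have [fP _] := andP aP; move: fP; rewrite (takes_feasible G tk) feasibleE /=.
  by case/andP=> _ /andP[/andP[]].
have psuf : path G x suf by move: sp; rewrite /p sorted_around => /andP[].
have sfit : size (rev e ++ x :: suf) <= 21.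
  by move: s47; rewrite /p !size_cat size_rev se /= => /andP[_ ?]; size_lia.
apply: (@make_rule 1 n G P [:: p'] Q e [:: rev e ++ x :: suf] [:: rev e ++ x :: suf]) => //=.
- by rewrite sorted_around revK pe psuf.
- move=> v; rewrite /= !cats0 !mem_cat orbb mem_rev (orient_mem pp') /p mem_cat.
  by case/orP=> ->; rewrite ?orbT.
- by rewrite se; size_lia.
- by rewrite sfit.
move=> n' G' P' Q' f aP' injf PE' nf; rewrite andbT map_cat map_rev /= => sf.
move: sf; rewrite sorted_around revK => /andP[pf _].
have tk' := takes_map pp' PE'; rewrite /p map_cat /= in tk'.
exists ((rev (map f e) ++ f x :: map f suf) :: Q') => //.
exists (f x), (map f e), (map f pre), (map f suf), Q'; split=> //.
- by move: half; rewrite /p !size_cat /= !size_map.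
- apply: extension_intro => //; rewrite map_inj_in_uniq //.
  by move=> u v ue' ve'; apply: injf; rewrite mem_cat ?ue' ?ve' orbT.
by rewrite !size_map se.
Qed.

Lemma double_rep_rule : applicable G 2 P -> good_rule 2.
Proof.
case=> P1 [pre [x [mid [y [suf [Q [e0 [f0 []]]]]]]]].
set p := pre ++ _ => tk half [exte0 extf0 uef0] [le lf] _.
have [p' PE pp'] := takes_orient tk; have s47 := takes_sizes aP tk.
(* At most 3 vertices remain in each extension: with the path, 7 choices. *)
pose e := take (4 - (size pre).+1) e0; pose h := take (4 - (size suf).+1) f0.
have exte : extension G P x e := extension_take _ exte0.
have exth : extension G P y h := extension_take _ extf0.
have se : size e = 4 - (size pre).+1 by rewrite /e size_takel.
have sh : size h = 4 - (size suf).+1 by rewrite /h size_takel.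
have ueh : uniq (e ++ h) by apply: subseq_uniq uef0; rewrite cat_subseq ?take_subseq.
have /and3P[pe ue ne] := exte; have /and3P[ph uh nh] := exth.
have [spre ssuf] : path G x (rev pre) /\ path G y suf.
  have [fP _] := andP aP; move: fP; rewrite (takes_feasible G tk) feasibleE /=.
  case/andP=> _ /andP[/andP[+ _] _]; rewrite /p sorted_around => /andP[-> ].
  by rewrite cat_path /= => /andP[_ /andP[]].
apply: (@make_rule 2 n G P [:: p'] Q (e ++ h) [:: pre ++ x :: e; rev h ++ y :: suf]
  [:: pre ++ x :: e; rev h ++ y :: suf]) => //=.
- by rewrite all_cat ne nh.
- by rewrite !sorted_around revK spre pe ph ssuf.
- move=> v; rewrite /= !cats0 [v \in p' ++ _]mem_cat (orient_mem pp') /p.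
  rewrite !(mem_cat, inE, mem_rev).
  by case: (v \in pre); case: (v \in e); case: (v \in h); case: (v \in suf);
    case: (v == x); case: (v == y); rewrite ?orbT.
- by rewrite size_cat se sh; clear; lia.
- move: s47; rewrite /p !(size_cat, size_rev) /= !(size_cat, size_rev) /= se sh.
  by move=> /andP[_ ?]; size_lia.
move=> n' G' P' Q' f aP' injf PE' nf; rewrite andbT !map_cat !map_rev /=.
rewrite !sorted_around revK => /andP[/andP[_ pfe] /andP[pfh _]].
have tk' := takes_map pp' PE'; rewrite /p map_cat /= map_cat /= in tk'.
have inj2 : {in e ++ h &, injective f}.
  by move=> u v ue' ve'; apply: injf; rewrite mem_cat ?ue' ?ve' orbT.
have ueh' : uniq (map f e ++ map f h) by rewrite -map_cat map_inj_in_uniq.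
have [ue' uh'] : uniq (map f e) /\ uniq (map f h).
  by move: ueh'; rewrite cat_uniq => /and3P[].
move: nf; rewrite map_cat all_cat => /andP[nfe nfh].
exists ((map f pre ++ f x :: map f e) :: (rev (map f h) ++ f y :: map f suf) :: Q') => //.
exists (map f pre), (f x), (map f mid), (f y), (map f suf), Q', (map f e), (map f h); split=> //.
- by move: half; rewrite /p !size_cat /= !size_cat /= !size_map.
- by split=> //; apply: extension_intro.
by rewrite !size_map se sh.
Qed.

Lemma recover_rule : applicable G 3 P -> good_rule 3.
Proof.
case=> P1 [p [q [Q [N [PE [p5 q5] [fN pN] h4 _]]]]].
have := takes_small_all aP (PE : perm_eq P ([:: p; q] ++ Q)).
rewrite /= andbT => /andP[/andP[_ p7] /andP[_ q7]].
have sN : size (flatten N) = size p + size q by rewrite (perm_size pN) size_cat.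
have [uN lN] : uniq (flatten N) /\ all (long G) N by move: fN; rewrite feasibleE => /andP[].
have N4 : 4 * size N <= size (flatten N).
  elim: (N) lN => //= r N' IH /andP[/andP[_ r4] /IH le].
  by rewrite size_cat mulnS leq_add.
(* A single new path would have order 4, while the two old ones have at least 10 vertices. *)
have N2 : 2 <= size N.
  case: (N) h4 sN => [|r [|r' N']] //=; rewrite orbF cats0 => /eqP-> ?; size_lia.
apply: (@make_rule 3 n G P [:: p; q] Q [::] N N) => //.
- by apply/allP => r /(allP lN) /andP[].
- by move=> v; rewrite flatten_cat mem_cat orbb (perm_mem pN) /= !cats0.
- by rewrite /= N2; size_lia.
- by size_lia.
- rewrite all_cat andbb; apply/allP => r rN.
  have : size r <= size (flatten N).
    by case/splitPr: rN => N1 N'; rewrite flatten_cat /= !size_cat addnCA leq_addr.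
  by rewrite sN => ?; size_lia.
move=> n' G' P' Q' f aP' injf PE' _ sf.
exists (map (map f) N ++ Q') => //.
exists (map f p), (map f q), Q', (map (map f) N); split=> //.
- by rewrite !size_map.
- split; last by rewrite -map_flatten -map_cat; apply: perm_map.
  rewrite feasibleE -map_flatten map_inj_in_uniq ?uN /=; last first.
    by move=> u v; rewrite !(perm_mem pN) => uu vv; apply: injf; rewrite /= !cats0.
  rewrite all_map; apply/allP => r rN; rewrite /= /long size_map.
  have /andP[_ ->] := allP lN r rN.
  by rewrite andbT; move: sf; rewrite all_map => /allP/(_ r rN).
by rewrite has_map; apply: sub_has h4 => r; rewrite /= size_map.
Qed.

Lemma near_end_map (n' : nat) (f : 'I_n -> 'I_n') w q :
  near_end w q -> near_end (f w) (map f q).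
Proof. by rewrite /near_end -map_rev -!map_take => /orP[] H; apply/orP; [left | right]; apply: map_f. Qed.

(* Both kinds of Look-ahead: p is replaced by r and a Rep at x' with the
   extension z follows. *)
Lemma look_ahead_pattern pre x suf Q e r pre' x' suf' Q2 z :
  let p := pre ++ x :: suf in let q := pre' ++ x' :: suf' in
  takes P p Q -> extension G P x e -> size e <= 3 ->
  {subset r <= p ++ e} -> {subset e <= r} -> size r <= 7 -> size q <= 7 ->
  takes (r :: Q) q Q2 -> size pre' < uphalf (size q) -> path G x' suf' ->
  extension G (r :: Q) x' z -> (size pre').+1 <= size z <= 4 ->
  size e + size [seq v <- z | v \notin p] + (if x' \in r then 1 else 2) <= 7 ->
  (forall n' (G' : sgraph 'I_n') (P' Q' : coll 'I_n') (f : 'I_n -> 'I_n'),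
     takes P' (map f p) Q' -> extension G' P' (f x) (map f e) ->
     (near_end x' q -> x' \notin r -> has (near_end (f x')) Q') ->
     forall P'', rep_at G' (map f r :: Q') (f x') (map f z) P'' -> operation G' 4 P' P'') ->
  good_rule 4.
Proof.
move=> p q tk ext e3 rpe er r7 q7 tk2 half' psuf extz /andP[le zz4] cnt wrap.
have [p' PE pp'] := takes_orient tk; have s47 := takes_sizes aP tk.
have up := takes_uniq aP tk.
have /and3P[pe ue /allP ne] := ext; have /and3P[pz uz /allP nz] := extz.
(* [z] may run through vertices of [p] freed by the replacement; these come with [p], and only the
   others need a loop. *)
pose w := [seq v <- z | v \notin p].
have memP v : (v \in flatten P) = (v \in p) || (v \in flatten Q).
  by rewrite (perm_mem (takes_perm tk)) mem_cat.
have nr v : v \in z -> v \notin r.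
  by move=> /nz; rewrite /= mem_cat => /norP[].
have nQ v : v \in z -> v \notin flatten Q.
  by move=> /nz; rewrite /= mem_cat => /norP[].
have wP v : v \in w -> v \notin flatten P.
  by rewrite mem_filter memP negb_or => /andP[-> /nQ].
have uy : uniq (e ++ w).
  rewrite cat_uniq ue filter_uniq // andbT; apply/hasPn => v.
  by rewrite mem_filter => /andP[_ /nr]; apply: contra => /er.
have ny : all (fun y => y \notin flatten P) (e ++ w).
  by apply/allP => v; rewrite mem_cat => /orP[/ne|/wP].
have zD v : v \in z -> v \in p \/ v \in e ++ w.
  by move=> vz; case vp: (v \in p); [left | right; rewrite mem_cat mem_filter vp vz orbT].
have p'E := orient_mem pp'.
have sz : size (rev z ++ x' :: suf') <= 21.
  by move: q7; rewrite /q !size_cat size_rev /= => ?; size_lia.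
have se : size (x :: e) <= 21 by rewrite /=; size_lia.
pose cks := [:: x :: e; rev z ++ x' :: suf'].
have sck : all (sorted G) cks by rewrite /= pe sorted_around revK pz psuf.
have qE v : v \in x' :: suf' -> v \in q by rewrite /q mem_cat => ->; rewrite orbT.
have x'q : x' \in q by apply: qE; rewrite inE eqxx.
have image n' (G' : sgraph 'I_n') (P' Q' : coll 'I_n') (f : 'I_n -> 'I_n') (D : seq 'I_n) :
    admissible G' P' -> {in D &, injective f} -> {subset p ++ e ++ w <= D} ->
    takes P' (map f p) Q' -> all (fun y => y \notin flatten P') (map f (e ++ w)) ->
    all (sorted G') (map (map f) cks) ->
    extension G' P' (f x) (map f e) /\ extension G' (map f r :: Q') (f x') (map f z).
  move=> aP' injf pD tk' nf /=; rewrite map_cat map_rev /= sorted_around revK andbT.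
  case/and3P=> pe' pz' _.
  have zD' v : v \in z -> v \in D.
    by move=> /zD[vp|vw]; apply: pD; rewrite mem_cat ?vp // vw orbT.
  have rD v : v \in r -> v \in D.
    by move=> /rpe H; apply: pD; rewrite catA mem_cat H.
  have eD v : v \in e -> v \in D by move=> /er/rD.
  split; apply: extension_intro => //.
  - by rewrite map_inj_in_uniq // => u v /eD ? /eD ?; apply: injf.
  - by move: nf; rewrite map_cat all_cat => /andP[].
  - by rewrite map_inj_in_uniq // => u v /zD' ? /zD' ?; apply: injf.
  rewrite all_map; apply/allP => v vz; rewrite /= mem_cat negb_or; apply/andP; split.
    apply: contra (nr v vz) => /mapP[u ur uv].
    by rewrite (injf v u _ _ uv) //; [apply: zD' | apply: rD].
  have [fP' _] := andP aP'; move: fP'; rewrite feasibleE => /andP[+ _].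
  rewrite (perm_uniq (takes_perm tk')) cat_uniq => /and3P[_ /hasPn D' _].
  have [vp|vw] := zD v vz.
    by apply: contraL (map_f f vp) => /D'.
  have /(allP nf) := map_f f vw.
  by rewrite (perm_mem (takes_perm tk')) mem_cat => /norP[].
have sizeyz : size (e ++ w) = size e + size w by rewrite size_cat.
(* The Rep acts on the replaced path itself, so that one path is chosen, or on another one, so that
   two are. *)
case: (takes_cons tk2) => [[rq QQ2] | [Q0 tQ Q2E]].
  have x'r : x' \in r by case: rq => ->; rewrite ?mem_rev.
  have qpe v : v \in q -> v \in p ++ e.
    by move=> vq; apply: rpe; case: rq => ->; rewrite ?mem_rev.
  rewrite x'r in cnt.
  apply: (@make_rule 4 n G P [:: p'] Q (e ++ w) cks [:: rev z ++ x' :: suf']) => //.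
  - move=> v; rewrite /= !cats0 [v \in p' ++ _]mem_cat p'E.
    rewrite -[x :: e ++ _]/((x :: e) ++ (rev z ++ x' :: suf')).
    have zx : v \in rev z ++ x' :: suf' -> (v \in p) || (v \in e ++ w).
      rewrite mem_cat mem_rev => /orP[/zD[->|->]|/qE/qpe]; rewrite ?orbT //.
      by rewrite mem_cat [v \in e ++ w]mem_cat => /orP[] ->; rewrite ?orbT.
    rewrite mem_cat => /orP[/zx //|]; rewrite mem_cat => /orP[|/zx //].
    rewrite inE => /orP[/eqP->|ve]; last by rewrite [v \in e ++ w]mem_cat ve orbT.
    by rewrite /p mem_cat inE eqxx orbT.
  - by rewrite /= sizeyz; move: cnt; rewrite -/w => ?; size_lia.
  - by rewrite /= sz se.
  move=> n' G' P' Q' f aP' injf PE' nf sf; have tk' := takes_map pp' PE'.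
  have [|exte' extz'] := image _ _ _ _ _ _ aP' injf _ tk' nf sf.
    by move=> v; rewrite mem_cat /= cats0 [v \in p' ++ _]mem_cat p'E.
  exists (map f (rev z ++ x' :: suf') :: Q') => //.
  apply: (wrap n' G' P' Q' f tk' exte'); first by rewrite x'r.
  exists (map f pre'), (map f suf'), Q'; split=> //.
  - rewrite -[_ :: map f suf']/(map f (x' :: suf')) -map_cat -/q.
    by case: rq => ->; [left | right; rewrite map_rev].
  - by move: half'; rewrite /q !size_cat /= !size_map.
  - by rewrite !size_map.
  by rewrite map_cat map_rev.
have x'Q : x' \in flatten Q by rewrite (perm_mem (takes_perm tQ)) mem_cat x'q.
have x'r : x' \notin r.
  apply/negP => /rpe; rewrite mem_cat => /orP[xp|/ne].
    by move: up; rewrite cat_uniq => /and3P[_ /hasPn/(_ _ x'Q)]; rewrite /= xp.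
  by rewrite memP x'Q orbT.
rewrite (negbTE x'r) in cnt.
have [q' QE qq'] := takes_orient tQ; have q'E := orient_mem qq'.
have PE2 : perm_eq P ([:: p'; q'] ++ Q0).
  by apply: (perm_trans PE); rewrite perm_cons.
apply: (@make_rule 4 n G P [:: p'; q'] Q0 (e ++ w) cks [:: rev z ++ x' :: suf'; r]) => //.
- move=> v vf; have H : [|| v \in p, v \in q, v \in e | v \in w].
    have zx : v \in rev z ++ x' :: suf' -> [|| v \in p, v \in q, v \in e | v \in w].
      rewrite mem_cat mem_rev => /orP[/zD[->|]|/qE ->]; rewrite ?orbT //.
      by rewrite mem_cat => /orP[] ->; rewrite ?orbT.
    have fE : flatten ([:: rev z ++ x' :: suf'; r] ++ cks)
        = (rev z ++ x' :: suf') ++ r ++ (x :: e) ++ (rev z ++ x' :: suf').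
      by rewrite /= cats0.
    move: vf; rewrite fE mem_cat => /orP[/zx //|].
    rewrite mem_cat => /orP[/rpe|].
      by rewrite mem_cat => /orP[] ->; rewrite ?orbT.
    rewrite mem_cat => /orP[|/zx //].
    rewrite inE => /orP[/eqP->|->]; last by rewrite !orbT.
    by rewrite /p mem_cat inE eqxx !orbT.
  have -> : flatten [:: p'; q'] ++ (e ++ w) = p' ++ q' ++ e ++ w by rewrite /= cats0 -!catA.
  by rewrite mem_cat p'E [v \in q' ++ _]mem_cat q'E [v \in e ++ w]mem_cat.
- by rewrite /= sizeyz; move: cnt; rewrite -/w => ?; size_lia.
- by rewrite /= sz se (leq_trans r7).
move=> n' G' P' Q' f aP' injf PE' nf sf.
have tk' : takes P' (map f p) (map f q' :: Q') := takes_map pp' PE'.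
have [|exte' extz'] := image _ _ _ _ _ _ aP' injf _ tk' nf sf.
  move=> v; have -> : flatten [:: p'; q'] ++ (e ++ w) = p' ++ q' ++ e ++ w by rewrite /= cats0 -!catA.
  by rewrite mem_cat [v \in p' ++ _]mem_cat p'E [v \in q' ++ _]mem_cat => /orP[] ->; rewrite ?orbT.
exists (map f (rev z ++ x' :: suf') :: map f r :: Q') => //.
apply: (wrap n' G' P' (map f q' :: Q') f tk' exte').
  move=> nx _ /=; apply/orP; left; case: qq' => ->; first exact: near_end_map.
  by rewrite map_rev near_end_rev; apply: near_end_map.
exists (map f pre'), (map f suf'), (map f r :: Q'); split=> //.
- rewrite -[_ :: map f suf']/(map f (x' :: suf')) -map_cat -/q.
  by case: qq' => ->; [left | right; rewrite -map_rev]; apply: perm_cons_swap.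
- by move: half'; rewrite /q !size_cat /= !size_map.
- by rewrite !size_map.
by rewrite map_cat map_rev.
Qed.

(** At the first two vertices Rep would apply; at the third one a single uncovered neighbor already
    allows a DoubleRep together with the center. *)
Lemma short_fresh_walk pre x suf Q v y1 y2 : rep_free G P -> (forall P', ~ double_rep G P P') ->
  takes P (pre ++ x :: suf) Q -> size pre = 3 -> size suf = 3 -> v \in pre ->
  y1 \notin flatten P -> y2 \notin flatten P -> y1 != y2 -> G v y1 -> G y1 y2 = false.
Proof.
move=> rf nd; case: pre => [|u0 [|u1 [|u2 [|//]]]] //; case: suf => [|v2 [|v1 [|v0 [|//]]]] //.
move=> tk _ _; rewrite !inE => vp n1 n2 y12 vy; apply/negP => yy.
have tk' : takes P [:: v0; v1; v2; x; u2; u1; u0] Q := takes_rev tk.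
case/or3P: vp => /eqP vE; subst v.
- have := @rep_free_size _ G P [::] u0 [:: u1; u2; x; v2; v1; v0] Q [:: y1] rf tk isT.
  by rewrite /extension /= vy n1 => /(_ isT).
- have := @rep_free_size _ G P [:: u0] u1 [:: u2; x; v2; v1; v0] Q [:: y1; y2] rf tk isT.
  by rewrite /extension /= vy yy n1 n2 inE y12 => /(_ isT).
apply: (nd (([:: v0; v1; v2] ++ [:: x]) :: (rev [:: y1] ++ u2 :: [:: u1; u0]) :: Q)).
exists [:: v0; v1; v2], x, [::], u2, [:: u1; u0], Q, [::], [:: y1]; split=> //.
by split=> //; rewrite /extension /= vy n1.
Qed.

Lemma near_end_front (w : 'I_n) pre suf : size pre <= 1 -> near_end w (pre ++ w :: suf).
Proof. by case: pre => [|a [|//]] _; rewrite /near_end /= ?inE eqxx ?orbT. Qed.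

Lemma look_ahead_rule : (forall j, j < 4 -> ~ applicable G j P) ->
  applicable G 4 P -> good_rule 4.
Proof.
move=> low [P1 /look_ahead_case[pre [x [suf [Q [e [tk [half t23] ext se la]]]]]]].
have rf : rep_free G P by move=> P' op; apply: (low 1 isT); exists P'.
have nd P' : ~ double_rep G P P' by move=> op; apply: (low 2 isT); exists P'.
have na P' : ~ add G P P' by move=> op; apply: (low 0 isT); exists P'.
have [fP smP] := andP aP; have s47 := takes_sizes aP tk.
have memP v : (v \in flatten P) = (v \in pre ++ x :: suf) || (v \in flatten Q).
  by rewrite (perm_mem (takes_perm tk)) mem_cat.
have pre3 : size pre <= 3 by move: t23; rewrite !inE => /orP[] /eqP->.
have smQ : all (fun p => size p <= 7) Q.
  by move: smP; rewrite (takes_small tk) => /andP[].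
case: la => [[P2 [x' [z0 [pre' [suf' [Q2 [tk2 half' extz0 le0 _]]]]]]] | ].
  set r := rev e ++ x :: suf in tk2 extz0.
  have [fP1 _] := look_ahead_swap tk ext se fP.
  have sr : size r = size (pre ++ x :: suf) by rewrite /r !size_cat size_rev se.
  have aP1 : admissible G (r :: Q).
    by rewrite /admissible fP1 /= sr smQ andbT; case/andP: s47.
  have /andP[q4 q7] := takes_sizes aP1 tk2.
  have psuf : path G x' suf'.
    by have := takes_sorted aP1 tk2; rewrite sorted_around => /andP[].
  pose z := take (size pre').+1 z0.
  have extz : extension G (r :: Q) x' z := extension_take _ extz0.
  have sz : size z = (size pre').+1 by rewrite /z size_takel.
  have pre'3 : size pre' <= 3 by size_lia.
  have /and3P[pz uz /allP nz] := extz.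
  have zr v : v \in z -> v \notin r by move=> /nz; rewrite /= mem_cat => /norP[].
  have zQ v : v \in z -> v \notin flatten Q by move=> /nz; rewrite /= mem_cat => /norP[].
  set F := [seq v <- z | v \notin pre ++ x :: suf].
  have Fz : size F <= size z by rewrite size_filter count_size.
  have full : size F = size z -> all (fun y => y \notin flatten P) z.
    move=> E; have /eqP : count (fun v => v \notin pre ++ x :: suf) z = size z by rewrite -size_filter.
    rewrite -all_count => /allP H; apply/allP => v vz.
    by rewrite memP negb_or (H v vz) zQ.
  (* The bounds 3 on [e] and 4 on [z] alone would allow 3 + 4 + 1 choices for a Rep on the same path
     and 3 + 4 + 2 on another one. *)
  have cnt : size e + size F + (if x' \in r then 1 else 2) <= 7.
    case x'r: (x' \in r).
      (* Four uncovered vertices in [z] would form a 4-path for Add. *)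
      have : size F = 4 -> size pre <= 2.
        move=> F4; have z4 : size z = 4 by size_lia.
        exfalso; apply: (na (z :: P)); exists z; split=> //.
          by rewrite /gpath uz; have := pz; case: (z) => //= a s /andP[].
        by apply: full; rewrite F4 z4.
      by rewrite se; move: (size F) Fz sz pre3 pre'3 => k; clear; lia.
    (* If [z] avoided the freed vertices, the Rep would already apply to [P]. *)
    have Flt : size F < size z.
      rewrite ltn_neqAle Fz andbT; apply/eqP => /full nzP.
      have [[rq _]|[Q0 tQ _]] := takes_cons tk2.
        move/negbT: x'r; case: rq => ->; rewrite ?mem_rev mem_cat inE eqxx orbT //.
      have [p' PE pp'] := takes_orient tk.
      have tP : exists Q3, takes P (pre' ++ x' :: suf') Q3.
        exists (p' :: Q0); case: tQ => QE; [left | right].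
          apply: (perm_trans PE); apply: (@perm_trans _ (p' :: (pre' ++ x' :: suf') :: Q0)).
            by rewrite perm_cons.
          exact: perm_cons_swap.
        apply: (perm_trans PE); apply: (@perm_trans _ (p' :: rev (pre' ++ x' :: suf') :: Q0)).
          by rewrite perm_cons.
        exact: perm_cons_swap.
      have [Q3 tk3] := tP.
      have extP : extension G P x' z by rewrite /extension pz uz.
      by have := rep_free_size rf tk3 half' extP; rewrite sz ltnn.
    (* Otherwise exactly one of the four vertices of [z] lies in [pre], and on one side of it [z]
       continues with two uncovered vertices. *)
    suff : size F = 3 -> size pre <= 2.
      by rewrite se; move: (size F) Flt sz pre3 pre'3 => k; clear; lia.
    move=> F3; rewrite leqNgt; apply/negP => p3.
    have p3' : size pre = 3 by size_lia.
    have s3 : size suf = 3 by move: half s47; rewrite size_cat /= => ? /andP[_ ?]; size_lia.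
    have z4 : size z = 4 by size_lia.
    have rest v : v \in z -> v \notin pre ++ x :: suf -> v \notin flatten P.
      by move=> vz vp; rewrite memP negb_or vp zQ.
    have inpre v : v \in z -> v \in pre ++ x :: suf -> v \in pre.
      move=> /zr; rewrite /r !mem_cat negb_or => /andP[_ /negbTE->].
      by rewrite orbF.
    have sw := short_fresh_walk rf nd tk p3' s3.
    move: F3 z4 pz uz rest inpre; rewrite /F; clear -sw.
    case: z => [|z1 [|z2 [|z3 [|z4 [|//]]]]] //= F3 _ /and5P[_ z12 z23 z34 _].
    rewrite !inE !negb_or => /and4P[/and3P[n12 n13 n14] /andP[n23 n24] n34 _] rest inpre.
    have R k : k \in [:: z1; z2; z3; z4] -> k \notin pre ++ x :: suf -> k \notin flatten P := rest k.
    have m1 : z1 \in [:: z1; z2; z3; z4] by rewrite !inE eqxx ?orbT.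
    have m2 : z2 \in [:: z1; z2; z3; z4] by rewrite !inE eqxx ?orbT.
    have m3 : z3 \in [:: z1; z2; z3; z4] by rewrite !inE eqxx ?orbT.
    have m4 : z4 \in [:: z1; z2; z3; z4] by rewrite !inE eqxx ?orbT.
    case i1: (z1 \in pre ++ x :: suf) F3; case i2: (z2 \in pre ++ x :: suf) => //=;
      case i3: (z3 \in pre ++ x :: suf) => //=; case i4: (z4 \in pre ++ x :: suf) => //= _.
    + have := sw z1 z2 z3 (inpre _ m1 i1) (R _ m2 (negbT i2)) (R _ m3 (negbT i3)) n23 z12.
      by rewrite z23.
    + have := sw z2 z3 z4 (inpre _ m2 i2) (R _ m3 (negbT i3)) (R _ m4 (negbT i4)) n34 z23.
      by rewrite z34.
    + have := sw z3 z2 z1 (inpre _ m3 i3) (R _ m2 (negbT i2)) (R _ m1 (negbT i1)).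
      by rewrite eq_sym adjC z23 [G z2 z1]adjC z12 => /(_ n12 isT).
    have := sw z4 z3 z2 (inpre _ m4 i4) (R _ m3 (negbT i3)) (R _ m2 (negbT i2)).
    by rewrite eq_sym adjC z34 [G z3 z2]adjC z23 => /(_ n23 isT).
  apply: (look_ahead_pattern tk ext _ _ _ _ q7 tk2 half' psuf extz _ cnt).
  - by rewrite se.
  - move=> v; rewrite /r !mem_cat mem_rev => /orP[->|->]; rewrite ?orbT //.
  - by move=> v ve; rewrite /r mem_cat mem_rev ve.
  - by rewrite sr; case/andP: s47.
  - by rewrite sz leqnn /=; size_lia.
  move=> n' G' P' Q' f tk' ext' _ P'' R.
  exists (map f pre), (f x), (map f suf), Q', (map f e); split=> //.
  - by move: tk'; rewrite map_cat.
  - by move: half t23; rewrite !size_cat /= !size_map.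
  - by rewrite !size_map.
  left; exists (map f r); split; first by left; rewrite /r map_cat map_rev.
  by exists (f x'), (map f z).
case=> p2 s3 [w [h [hE wH R]]].
set r := pre ++ x :: e in R.
have [fP2 _] := look_ahead_ii_near tk ext se fP p2 s3.
have e2 : size e = 2 by rewrite se.
have sr : size r = 5 by rewrite /r size_cat /= p2 e2.
have aP2 : admissible G (r :: Q) by rewrite /admissible fP2 /= sr smQ.
have [pre' [suf' [Q2 [tk2 pre'1 exth leh _]]]] :=
  near_end_rep fP2 (look_ahead_ii_end x p2 e2 wH) R.
have /andP[q4 q7] := takes_sizes aP2 tk2.
have psuf : path G w suf'.
  by have := takes_sorted aP2 tk2; rewrite sorted_around => /andP[].
have h3 : size h = 3 by case: hE => ->; rewrite ?size_rev.
have hp v : v \in h -> v \in pre ++ x :: suf.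
  move=> vh; rewrite mem_cat inE; apply/orP; right; apply/orP; right.
  by move: vh; case: hE => ->; rewrite ?mem_rev.
have half' : size pre' < uphalf (size (pre' ++ w :: suf')) by size_lia.
apply: (look_ahead_pattern tk ext _ _ _ _ q7 tk2 half' psuf exth).
- by rewrite se.
- by move=> v; rewrite /r !mem_cat !inE => /or3P[] ->; rewrite ?orbT.
- by move=> v ve; rewrite /r mem_cat inE ve !orbT.
- by rewrite sr.
- by rewrite leh h3.
(* The extension used by this Rep is half of the old path, so it needs no loop. *)
- have -> : [seq v <- h | v \notin pre ++ x :: suf] = [::].
    by apply/eqP; rewrite -size_eq0 size_filter -leqn0 leqNgt -has_count; apply/hasPn => v /hp ->.
  by rewrite e2; case: (_ \in _).
move=> n' G' P' Q' f tk' ext' nearQ P'' R'.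
exists (map f pre), (f x), (map f suf), Q', (map f e); split=> //.
- by move: tk'; rewrite map_cat.
- by move: half t23; rewrite !size_cat /= !size_map.
- by rewrite !size_map.
right; split; rewrite ?size_map //; exists (f w), (map f h); split.
- by case: hE => ->; [left | right; rewrite map_rev].
- case wr: (w \in r); last first.
    by apply/or3P; apply: Or33; apply: nearQ; rewrite ?wr //; apply: near_end_front.
  have := near_end_takes fP2 tk2 _ wr; rewrite inE eqxx pre'1 => /(_ isT).
  rewrite /near_end /r rev_cat rev_cons cat_rcons take_size_cat // take_size_cat ?size_rev //.
  by rewrite mem_rev => /orP[] H; rewrite (map_f f H) ?orbT.
by move: R'; rewrite /r map_cat.
Qed.

End OperationRules.

Lemma complete_rules_exist : exists L, complete_rules L.
Proof.
have good i n (G : sgraph 'I_n) P : admissible G P -> applicable G i P ->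
    (forall j, j < i -> ~ applicable G j P) ->
    exists2 r, r \in universe /\ valid_rule i r & fires G P r.
  move=> aP; case: i => [|[|[|[|[|i]]]]] app low.
  - exact: add_rule.
  - exact: rep_rule.
  - exact: double_rep_rule.
  - exact: recover_rule.
  - exact: look_ahead_rule.
  by case: app => P'; rewrite /operation /= nth_nil.
have filt i := classical_filter (valid_rule i) universe.
have [L0 H0] := filt 0; have [L1 H1] := filt 1; have [L2 H2] := filt 2.
have [L3 H3] := filt 3; have [L4 H4] := filt 4.
exists (nth [::] [:: L0; L1; L2; L3; L4]) => i.
have HL : forall r, r \in nth [::] [:: L0; L1; L2; L3; L4] i <->
    (r \in universe /\ valid_rule i r) /\ i < 5.
  move=> r; case: i => [|[|[|[|[|i]]]]] /=.
  - by split=> [/H0|[/H0]].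
  - by split=> [/H1|[/H1]].
  - by split=> [/H2|[/H2]].
  - by split=> [/H3|[/H3]].
  - by split=> [/H4|[/H4]].
  by rewrite nth_nil; split=> [|[]].
split=> [r /HL[[]] // | n G P aP app low].
have i5 : i < 5.
  rewrite ltnNge; apply/negP => i5; case: app => P'.
  by rewrite /operation nth_default.
have [r ru fr] := good i n G P aP app low.
by exists r => //; apply/HL.
Qed.

Lemma terminal_output_ratio (T : finType) (G : sgraph T) (s : seq (coll T)) :
  complete_execution G s -> feasible G (output s) /\
  (forall m, is_opt G m -> m <= 2 * #|covered (output s)|).
Proof.
case=> /output_admissible aP tP; split; first by case/andP: aP.
by move=> m [[Q fQ <-] _]; apply: terminal_ratio fQ.
Qed.

Theorem theorem2 :
  (* running time O(|V|^8) *)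
  (exists C n0 : nat,
    (exists c : cmd, forall (n : nat) (G : sgraph 'I_n),
      exists (s : seq (coll 'I_n)) (m : memory) (t : nat),
        [/\ complete_execution G s,
            exec G c mem0 m (encode_execution s) t
          & n0 <= n -> t <= C * n ^ 8]) /\
    (forall (n : nat) (G : sgraph 'I_n) (s : seq (coll 'I_n)),
      execution G s -> n0 <= n -> size s <= C * n ^ 8)) /\
  (* approximation guarantee *)
  (forall (T : finType) (G : sgraph T) (s : seq (coll T)),
    complete_execution G s ->
    feasible G (output s) /\
    (forall m : nat, is_opt G m -> m <= 2 * #|covered (output s)|)) /\
  (* lower bound 16/9 on the performance ratio *)
  (exists (T : finType) (G : sgraph T) (s : seq (coll T)) (m : nat),
    [/\ complete_execution G s, is_opt G m, 0 < m
      & 16 * #|covered (output s)| = 9 * m]).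
Proof.
have [L HL] := complete_rules_exist; have [C HC] := program_spec HL.
split; last by split; [exact: terminal_output_ratio | exact: tight_ratio].
(* The 3 serves the bound [3 * n] on the number of steps, and [n <= n ^ 8] from order 1 on. *)
exists (maxn C 3), 1; split.
  exists (program L) => n G; have [s [m [t [cs ex le]]]] := HC n G.
  exists s, m, t; split=> // /le le'; apply: leq_trans le' _.
  by rewrite leq_mul2r leq_maxl orbT.
move=> n G s /execution_size; rewrite card_ord => le n1; apply: leq_trans le _.
rewrite -[X in 3 * X]expn1; apply: leq_mul; first exact: leq_maxr.
by rewrite leq_pexp2l.
Qed.
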